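(* Let $K$ be a field of characteristic $0$. Let $Q$ be the quiver with one vertex and two loops $a$ and $b$, and let $A=KQ/I$ with $I=(a^2,\ ab+b^2+b^2a)$. Let $\tau_2:=\tau\,\Omega^1$, and let $$M:=DA\oplus \tau_2 DA\oplus \tau_2^2 DA\oplus \tau_2^3 DA\oplus \tau_2^4 DA .$$ Then $M$ is a $2$-cluster tilting $A$-module.
   Context: All algebras are finite dimensional over $K$ and modules are finitely generated right modules; $\mathrm{mod}\,A$ denotes the category of such modules. Paths in $KQ$ are multiplied left to right: $ab$ is the path ''first $a$, then $b$''. $D=\operatorname{Hom}_K(-,K)$ is the standard duality, so $DA$ is the injective cogenerator (the dual of the regular module). $\Omega^1$ denotes the first syzygy (kernel of a projective cover) and $\tau=D\operatorname{Tr}$ is the Auslander–Reiten translate. An $A$-module $M$ is called $n$-cluster tilting ($n\ge1$) if $$\operatorname{add}M=\{X\in\mathrm{mod}\,A\mid \operatorname{Ext}^i_A(X,M)=0\ \forall\,0<i<n\}=\{X\in\mathrm{mod}\,A\mid \operatorname{Ext}^i_A(M,X)=0\ \forall\,0<i<n\}.$$ *)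

(* Defs.v *)
(* Finite-dimensional right A-modules, A = KQ/I with Q one
   vertex and two loops a, b, I = (a^2, ab + b^2 + b^2 a), encoded as
   representations: a pair of square matrices (X, Y) acting on ROW vectors
   (v . a = v *m X, v . b = v *m Y), so the path ab ("first a then b") acts by
   X *m Y. *)
From HB Require Import structures.
From mathcomp Require Import all_boot all_algebra.
Unset Printing Implicit Defensive.
Import GRing.Theory.
Local Open Scope ring_scope.

Section Defs.
Context {K : fieldType}.

Definition rels n (X Y : 'M[K]_n) : bool :=
  (X *m X == 0) && (X *m Y + Y *m Y + Y *m Y *m X == 0).
Arguments rels {n}.

(* A finite-dimensional A-module (right module: row action).  The same data,
   read with COLUMN action (a . c = X *m c), is a left A-module; the relation
   matrix polynomial is the same in both readings. *)
Record rep := Rep { rdim : nat; ra : 'M[K]_rdim; rb : 'M[K]_rdim;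
                    rrels : rels ra rb }.

Lemma dsum_rels (V W : rep) :
  rels (block_mx (ra V) 0 0 (ra W)) (block_mx (rb V) 0 0 (rb W)).
Proof.
move: (rrels V) (rrels W) => /andP[/eqP h1 /eqP h2] /andP[/eqP h1' /eqP h2'].
rewrite /rels /= !mulmx_block !(mulmx0, mul0mx, addr0, add0r) h1 h1'.
by rewrite !add_block_mx !(addr0, add0r) h2 h2' block_mx0 !eqxx.
Qed.

Definition dsum (V W : rep) : rep := @Rep (rdim V + rdim W) _ _ (dsum_rels V W).

Definition rhom (V W : rep) (f : 'M[K]_(rdim V, rdim W)) : bool :=
  (ra V *m f == f *m ra W) && (rb V *m f == f *m rb W).

Definition lhom (V W : rep) (f : 'M[K]_(rdim W, rdim V)) : bool :=
  (f *m ra V == ra W *m f) && (f *m rb V == rb W *m f).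

(* R is the right regular module A_A, with e playing the role of 1:
   R is free of rank one on e. *)
Definition rgen (R : rep) (e : 'rV[K]_(rdim R)) : Prop :=
  forall (W : rep) (w : 'rV[K]_(rdim W)),
    exists! f : 'M[K]_(rdim R, rdim W), rhom R W f /\ e *m f = w.

(* V, read as a left module (columns), is the left regular module _A A. *)
Definition lgen (V : rep) (e : 'cV[K]_(rdim V)) : Prop :=
  forall (W : rep) (w : 'cV[K]_(rdim W)),
    exists! f : 'M[K]_(rdim W, rdim V), lhom V W f /\ f *m e = w.

(* DA = D(_A A): the K-dual of the left module given by column action of
   (X, Y) on K^n is the right module given by row action of (X, Y) on the
   dual row vectors.  Hence V (read as a right module) is DA iff V read as a
   left module is the left regular module. *)
Definition is_DA (V : rep) : Prop := exists e, lgen V e.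

Definition rproj (P : rep) : Prop :=
  forall (W W' : rep) (g : 'M[K]_(rdim W, rdim W')) (h : 'M[K]_(rdim P, rdim W')),
    rhom W W' g -> row_full g -> rhom P W' h ->
    exists h' : 'M[K]_(rdim P, rdim W), rhom P W h' /\ h' *m g = h.

(* projective cover: surjection from a projective with superfluous kernel
   (every submodule im h with im h + ker p = P is all of P) *)
Definition proj_cover (P X : rep) (p : 'M[K]_(rdim P, rdim X)) : Prop :=
  [/\ rproj P, rhom P X p, row_full p &
      forall (Q : rep) (h : 'M[K]_(rdim Q, rdim P)),
        rhom Q P h -> row_full (h *m p) -> row_full h].

Definition syzygy (X N : rep) : Prop :=
  exists (P : rep) (p : 'M[K]_(rdim P, rdim X)) (i : 'M[K]_(rdim N, rdim P)),
    [/\ proj_cover P X p, rhom N P i, row_free i & (i == kermx p)%MS].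

Definition min_pres (X P1 P0 : rep) (f : 'M[K]_(rdim P1, rdim P0))
    (p : 'M[K]_(rdim P0, rdim X)) : Prop :=
  [/\ proj_cover P0 X p, rproj P1, rhom P1 P0 f, (f == kermx p)%MS &
      forall (Q : rep) (h : 'M[K]_(rdim Q, rdim P1)),
        rhom Q P1 h -> (h *m f == f)%MS -> row_full h].

(* H (read as a left module) with the basis B is a coordinatization of the
   left A-module Hom_A(P, A_A), where R = A_A and La, Lb are the matrices of
   left multiplication by a, b on R, so that (a . h) = h *m La. *)
Definition hom_coords (P R : rep) (La Lb : 'M[K]_(rdim R)) (H : rep)
    (B : 'I_(rdim H) -> 'M[K]_(rdim P, rdim R)) : Prop :=
  [/\ forall j, rhom P R (B j),
      row_free (\matrix_(j < rdim H) mxvec (B j)),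
      forall h, rhom P R h -> (mxvec h <= \matrix_(j < rdim H) mxvec (B j))%MS,
      forall j, B j *m La = \sum_i ra H i j *: B i &
      forall j, B j *m Lb = \sum_i rb H i j *: B i].

(* T is (isomorphic to) tau X = D Tr X.  With a minimal presentation
   P1 --f--> P0 --> X --> 0, Tr X = Coker (Hom_A(f, A) : Hom_A(P0,A) -> Hom_A(P1,A))
   (F is the matrix of Hom_A(f,A) in the chosen coordinates), so
   D Tr X = Ker (D F : D Hom_A(P1,A) -> D Hom_A(P0,A)), i.e. the row kernel of F
   inside the right module D H1 (= H1 read with row action). *)
Definition is_tau (X T : rep) : Prop :=
  exists (R : rep) (e : 'rV[K]_(rdim R)) (La Lb : 'M[K]_(rdim R))
         (P1 P0 : rep) (f : 'M[K]_(rdim P1, rdim P0)) (p : 'M[K]_(rdim P0, rdim X))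
         (H1 : rep) (B1 : 'I_(rdim H1) -> 'M[K]_(rdim P1, rdim R))
         (H0 : rep) (B0 : 'I_(rdim H0) -> 'M[K]_(rdim P0, rdim R))
         (F : 'M[K]_(rdim H1, rdim H0)) (i : 'M[K]_(rdim T, rdim H1)),
    [/\ rgen R e,
        [/\ rhom R R La, e *m La = e *m ra R, rhom R R Lb & e *m Lb = e *m rb R],
        min_pres X P1 P0 f p,
        [/\ hom_coords P1 R La Lb H1 B1, hom_coords P0 R La Lb H0 B0 &
            forall j, f *m B0 j = \sum_i F i j *: B1 i] &
        [/\ rhom T H1 i, row_free i & (i == kermx F)%MS]].

Definition tau2 (X Y : rep) : Prop := exists N, syzygy X N /\ is_tau N Y.

Definition in_add (M X : rep) : Prop :=
  exists k (i : 'I_k -> 'M[K]_(rdim X, rdim M)) (q : 'I_k -> 'M[K]_(rdim M, rdim X)),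
    (forall j, rhom X M (i j) /\ rhom M X (q j)) /\ \sum_j i j *m q j = 1%:M.

Definition ext1_zero (X Y : rep) : Prop :=
  forall (E : rep) (u : 'M[K]_(rdim Y, rdim E)) (p : 'M[K]_(rdim E, rdim X)),
    rhom Y E u -> rhom E X p -> row_free u -> row_full p -> (u == kermx p)%MS ->
    exists s : 'M[K]_(rdim X, rdim E), rhom X E s /\ s *m p = 1%:M.

(* 2-cluster tilting (n = 2, so only Ext^1 is involved) *)
Definition cluster_tilting2 (M : rep) : Prop :=
  (forall X : rep, in_add M X <-> ext1_zero X M) /\
  (forall X : rep, in_add M X <-> ext1_zero M X).

End Defs.
Arguments rep K : clear implicits.

(* Main.v *)
(** The algebra is local with basis 1, a, b, ab, ba, aba, where b^2 = aba - ab and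
    ab^2 = bab = 0.  Put N_i = tau_2^i DA for i <= 4; the dimensions are 6, 8, 5, 8, 6
    and N_4 = A.  With N_{-1} = 0 there are exact sequences
      N_i -> C_i -> D_i -> N_{i-1} -> 0,  with C_i, D_i in add M,
    in which N_i -> C_i is left almost split within add M.  If Ext^1(M, X) = 0, then
    every map C_i -> X that vanishes on N_i extends along C_i -> D_i.  Choose a minimal
    family of maps N_j -> X through which all maps N_j -> X factor.  By minimality a
    relation between its members has radical coefficients, so it factors through the
    maps N_i -> C_i; subtracting something that comes from D_i, it becomes a relation
    on C_i again.  The radical of End M is nilpotent, so the relation is zero.  As
    N_4 = A, the family is an isomorphism from a direct sum of modules N_j onto X.
    The condition on Ext^1(X, M) follows by applying this to the kernel of a right
    add M-approximation of X.

    Over an arbitrary field of characteristic 0 the modules, maps and exactness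
    certificates are images of explicit integer matrices, and all identities between
    them are checked by computation on the integers. *)
Require Import Defs.
From Stdlib Require Import ZArith Classical.
From mathcomp Require Import all_boot all_algebra.
From mathcomp.zify Require Import ssrZ.
Import GRing.Theory.
Set Implicit Arguments.
Unset Strict Implicit.
Unset Printing Implicit Defensive.
Local Open Scope ring_scope.

(** * Modules, covers and presentations *)

Section Modules.
Context {K : fieldType}.
Implicit Types V W X Y : rep K.

(** The hypotheses describe each N_i only through existentially chosen regular modules, covers,
    presentations and coordinates. The translate therefore has to be shown independent of all these
    choices before explicit matrices may stand in for N_i. Extensions are seldom handled as modules.
    A linear map between modules has a defect from being a homomorphism; such defects are cocycles,
    and Ext^1 = 0 means that every cocycle is a coboundary, so that the map can be corrected. No
    rank is computed over K. Exactness is witnessed by integer identities [f U + V g = c], which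
    survive the passage to K as long as the integer c (a cleared denominator: 1, 2 or 3) stays
    nonzero there. The almost split property comes from finite data: Hom(N_i, N_j) is spanned by
    compositions of components of the maps N_i -> C_i, and each nonempty composition starts with
    such a component. Powers of the radical are not computed either: a weight on basis vectors,
    strictly lowered by the components, bounds the length of nonzero compositions. *)

Definition act V (c : bool) : 'M[K]_(rdim V) := if c then rb V else ra V.

Lemma rhomP V W (f : 'M[K]_(rdim V, rdim W)) :
  reflect (forall c, act V c *m f = f *m act W c) (rhom V W f).
Proof.
apply: (iffP andP) => [[/eqP ha /eqP hb] [] //|h].
by split; apply/eqP; [exact: h false | exact: h true].
Qed.

Lemma rhom1 V : rhom V V 1%:M.
Proof. by apply/rhomP => c; rewrite mulmx1 mul1mx. Qed.

Lemma rhomM V W X (f : 'M[K]_(rdim V, rdim W)) (g : 'M[K]_(rdim W, rdim X)) :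
  rhom V W f -> rhom W X g -> rhom V X (f *m g).
Proof.
by move=> /rhomP hf /rhomP hg; apply/rhomP => c; rewrite mulmxA hf -!mulmxA hg.
Qed.

Lemma rhom0 V W : rhom V W 0.
Proof. by apply/rhomP => c; rewrite mulmx0 mul0mx. Qed.

Lemma rhomD V W (f g : 'M[K]_(rdim V, rdim W)) :
  rhom V W f -> rhom V W g -> rhom V W (f + g).
Proof.
by move=> /rhomP hf /rhomP hg; apply/rhomP => c; rewrite mulmxDr mulmxDl hf hg.
Qed.

Lemma rhomZ V W a (f : 'M[K]_(rdim V, rdim W)) : rhom V W f -> rhom V W (a *: f).
Proof. by move=> /rhomP hf; apply/rhomP => c; rewrite -scalemxAr hf scalemxAl. Qed.

Lemma rhomN V W (f : 'M[K]_(rdim V, rdim W)) : rhom V W f -> rhom V W (- f).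
Proof. by rewrite -scaleN1r; apply: rhomZ. Qed.

Lemma rhomB V W (f g : 'M[K]_(rdim V, rdim W)) :
  rhom V W f -> rhom V W g -> rhom V W (f - g).
Proof. by move=> hf hg; apply: rhomD => //; apply: rhomN. Qed.

Lemma rhom_sum V W (I : Type) (r : seq I) (P : pred I)
    (F : I -> 'M[K]_(rdim V, rdim W)) :
  (forall i, P i -> rhom V W (F i)) -> rhom V W (\sum_(i <- r | P i) F i).
Proof.
move=> h; apply: (big_ind (fun f : 'M_(_, _) => is_true (rhom V W f))) => //.
- exact: rhom0.
- by move=> f g; apply: rhomD.
Qed.

Lemma rhom_cancelr V W X (f : 'M[K]_(rdim V, rdim W)) (g : 'M[K]_(rdim W, rdim X)) :
  rhom W X g -> row_free g -> rhom V X (f *m g) -> rhom V W f.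
Proof.
move=> /rhomP hg fg /rhomP h; apply/rhomP => c; apply: (row_free_inj fg).
by rewrite -!mulmxA hg h mulmxA.
Qed.

Lemma rhom_cancell V W X (f : 'M[K]_(rdim V, rdim W)) (g : 'M[K]_(rdim X, rdim V)) :
  rhom X V g -> row_full g -> rhom X W (g *m f) -> rhom V W f.
Proof.
move=> /rhomP hg fg /rhomP h; apply/rhomP => c; apply: (row_full_inj fg).
by rewrite !mulmxA -hg -h mulmxA.
Qed.

Lemma rhom_inv V W (f : 'M[K]_(rdim V, rdim W)) (g : 'M[K]_(rdim W, rdim V)) :
  rhom V W f -> f *m g = 1%:M -> g *m f = 1%:M -> rhom W V g.
Proof.
move=> hf fg gf; apply: rhom_cancelr hf _ _.
  by apply/row_freeP; exists g.
by rewrite gf; apply: rhom1.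
Qed.

Lemma aa V : ra V *m ra V = 0.
Proof. by case/andP: (rrels V) => /eqP. Qed.

Lemma abbba V : ra V *m rb V + rb V *m rb V + rb V *m rb V *m ra V = 0.
Proof. by case/andP: (rrels V) => _ /eqP. Qed.

Lemma abb V : ra V *m rb V *m rb V = 0.
Proof.
have h : ra V *m rb V *m rb V + ra V *m rb V *m rb V *m ra V = 0.
  have := congr1 (mulmx (ra V)) (abbba V).
  by rewrite !mulmxDr !mulmxA aa !mul0mx add0r mulmx0.
have h1 : ra V *m rb V *m rb V *m ra V = 0.
  have := congr1 (mulmxr (ra V)) h.
  by rewrite /= mulmxDl -[X in _ + X = _]mulmxA aa mulmx0 addr0 mul0mx.
by move: h; rewrite h1 addr0.
Qed.

Lemma bba V : rb V *m rb V *m ra V = - (ra V *m rb V *m ra V).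
Proof.
have := congr1 (mulmxr (ra V)) (abbba V).
rewrite /= !mulmxDl -[X in _ + X = _]mulmxA aa mulmx0 addr0 mul0mx.
by move/eqP; rewrite addrC addr_eq0 => /eqP.
Qed.

Lemma bb V : rb V *m rb V = ra V *m rb V *m ra V - ra V *m rb V.
Proof.
have := abbba V; rewrite bba => /eqP; rewrite subr_eq0 => /eqP <-.
by rewrite addrC addKr.
Qed.

(** Computing b^3 as (bb)b and as b(bb) gives abab = baba - bab. Multiplying by a on either side
    turns this into bab = 2 baba, whence baba = 2 babaa = 0. There is no division by 2, so the
    identity holds in every characteristic. *)
Lemma bab V : rb V *m ra V *m rb V = 0.
Proof.
set x := ra V; set y := rb V.
have e1 : x *m y *m x *m y = y *m x *m y *m x - y *m x *m y.
  have : y *m y *m y = y *m (y *m y) by rewrite mulmxA.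
  by rewrite bb mulmxBl mulmxBr abb subr0 !mulmxA.
have e2 : x *m y *m x *m y *m x = x *m y *m x *m y.
  have := congr1 (mulmx x) e1.
  rewrite mulmxBr !mulmxA aa !mul0mx => /esym/eqP.
  by rewrite subr_eq0 => /eqP.
have e3 : x *m y *m x *m y *m x = - (y *m x *m y *m x).
  by rewrite e1 mulmxBl -[X in X - _]mulmxA aa mulmx0 sub0r.
have e4 : y *m x *m y = y *m x *m y *m x *+ 2.
  have := e1; rewrite -e2 e3 => h.
  by rewrite -[LHS](subKr (y *m x *m y *m x)) -h opprK mulr2n.
have e5 : y *m x *m y *m x = 0.
  by rewrite {1}e4 mulmxDl -mulmxA aa mulmx0 addr0.
by rewrite e4 e5 mul0rn.
Qed.

(* Nakayama's lemma: the radical is spanned by a, b, ab, ba and aba, hence nilpotent. *)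
Lemma nakayama V q (h : 'M[K]_(q, rdim V)) :
  (forall c, (h *m act V c <= h)%MS) -> (1%:M <= h + (ra V + rb V))%MS -> row_full h.
Proof.
move=> st h1.
(* Multiplying V = h + Va + Vb on the right by a word [M] leaves h [M], a [M] and b [M] to check, so
   the words are treated from the longest down to 1. *)
have step (M : 'M[K]_(rdim V)) : (h *m M <= h)%MS -> (ra V *m M <= h)%MS ->
    (rb V *m M <= h)%MS -> (M <= h)%MS.
  move=> hM aM bM; rewrite -(mul1mx M); apply: submx_trans (submxMr M h1) _.
  by rewrite addsmxMr addsmx_sub hM addsmxMr addsmx_sub aM bM.
have sa : (h *m ra V <= h)%MS := st false.
have sb : (h *m rb V <= h)%MS := st true.
have sM (A B : 'M[K]_(rdim V)) :
    (h *m A <= h)%MS -> (h *m B <= h)%MS -> (h *m (A *m B) <= h)%MS.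
  by move=> hA hB; rewrite mulmxA; apply: submx_trans (submxMr _ hA) hB.
have aba : (ra V *m rb V *m ra V <= h)%MS.
  apply: step; rewrite ?sM //.
    by rewrite !mulmxA aa !mul0mx sub0mx.
  by rewrite !mulmxA bab !mul0mx sub0mx.
have ab : (ra V *m rb V <= h)%MS.
  apply: step; rewrite ?sM //.
    by rewrite !mulmxA aa !mul0mx sub0mx.
  by rewrite !mulmxA bab sub0mx.
have ba : (rb V *m ra V <= h)%MS.
  apply: step; rewrite ?sM //; first by rewrite mulmxA.
  by rewrite mulmxA bba eqmx_opp.
have a1 : (ra V <= h)%MS by apply: step => //; rewrite aa sub0mx.
have b1 : (rb V <= h)%MS.
  by apply: step => //; rewrite bb addmx_sub ?eqmx_opp.
rewrite -sub1mx; apply: step; rewrite ?mulmx1 //.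
Qed.

Definition iso V W := exists (f : 'M[K]_(rdim V, rdim W)) (g : 'M[K]_(rdim W, rdim V)),
  [/\ rhom V W f, rhom W V g, f *m g = 1%:M & g *m f = 1%:M].

Lemma iso_sym V W : iso V W -> iso W V.
Proof. by move=> [f [g [hf hg fg gf]]]; exists g, f. Qed.

Lemma ker_factor V P (i : 'M[K]_(rdim V, rdim P)) m (p : 'M[K]_(rdim P, m)) Q
    (u : 'M[K]_(rdim Q, rdim P)) :
  rhom V P i -> row_free i -> (i == kermx p)%MS -> rhom Q P u -> u *m p = 0 ->
  exists2 v, rhom Q V v & u = v *m i.
Proof.
move=> hi fi /eqmxP ei hu /eqP; rewrite -sub_kermx -ei => /submxP[v uv].
exists v => //; apply: rhom_cancelr hi fi _; by rewrite -uv.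
Qed.

(** Compatible isomorphisms of the sources restrict to the kernels. The maps [p] and [p'] are plain
    matrices here because [is_tau] takes the kernel of a matrix [F] that is not presented as a
    homomorphism. *)
Lemma ker_iso P P' V V' m m' (p : 'M[K]_(rdim P, m)) (p' : 'M[K]_(rdim P', m'))
    (i : 'M[K]_(rdim V, rdim P)) (i' : 'M[K]_(rdim V', rdim P'))
    (f : 'M[K]_(rdim P, rdim P')) (g : 'M[K]_(rdim P', rdim P)) c d :
  rhom V P i -> row_free i -> (i == kermx p)%MS ->
  rhom V' P' i' -> row_free i' -> (i' == kermx p')%MS ->
  rhom P P' f -> rhom P' P g -> f *m g = 1%:M -> g *m f = 1%:M ->
  f *m p' = p *m c -> g *m p = p' *m d -> iso V V'.
Proof.
move=> hi fi ei hi' fi' ei' hf hg fg gf pc pd.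
have ip : i *m p = 0 by apply/eqP; rewrite -sub_kermx; move/eqmxP: ei => <-.
have ip' : i' *m p' = 0 by apply/eqP; rewrite -sub_kermx; move/eqmxP: ei' => <-.
have [v hv ev] : exists2 v, rhom V V' v & i *m f = v *m i'.
  by apply: (ker_factor hi' fi' ei'); rewrite ?rhomM // -mulmxA pc mulmxA ip mul0mx.
have [w hw ew] : exists2 v, rhom V' V v & i' *m g = v *m i.
  by apply: (ker_factor hi fi ei); rewrite ?rhomM // -mulmxA pd mulmxA ip' mul0mx.
exists v, w; split=> //.
  by apply: (row_free_inj fi); rewrite mul1mx -mulmxA -ew mulmxA -ev -mulmxA fg mulmx1.
by apply: (row_free_inj fi'); rewrite mul1mx -mulmxA -ev mulmxA -ew -mulmxA gf mulmx1.
Qed.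

(** A surjective endomorphism of a finite-dimensional space is invertible, so g (f g)^-1 is a
    two-sided inverse of [f]; being inverse to a homomorphism, it is one. *)
Lemma iso_of_full P P' (f : 'M[K]_(rdim P, rdim P')) (g : 'M[K]_(rdim P', rdim P)) :
  rhom P P' f -> row_full (f *m g) -> row_full (g *m f) ->
  exists2 g' : 'M[K]_(rdim P', rdim P), rhom P' P g' & f *m g' = 1%:M /\ g' *m f = 1%:M.
Proof.
move=> hf; rewrite !row_full_unit => fg gf.
have e1 : f *m (g *m invmx (f *m g)) = 1%:M by rewrite mulmxA mulmxV.
have e2 : g *m invmx (f *m g) *m f = 1%:M.
  have ff : row_full f by apply/row_fullP; exists (invmx (g *m f) *m g); rewrite -mulmxA mulVmx.
  by apply: (row_full_inj ff); rewrite mulmxA e1 mul1mx mulmx1.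
by exists (g *m invmx (f *m g)) => //; apply: rhom_inv e1 e2.
Qed.

(** Lifts exist in both directions by projectivity. Their composites are compatible with the covers,
    so superfluity of the kernels makes them surjective; the inverse of the first lift then replaces
    the second. *)
Lemma cover_iso X X' P P' p p' (phi : 'M[K]_(rdim X, rdim X')) psi :
  proj_cover P X p -> proj_cover P' X' p' ->
  rhom X X' phi -> rhom X' X psi -> phi *m psi = 1%:M -> psi *m phi = 1%:M ->
  exists f g, [/\ rhom P P' f, rhom P' P g, f *m g = 1%:M, g *m f = 1%:M &
                  f *m p' = p *m phi].
Proof.
move=> [pP hp fp sp] [pP' hp' fp' sp'] hphi hpsi e1 e2.
have [f [hf ef]] := pP P' X' p' _ hp' fp' (rhomM hp hphi).
have [g [hg eg]] := pP' P X p _ hp fp (rhomM hp' hpsi).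
have fg : row_full (f *m g).
  apply: sp; first exact: rhomM.
  by rewrite -mulmxA eg mulmxA ef -mulmxA e1 mulmx1.
have gf : row_full (g *m f).
  apply: sp'; first exact: rhomM.
  by rewrite -mulmxA ef mulmxA eg -mulmxA e2 mulmx1.
have [g' hg' [fg' gf']] := iso_of_full hf fg gf.
by exists f, g'.
Qed.

Lemma syzygy_iso X X' N N' : iso X X' -> syzygy X N -> syzygy X' N' -> iso N N'.
Proof.
move=> [phi [psi [hphi hpsi e1 e2]]] [P [p [i [cp hi fi ei]]]] [P' [p' [i' [cp' hi' fi' ei']]]].
have [f [g [hf hg fg gf pc]]] := cover_iso cp cp' hphi hpsi e1 e2.
apply: (ker_iso hi fi ei hi' fi' ei' hf hg fg gf pc (d := psi)).
by rewrite -[p in LHS]mulmx1 -e1 (mulmxA p) -pc !mulmxA gf mul1mx.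
Qed.

Section Subrep.
Variables (V : rep K) (n : nat) (u : 'M[K]_(n, rdim V)).
Hypotheses (fu : row_free u) (su : forall c, (u *m act V c <= u)%MS).

Let sact c := u *m act V c *m pinvmx u.
Let sactE c : sact c *m u = u *m act V c.
Proof. by rewrite mulmxKpV. Qed.

Lemma subrep_rels : rels n (sact false) (sact true).
Proof.
have mul2 c d : sact c *m sact d *m u = u *m (act V c *m act V d).
  by rewrite -mulmxA sactE mulmxA sactE -mulmxA.
apply/andP; split; apply/eqP; apply: (row_free_inj fu).
  by rewrite mul0mx mul2 aa mulmx0.
rewrite mul0mx !mulmxDl !mul2 -[_ *m sact false *m u]mulmxA sactE.
rewrite [X in _ + X]mulmxA mul2 -[X in _ + X]mulmxA -!mulmxDr.
by rewrite [X in u *m X]abbba mulmx0.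
Qed.

Definition subrep : rep K := Rep n _ _ subrep_rels.

Lemma subrep_hom : rhom subrep V u.
Proof. by apply/rhomP => -[]; rewrite /= sactE. Qed.
End Subrep.

Lemma ker_stable V W (f : 'M[K]_(rdim V, rdim W)) c :
  rhom V W f -> (row_base (kermx f) *m act V c <= row_base (kermx f))%MS.
Proof.
move=> /rhomP hf; rewrite eq_row_base sub_kermx -mulmxA hf mulmxA.
have : (row_base (kermx f) <= kermx f)%MS by rewrite eq_row_base.
by rewrite sub_kermx => /eqP ->; rewrite mul0mx.
Qed.

Lemma im_stable V W (f : 'M[K]_(rdim V, rdim W)) c :
  rhom V W f -> (row_base f *m act W c <= row_base f)%MS.
Proof.
move=> /rhomP hf; rewrite eq_row_base.
have /submxP[d ->] : (row_base f <= f)%MS by rewrite eq_row_base.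
by rewrite -mulmxA -hf mulmxA submxMl.
Qed.

Lemma ker_rep V W (f : 'M[K]_(rdim V, rdim W)) : rhom V W f ->
  exists N (i : 'M[K]_(rdim N, rdim V)), [/\ rhom N V i, row_free i & (i == kermx f)%MS].
Proof.
move=> hf; have fi := row_base_free (kermx f).
exists (subrep fi (fun c => ker_stable c hf)), (row_base (kermx f)).
by split=> //; [exact: subrep_hom | apply/eqmxP; apply: eq_row_base].
Qed.

(** Since [rproj] only speaks of surjections, the lift is taken along [V] onto the image of [f],
    which is a module in the coordinates of [row_base f]. *)
Lemma proj_lift P V W (f : 'M[K]_(rdim V, rdim W)) (u : 'M[K]_(rdim P, rdim W)) :
  rproj P -> rhom V W f -> rhom P W u -> (u <= f)%MS ->
  exists2 v, rhom P V v & v *m f = u.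
Proof.
move=> pP hf hu uf; have fi := row_base_free f.
set J := subrep fi (fun c => im_stable c hf); have hj : rhom J W (row_base f) := subrep_hom _ _.
have /submxP[g eg] : (f <= row_base f)%MS by rewrite eq_row_base.
have /submxP[w ew] : (u <= row_base f)%MS by rewrite eq_row_base.
have hg : rhom V J g by apply: (rhom_cancelr hj fi); rewrite -eg.
have hw : rhom P J w by apply: (rhom_cancelr hj fi); rewrite -ew.
have fg : row_full g.
  have /submxP[d ed] : (row_base f <= f)%MS by rewrite eq_row_base.
  apply/row_fullP; exists d; apply: (row_free_inj fi).
  by rewrite mul1mx -mulmxA -eg.
have [v [hv ev]] := pP V J g w hg fg hw.
by exists v => //; rewrite eg mulmxA ev -ew.
Qed.

(** On P_0 this is uniqueness of projective covers. On P_1 the two lifts exist by projectivity, and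
    since their composites preserve [f] and [f'], the last clause of [min_pres] makes these
    composites surjective. *)
Lemma pres_iso X X' P1 P1' P0 P0' f f' p p' : iso X X' ->
  min_pres X P1 P0 f p -> min_pres X' P1' P0' f' p' ->
  exists a1 b1 a0 b0,
    [/\ rhom P1 P1' a1, rhom P1' P1 b1, a1 *m b1 = 1%:M & b1 *m a1 = 1%:M] /\
    [/\ rhom P0 P0' a0, rhom P0' P0 b0, a0 *m b0 = 1%:M, b0 *m a0 = 1%:M &
        f *m a0 = a1 *m f'].
Proof.
move=> [phi [psi [hphi hpsi e1 e2]]] [cp pP1 hf /eqmxP ef mf] [cp' pP1' hf' /eqmxP ef' mf'].
have [a0 [b0 [ha0 hb0 ab0 ba0 pc]]] := cover_iso cp cp' hphi hpsi e1 e2.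
have pc' : b0 *m p = p' *m psi.
  by rewrite -[p in LHS]mulmx1 -e1 (mulmxA p) -pc !mulmxA ba0 mul1mx.
have fp : f *m p = 0 by apply/eqP; rewrite -sub_kermx -ef.
have fp' : f' *m p' = 0 by apply/eqP; rewrite -sub_kermx -ef'.
have [a1 ha1 ea1] : exists2 v, rhom P1 P1' v & v *m f' = f *m a0.
  apply: (proj_lift pP1 hf' (rhomM hf ha0)).
  by rewrite ef' sub_kermx -mulmxA pc mulmxA fp mul0mx.
have [b1 hb1 eb1] : exists2 v, rhom P1' P1 v & v *m f = f' *m b0.
  apply: (proj_lift pP1' hf (rhomM hf' hb0)).
  by rewrite ef sub_kermx -mulmxA pc' mulmxA fp' mul0mx.
have fg : row_full (a1 *m b1).
  apply: mf; first exact: rhomM.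
  by rewrite -mulmxA eb1 mulmxA ea1 -mulmxA ab0 mulmx1 submx_refl.
have gf : row_full (b1 *m a1).
  apply: mf'; first exact: rhomM.
  by rewrite -mulmxA ea1 mulmxA eb1 -mulmxA ba0 mulmx1 submx_refl.
have [b1' hb1' [ab1 ba1]] := iso_of_full ha1 fg gf.
by exists a1, b1', a0, b0; rewrite -ea1.
Qed.

Lemma rgen_inj R e W (f g : 'M[K]_(rdim R, rdim W)) :
  rgen R e -> rhom R W f -> rhom R W g -> e *m f = e *m g -> f = g.
Proof.
move=> /(_ W (e *m g)) [h [_ uh]] hf hg e1.
by rewrite -(uh f) ?(uh g).
Qed.

Lemma rgen_hom R e W (w : 'rV[K]_(rdim W)) :
  rgen R e -> exists2 f, rhom R W f & e *m f = w.
Proof. by move=> /(_ W w) [f [[hf ef] _]]; exists f. Qed.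

(** For fixed matrices, a left homomorphism from [V] to [W] is the same as a right homomorphism from
    [W] to [V]. Uniqueness of the left regular module thus yields an isomorphism of its dual right
    modules. *)
Lemma lgen_iso V e V' e' : lgen V e -> lgen V' e' -> iso V V'.
Proof.
have hl (A B : rep K) (f : 'M[K]_(rdim B, rdim A)) : lhom A B f -> rhom B A f.
  by move=> /andP[/eqP h1 /eqP h2]; apply/andP; split; apply/eqP.
have lh (A B : rep K) (f : 'M[K]_(rdim B, rdim A)) : rhom B A f -> lhom A B f.
  by move=> /andP[/eqP h1 /eqP h2]; apply/andP; split; apply/eqP.
move=> g g'.
have [f [[/hl hf ef] _]] := g V' e'; have [f' [[/hl hf' ef'] _]] := g' V e.
have e1 : f' *m f = 1%:M.
  have [x [_ ux]] := g V e; rewrite -(ux (f' *m f)) ?(ux 1%:M) //.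
    by rewrite mul1mx; split=> //; apply: lh; apply: rhom1.
  by rewrite -mulmxA ef ef'; split=> //; apply: lh; apply: rhomM.
have e2 : f *m f' = 1%:M.
  have [x [_ ux]] := g' V' e'; rewrite -(ux (f *m f')) ?(ux 1%:M) //.
    by rewrite mul1mx; split=> //; apply: lh; apply: rhom1.
  by rewrite -mulmxA ef' ef; split=> //; apply: lh; apply: rhomM.
by exists f', f.
Qed.

End Modules.

(** * Uniqueness of the Auslander-Reiten translate *)

Section Tau.
Context {K : fieldType}.
Implicit Types V W X Y P R H : rep K.

(** A family of maps times a matrix of scalars, like a row of basis vectors times a change of
    basis. *)
Definition comb m n k (B : 'I_k -> 'M[K]_(m, n)) l (M : 'M[K]_(k, l)) j :=
  \sum_i M i j *: B i.

Lemma comb_mul m n k (B : 'I_k -> 'M[K]_(m, n)) l (M : 'M[K]_(k, l)) q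
    (N : 'M[K]_(l, q)) j : \sum_i N i j *: comb B M i = comb B (M *m N) j.
Proof.
rewrite /comb; under eq_bigr => i _ do rewrite scaler_sumr.
rewrite exchange_big; apply: eq_bigr => i _; rewrite mxE scaler_suml.
by apply: eq_bigr => k' _; rewrite scalerA mulrC.
Qed.

Lemma comb1 m n k (B : 'I_k -> 'M[K]_(m, n)) j : comb B 1%:M j = B j.
Proof.
rewrite /comb (bigD1 j) //= mxE eqxx scale1r big1 ?addr0 // => i ij.
by rewrite mxE (negPf ij) scale0r.
Qed.

Lemma mxvec_comb m n k (B : 'I_k -> 'M[K]_(m, n)) l (M : 'M[K]_(k, l)) j :
  mxvec (comb B M j) = (col j M)^T *m \matrix_i mxvec (B i).
Proof.
rewrite linear_sum mulmx_sum_row; apply: eq_bigr => i _.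
by rewrite linearZ /= rowK !mxE.
Qed.

Lemma comb_inj m n k (B : 'I_k -> 'M[K]_(m, n)) l (M N : 'M[K]_(k, l)) :
  row_free (\matrix_i mxvec (B i)) -> (forall j, comb B M j = comb B N j) -> M = N.
Proof.
move=> fB h; apply/trmx_inj/row_matrixP => j; rewrite -!tr_col; apply: (row_free_inj fB).
by rewrite -!mxvec_comb h.
Qed.

Lemma comb_span m n k (B : 'I_k -> 'M[K]_(m, n)) h :
  (mxvec h <= \matrix_i mxvec (B i))%MS -> exists x : 'cV_k, h = comb B x 0.
Proof.
case/submxP => D eD; exists D^T; apply: (can_inj mxvecK).
rewrite mxvec_comb eD; congr (_ *m _); apply/rowP => i; by rewrite !mxE.
Qed.

(** Composition with [a] and [r'] is a map Hom(P', R') -> Hom(P, R), and [c] is its matrix. On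
    columns it is left linear because [r] intertwines the left multiplications; on rows it is the
    dual map D Hom(P, R) -> D Hom(P', R'). *)
Lemma coords_iso P R La Lb H B P' R' La' Lb' H' B'
    (a : 'M[K]_(rdim P, rdim P'))
    (r : 'M[K]_(rdim R, rdim R')) (r' : 'M[K]_(rdim R', rdim R)) :
  hom_coords P R La Lb H B -> hom_coords P' R' La' Lb' H' B' ->
  rhom P P' a -> rhom R' R r' -> r *m r' = 1%:M ->
  La *m r = r *m La' -> Lb *m r = r *m Lb' -> r' *m r = 1%:M ->
  exists2 c, rhom H H' c & forall j, a *m B' j *m r' = comb B c j.
Proof.
move=> [hB fB sB aB bB] [hB' fB' sB' aB' bB'] ha hr' rr la lb rr'.
have ex0 j : exists x : 'cV[K]_(rdim H), a *m B' j *m r' = comb B x 0.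
  apply: comb_span; apply: sB; exact: rhomM (rhomM ha (hB' j)) hr'.
have [x ex] := fin_all_exists ex0.
pose c := \matrix_(i, j) x j i 0.
have ec j : a *m B' j *m r' = comb B c j.
  by rewrite ex; apply: eq_bigr => i _; rewrite mxE.
have la' : r' *m La = La' *m r'.
  by rewrite -[La]mulmx1 -rr (mulmxA La) la !mulmxA rr' mul1mx.
have lb' : r' *m Lb = Lb' *m r'.
  by rewrite -[Lb]mulmx1 -rr (mulmxA Lb) lb !mulmxA rr' mul1mx.
have key (h : 'M[K]_(rdim H)) (h' : 'M[K]_(rdim H')) L L' : r' *m L = L' *m r' ->
    (forall j, B j *m L = comb B h j) -> (forall j, B' j *m L' = comb B' h' j) ->
    h *m c = c *m h'.
  move=> ll bl bl'; apply: (comb_inj fB) => j; rewrite -!comb_mul.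
  under eq_bigr => i _ do rewrite -bl scalemxAl.
  rewrite -mulmx_suml -[X in X *m L]/(comb B c j) -ec -mulmxA ll mulmxA -(mulmxA a) bl'.
  rewrite /comb mulmx_sumr mulmx_suml; apply: eq_bigr => i _.
  by rewrite -scalemxAr -scalemxAl ec.
exists c => //; apply/rhomP => -[]; [exact: key lb' bB bB' | exact: key la' aB aB'].
Qed.

Lemma tau_iso X X' T T' : iso X X' -> is_tau X T -> is_tau X' T' -> iso T T'.
Proof.
move=> hX [R [e [La [Lb [P1 [P0 [f [p [H1 [B1 [H0 [B0 [F [i [gR hL mp [c1 c0 hF] [hi fi ei]]]]]]]]]]]]]]]].
move=> [R' [e' [La' [Lb' [P1' [P0' [f' [p' [H1' [B1' [H0' [B0' [F' [i' [gR' hL' mp' [c1' c0' hF'] [hi' fi' ei']]]]]]]]]]]]]]]].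
have [a1 [b1 [a0 [b0 [[ha1 hb1 ab1 ba1] [ha0 hb0 ab0 ba0 ff]]]]]] := pres_iso hX mp mp'.
have ff' : f' *m b0 = b1 *m f.
  by rewrite -[f']mul1mx -ba1 -!mulmxA (mulmxA a1) -ff -mulmxA ab0 mulmx1.
(* [r] and [r'] exchange the two generators, so they are mutually inverse. *)
have [r hr er] := rgen_hom e' gR; have [r' hr' er'] := rgen_hom e gR'.
have rr : r *m r' = 1%:M.
  by apply: (rgen_inj gR); rewrite ?rhomM ?rhom1 // mulmxA er er' mulmx1.
have rr' : r' *m r = 1%:M.
  by apply: (rgen_inj gR'); rewrite ?rhomM ?rhom1 // mulmxA er' er mulmx1.
case: hL => [hLa eLa hLb eLb]; case: hL' => [hLa' eLa' hLb' eLb'].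
have act_r c : act R c *m r = r *m act R' c by move/rhomP: hr.
have act_r' c : act R' c *m r' = r' *m act R c by move/rhomP: hr'.
(* Both sides are homomorphisms on the regular module, so comparing them at the generator
   suffices. *)
have la : La *m r = r *m La'.
  apply: (rgen_inj gR); rewrite ?rhomM // !mulmxA eLa er eLa' -mulmxA.
  by rewrite (act_r false) mulmxA er.
have lb : Lb *m r = r *m Lb'.
  apply: (rgen_inj gR); rewrite ?rhomM // !mulmxA eLb er eLb' -mulmxA.
  by rewrite (act_r true) mulmxA er.
have la' : La' *m r' = r' *m La.
  apply: (rgen_inj gR'); rewrite ?rhomM // !mulmxA eLa' er' eLa -mulmxA.
  by rewrite (act_r' false) mulmxA er'.
have lb' : Lb' *m r' = r' *m Lb.
  apply: (rgen_inj gR'); rewrite ?rhomM // !mulmxA eLb' er' eLb -mulmxA.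
  by rewrite (act_r' true) mulmxA er'.
have [x1 hx1 ex1] := coords_iso c1 c1' ha1 hr' rr la lb rr'.
have [y1 hy1 ey1] := coords_iso c1' c1 hb1 hr rr' la' lb' rr.
have [x0 hx0 ex0] := coords_iso c0 c0' ha0 hr' rr la lb rr'.
have [y0 hy0 ey0] := coords_iso c0' c0 hb0 hr rr' la' lb' rr.
have xy1 : x1 *m y1 = 1%:M.
  have [_ fB _ _ _] := c1; apply: (comb_inj fB) => j; rewrite comb1 -comb_mul.
  under eq_bigr => k _ do rewrite -ex1.
  have -> : \sum_k y1 k j *: (a1 *m B1' k *m r') = a1 *m comb B1' y1 j *m r'.
    rewrite /comb mulmx_sumr mulmx_suml; apply: eq_bigr => k _.
    by rewrite -scalemxAr -scalemxAl.
  by rewrite -ey1 !mulmxA ab1 mul1mx -mulmxA rr mulmx1.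
have yx1 : y1 *m x1 = 1%:M.
  have [_ fB _ _ _] := c1'; apply: (comb_inj fB) => j; rewrite comb1 -comb_mul.
  under eq_bigr => k _ do rewrite -ey1.
  have -> : \sum_k x1 k j *: (b1 *m B1 k *m r) = b1 *m comb B1 x1 j *m r.
    rewrite /comb mulmx_sumr mulmx_suml; apply: eq_bigr => k _.
    by rewrite -scalemxAr -scalemxAl.
  by rewrite -ex1 !mulmxA ba1 mul1mx -mulmxA rr' mulmx1.
(* Naturality of Hom(f, A): the comparison maps at both ends of the dualized presentation commute
   with [F] and [F']. *)
have Fx : x1 *m F' = F *m x0.
  have [_ fB _ _ _] := c1; apply: (comb_inj fB) => j; rewrite -!comb_mul.
  transitivity (a1 *m (f' *m B0' j) *m r').
    rewrite hF' mulmx_sumr mulmx_suml; apply: eq_bigr => k _.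
    by rewrite -ex1 -scalemxAr -scalemxAl.
  rewrite mulmxA -ff -!mulmxA (mulmxA a0) ex0 /comb mulmx_sumr; apply: eq_bigr => k _.
  by rewrite -scalemxAr hF.
have Fy : y1 *m F = F' *m y0.
  have [_ fB _ _ _] := c1'; apply: (comb_inj fB) => j; rewrite -!comb_mul.
  transitivity (b1 *m (f *m B0 j) *m r).
    rewrite hF mulmx_sumr mulmx_suml; apply: eq_bigr => k _.
    by rewrite -ey1 -scalemxAr -scalemxAl.
  rewrite mulmxA -ff' -!mulmxA (mulmxA b0) ey0 /comb mulmx_sumr; apply: eq_bigr => k _.
  by rewrite -scalemxAr hF'.
exact: (ker_iso hi fi ei hi' fi' ei' hx1 hy1 xy1 yx1 Fx Fy).
Qed.

Lemma tau2_iso X X' T T' : iso X X' -> tau2 X T -> tau2 X' T' -> iso T T'.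
Proof.
move=> hX [N [sN tN]] [N' [sN' tN']]; apply: tau_iso tN tN'; exact: syzygy_iso sN sN'.
Qed.

End Tau.

(** * Extensions as cocycles *)

Section Ext.
Context {K : fieldType}.
Implicit Types V W X Y P R H : rep K.

(* The maps [e] for which
   [(block_mx (ra Y) 0 (e false) (ra W), block_mx (rb Y) 0 (e true) (rb W))] is a module. *)
Definition cocycle W Y (e : bool -> 'M[K]_(rdim W, rdim Y)) : Prop :=
  e false *m ra Y + ra W *m e false = 0 /\
  (e false *m rb Y + ra W *m e true) + (e true *m rb Y + rb W *m e true) +
  ((e true *m rb Y + rb W *m e true) *m ra Y + rb W *m rb W *m e false) = 0.

Definition coboundary W Y (h : 'M[K]_(rdim W, rdim Y)) c : 'M[K]_(rdim W, rdim Y) :=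
  act W c *m h - h *m act Y c.

Lemma cocycle_rels W Y e : cocycle e ->
  rels (rdim Y + rdim W) (block_mx (ra Y) 0 (e false) (ra W))
                         (block_mx (rb Y) 0 (e true) (rb W)).
Proof.
move=> [h1 h2]; rewrite /rels !mulmx_block !(mulmx0, mul0mx, addr0, add0r).
rewrite !add_block_mx !(addr0, add0r) !aa !abbba h1.
by rewrite h2 block_mx0 !eqxx.
Qed.

(* [p *m e c *m u] is the defect of the linear map [h] from being a homomorphism.  With
   [p = 1] this is the class of an extension with a linear section, with [u = 1] the
   obstruction to correcting a linear map into a homomorphism. *)
Lemma cocycle_of W Y m (p : 'M[K]_(m, rdim W)) n (u : 'M[K]_(rdim Y, n))
    (A : bool -> 'M[K]_m) (B : bool -> 'M[K]_n) (h : 'M[K]_(m, n)) e :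
  (forall c, A c *m p = p *m act W c) -> (forall c, u *m B c = act Y c *m u) ->
  row_full p -> row_free u ->
  A false *m A false = 0 -> B false *m B false = 0 ->
  A false *m A true + A true *m A true + A true *m A true *m A false = 0 ->
  B false *m B true + B true *m B true + B true *m B true *m B false = 0 ->
  (forall c, p *m e c *m u = A c *m h - h *m B c) -> cocycle e.
Proof.
move=> hp hu fp fu A0 B0 A1 B1 he.
have mid c d : p *m (e c *m act Y d) *m u = A c *m h *m B d - h *m (B c *m B d).
  by rewrite !mulmxA -mulmxA -hu mulmxA he mulmxBl ?mulmxA.
have mid' c d : p *m (act W c *m e d) *m u = A c *m A d *m h - A c *m h *m B d.
  by rewrite !mulmxA -hp -!mulmxA (mulmxA p) he mulmxBr !mulmxA.
(* The defect obeys a product rule: the mixed term, [A c] on the left of [h] and [B d] on its right,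
   occurs with both signs and cancels. The relations of the algebra then pass from [A] and [B] to
   the cocycle condition. *)
have s c d : p *m (e c *m act Y d + act W c *m e d) *m u =
    A c *m A d *m h - h *m (B c *m B d).
  by rewrite mulmxDr mulmxDl mid mid' addrC addrA subrK.
split; apply: (row_free_inj fu); apply: (row_full_inj fp); rewrite mul0mx mulmx0 mulmxA.
  by rewrite (s false false) A0 B0 mul0mx mulmx0 subr0.
have t : p *m ((e true *m rb Y + rb W *m e true) *m ra Y + rb W *m rb W *m e false) *m u =
    A true *m A true *m A false *m h - h *m (B true *m B true *m B false).
  have -> : rb W *m rb W *m e false = rb W *m (act W true *m e false) by rewrite mulmxA.
  rewrite mulmxDr mulmxDl [p *m (_ *m ra Y)]mulmxA -[p *m _ *m ra Y *m u]mulmxA -(hu false).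
  rewrite [p *m _ *m (u *m _)]mulmxA (s true true) [p *m (rb W *m _)]mulmxA -[p *m rb W](hp true).
  rewrite -[A true *m p *m _]mulmxA -[A true *m _ *m u]mulmxA mid' mulmxBl mulmxBr !mulmxA.
  by rewrite addrC addrA subrK.
have sub3 (x y z w x' y' : 'M[K]_(m, n)) : x - y + (z - w) + (x' - y') = (x + z + x') - (y + w + y').
  by rewrite !opprD [x - y + _]addrACA [LHS]addrACA.
rewrite 2!mulmxDr 2!mulmxDl t (s false true) (s true true) sub3.
have := congr1 (mulmxr h) A1; rewrite /= !mulmxDl mul0mx => ->.
by have := congr1 (mulmx h) B1; rewrite /= !mulmxDr mulmx0 => ->; rewrite subrr.
Qed.

(** A section of the block extension has the identity as its [W] component; its [Y] component is the
    required [h], as compatibility with the lower left block shows. *)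
Lemma ext1_coboundary W Y (e : bool -> 'M[K]_(rdim W, rdim Y)) :
  ext1_zero W Y -> cocycle e -> exists h, e =1 coboundary h.
Proof.
move=> ext ce; pose E := Rep _ _ _ (cocycle_rels ce).
have EE c : act E c = block_mx (act Y c) 0 (e c) (act W c) by case: c.
pose u : 'M[K]_(rdim Y, rdim Y + rdim W) := row_mx 1%:M 0.
pose p : 'M[K]_(rdim Y + rdim W, rdim W) := col_mx 0 1%:M.
have hu : rhom Y E u.
  apply/rhomP => c; rewrite EE; transitivity (row_mx (act Y c) 0 : 'M_(_, rdim Y + rdim W)).
    by rewrite mul_mx_row mulmx1 mulmx0.
  by rewrite /u [RHS]mul_row_block !mul1mx !mul0mx !addr0.
have hp : rhom E W p.
  apply/rhomP => c; rewrite EE; transitivity (col_mx 0 (act W c) : 'M_(rdim Y + rdim W, _)).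
    by rewrite /p [LHS]mul_block_col !mulmx1 !mulmx0 !add0r.
  by rewrite mul_col_mx mul1mx mul0mx.
have fu : row_free u.
  by apply/row_freeP; exists (col_mx 1%:M 0); rewrite mul_row_col mulmx1 mulmx0 addr0.
have fp : row_full p.
  by apply/row_fullP; exists (row_mx 0 1%:M); rewrite mul_row_col mulmx1 mulmx0 add0r.
have up : (u == kermx p)%MS.
  apply/andP; split; first by rewrite sub_kermx mul_row_col mulmx0 mul0mx addr0.
  apply/rV_subP => v /sub_kermxP; rewrite -[v]hsubmxK mul_row_col mulmx0 add0r mulmx1 => ->.
  by apply/submxP; exists (lsubmx v); rewrite mul_mx_row mulmx1 mulmx0.
have [s [/rhomP hs]] := ext E u p hu hp fu fp up.
have [s1 [s2 es]] : exists s1 s2, s = row_mx s1 s2 :> 'M_(_, rdim Y + rdim W).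
  by exists (lsubmx s), (rsubmx s); rewrite hsubmxK.
rewrite es mul_row_col mulmx0 add0r mulmx1 => e2.
exists s1 => c; have := hs c; rewrite es e2 EE mul_mx_row [in RHS]mul_row_block.
by case/eq_row_mx => h _; rewrite /coboundary h mul1mx addrC addKr.
Qed.

(** A linear section [s] of [p] has its defect in the kernel of [p], hence in [Y]. If that cocycle
    is the coboundary of [h], then [s - h u] is a homomorphism and still a section. *)
Lemma ext1_zeroP W Y : (forall e : bool -> 'M[K]_(rdim W, rdim Y), cocycle e ->
  exists h, e =1 coboundary h) -> ext1_zero W Y.
Proof.
move=> H E u p /rhomP hu /rhomP hp fu fp /eqmxP up.
have [s sp] := row_fullP fp.
have up0 : u *m p = 0 by apply/eqP; rewrite -sub_kermx -up.
have eE c : exists d, d *m u = s *m act E c - act W c *m s.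
  have /submxP[d ->] : (s *m act E c - act W c *m s <= u)%MS; last by exists d.
  by rewrite up sub_kermx mulmxBl -[_ *m s *m p]mulmxA sp mulmx1 -mulmxA hp mulmxA sp mul1mx subrr.
have [e he] := fin_all_exists eE.
have ce : cocycle (fun c => - e c).
  apply: (@cocycle_of W Y _ 1%:M _ u (act W) (act E) s) => //.
  - by move=> c; rewrite mulmx1 mul1mx.
  - by rewrite row_full_unit unitmx1.
  - exact: aa.
  - exact: aa.
  - exact: abbba.
  - exact: abbba.
  - by move=> c; rewrite mul1mx mulNmx he opprB.
have [h hh] := H _ ce.
exists (s - h *m u); split; last by rewrite mulmxBl -[h *m u *m p]mulmxA up0 mulmx0 subr0.
apply/rhomP => c; rewrite mulmxBr mulmxBl -[h *m u *m _]mulmxA -hu !mulmxA.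
have := hh c; rewrite /coboundary => /(congr1 (mulmxr u)) /=.
rewrite mulNmx he mulmxBl opprB -mulmxA => q.
by rewrite -[act W c *m s](subrK (s *m act E c)) q addrC -!addrA addKr addrC.
Qed.

Lemma cocycleMr W Y Z (f : 'M[K]_(rdim Y, rdim Z)) (e : bool -> 'M[K]_(rdim W, rdim Y)) :
  rhom Y Z f -> cocycle e -> cocycle (fun c => e c *m f).
Proof.
move=> /rhomP hf [h1 h2]; have fa := hf false; have fb := hf true; rewrite /= in fa fb.
split.
  by rewrite -mulmxA -fa !mulmxA -mulmxDl h1 mul0mx.
rewrite -[_ *m f *m rb Z]mulmxA -[e true *m f *m rb Z]mulmxA -fb !mulmxA -!mulmxDl.
by rewrite -[_ *m f *m ra Z]mulmxA -fa mulmxA -!mulmxDl h2 mul0mx.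
Qed.

Lemma cocycleMl W V Y (f : 'M[K]_(rdim V, rdim W)) (e : bool -> 'M[K]_(rdim W, rdim Y)) :
  rhom V W f -> cocycle e -> cocycle (fun c => f *m e c).
Proof.
move=> /rhomP hf [h1 h2]; have fa := hf false; have fb := hf true; rewrite /= in fa fb.
split.
  by rewrite !mulmxA fa -!mulmxA -mulmxDr h1 mulmx0.
have k1 : rb V *m (f *m e true) = f *m (rb W *m e true) by rewrite mulmxA fb mulmxA.
have k2 : ra V *m (f *m e true) = f *m (ra W *m e true) by rewrite mulmxA fa mulmxA.
have k3 : rb V *m rb V *m (f *m e false) = f *m (rb W *m rb W *m e false).
  by rewrite -mulmxA (mulmxA _ f) fb -(mulmxA f) (mulmxA _ f) fb -!mulmxA.
rewrite k1 k2 k3 -![f *m _ *m rb Y]mulmxA -!mulmxDr -[f *m _ *m ra Y]mulmxA.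
by rewrite -!mulmxDr h2 mulmx0.
Qed.

Lemma ext1_add_r k X Y (Z : 'I_k -> rep K) (i : forall j, 'M[K]_(rdim Y, rdim (Z j)))
    (q : forall j, 'M[K]_(rdim (Z j), rdim Y)) :
  (forall j, rhom Y (Z j) (i j)) -> (forall j, rhom (Z j) Y (q j)) ->
  \sum_j i j *m q j = 1%:M -> (forall j, ext1_zero X (Z j)) -> ext1_zero X Y.
Proof.
move=> hi hq iq ext; apply: ext1_zeroP => e ce.
have [h hh] := fin_all_exists (fun j => ext1_coboundary (ext j) (cocycleMr (hi j) ce)).
exists (\sum_j h j *m q j) => c.
rewrite /coboundary -[LHS]mulmx1 -iq !mulmx_sumr mulmx_suml -sumrB; apply: eq_bigr => j _.
by rewrite mulmxA hh mulmxBl -!mulmxA (rhomP _ (hq j) c).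
Qed.

Lemma ext1_add_l k X Y (Z : 'I_k -> rep K) (i : forall j, 'M[K]_(rdim X, rdim (Z j)))
    (q : forall j, 'M[K]_(rdim (Z j), rdim X)) :
  (forall j, rhom X (Z j) (i j)) -> (forall j, rhom (Z j) X (q j)) ->
  \sum_j i j *m q j = 1%:M -> (forall j, ext1_zero (Z j) Y) -> ext1_zero X Y.
Proof.
move=> hi hq iq ext; apply: ext1_zeroP => e ce.
have [h hh] := fin_all_exists (fun j => ext1_coboundary (ext j) (cocycleMl (hq j) ce)).
exists (\sum_j i j *m h j) => c.
rewrite /coboundary -[LHS]mul1mx -iq !mulmx_sumr !mulmx_suml -sumrB; apply: eq_bigr => j _.
by rewrite -mulmxA hh mulmxBr !mulmxA (rhomP _ (hi j) c).
Qed.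

(** Ext^1(W, X) contains the obstruction to extending [f] along [t]. Linearly [f] is [t h0]; the
    defect of [h0] vanishes on the image of [t], which is the kernel of [p], so it comes from a
    cocycle on [W], and a coboundary corrects [h0]. *)
Lemma ext1_extend X C D W n (s : 'M[K]_(n, rdim C)) t p (f : 'M[K]_(rdim C, rdim X)) :
  ext1_zero W X -> rhom C D t -> rhom D W p -> row_full p ->
  (kermx t <= s)%MS -> t *m p = 0 -> (kermx p <= t)%MS ->
  rhom C X f -> s *m f = 0 -> exists2 h, rhom D X h & f = t *m h.
Proof.
move=> ext /rhomP ht /rhomP hp fp ts tp pt /rhomP hf sf.
have [h0 ft] : exists h0, t *m h0 = f.
  exists (pinvmx t *m f).
  apply/eqP; rewrite -subr_eq0 mulmxA -{2}[f]mul1mx -mulmxBl; apply/eqP.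
  have /submxP[d ->] : (t *m pinvmx t - 1%:M <= s)%MS.
    by apply: submx_trans ts; rewrite sub_kermx mulmxBl mulmxKpV // mul1mx subrr.
  by rewrite -mulmxA sf mulmx0.
have eE c : exists d, p *m d = act D c *m h0 - h0 *m act X c.
  have [g gp] := row_fullP fp.
  exists (g *m (act D c *m h0 - h0 *m act X c)).
  have tk : t *m (act D c *m h0 - h0 *m act X c) = 0.
    by rewrite mulmxBr !mulmxA -ht -!mulmxA ft mulmxA ft hf subrr.
  apply/eqP; rewrite mulmxA -subr_eq0 -[X in _ *m _ - X]mul1mx -mulmxBl; apply/eqP.
  have /submxP[d ->] : (p *m g - 1%:M <= t)%MS.
    by apply: submx_trans pt; rewrite sub_kermx mulmxBl -mulmxA gp mulmx1 mul1mx subrr.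
  by rewrite -mulmxA tk mulmx0.
have [e he] := fin_all_exists eE.
have ce : cocycle e.
  apply: (@cocycle_of W X _ p _ 1%:M (act D) (act X) h0) => //.
  - by move=> c; rewrite mulmx1 mul1mx.
  - by rewrite row_free_unit unitmx1.
  - exact: aa.
  - exact: aa.
  - exact: abbba.
  - exact: abbba.
  - by move=> c; rewrite mulmx1 he.
have [k hk] := ext1_coboundary ext ce.
exists (h0 - p *m k); last by rewrite mulmxBr ft mulmxA tp mul0mx subr0.
apply/rhomP => c; rewrite mulmxBr mulmxBl [act D c *m (p *m k)]mulmxA hp -!mulmxA.
have := he c; rewrite hk /coboundary mulmxBr => q.
by rewrite -[act D c *m h0](subrK (h0 *m act X c)) -q addrC -!addrA addKr addrC.
Qed.

End Ext.

(** * From almost split sequences to cluster tilting *)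

Section Tilting.
Context {K : fieldType}.
Implicit Types M V W X Y P R H : rep K.

Lemma ker_lift m n q l (p : 'M[K]_(m, n)) (d : 'M[K]_(q, m)) (f : 'M[K]_(m, l)) g :
  g *m p = 1%:M -> (kermx p <= d)%MS -> d *m f = 0 -> p *m (g *m f) = f.
Proof.
move=> gp kd df; apply/eqP; rewrite mulmxA -subr_eq0 -[X in _ *m _ - X]mul1mx -mulmxBl.
have /submxP[x ->] : (p *m g - 1%:M <= d)%MS.
  by apply: submx_trans kd; rewrite sub_kermx mulmxBl -mulmxA gp mulmx1 mul1mx subrr.
by rewrite -mulmxA df mulmx0.
Qed.

(** Lift [p0] to a map P_0 -> E. On P_1 the lift takes values in [Y] and is a cocycle of Hom(P, Y);
    once it is written as [d1 z], subtracting [z] from the lift makes it descend to a section. *)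
Lemma ext1_of_resolution W Y P0 P1 n (d2 : 'M[K]_(n, rdim P1)) d1 p0 :
  rproj P0 -> rhom P1 P0 d1 -> rhom P0 W p0 -> row_full p0 ->
  (kermx p0 <= d1)%MS -> d1 *m p0 = 0 -> d2 *m d1 = 0 ->
  (forall y, rhom P1 Y y -> d2 *m y = 0 -> exists2 z, rhom P0 Y z & y = d1 *m z) ->
  ext1_zero W Y.
Proof.
move=> pP hd hp fp kp dp dd H E u p hu hpE fu fpE up.
have [g gp] := row_fullP fp.
have [f [hf ef]] := pP E W p p0 hpE fpE hp.
have [y hy ey] : exists2 y, rhom P1 Y y & d1 *m f = y *m u.
  apply: (ker_factor hu fu up); first exact: rhomM hd hf.
  by rewrite -mulmxA ef.
have [z hz ez] : exists2 z, rhom P0 Y z & y = d1 *m z.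
  by apply: H => //; apply: (row_free_inj fu); rewrite mul0mx -mulmxA -ey mulmxA dd mul0mx.
have hf' : rhom P0 E (f - z *m u) by apply: rhomB => //; apply: rhomM.
have e1 : p0 *m (g *m (f - z *m u)) = f - z *m u.
  by apply: ker_lift gp kp _; rewrite mulmxBr ey ez mulmxA subrr.
exists (g *m (f - z *m u)); split.
  by apply: rhom_cancell hp fp _; rewrite e1.
have up0 : u *m p = 0 by apply/eqP; rewrite -sub_kermx; move/eqmxP: up => <-.
apply: (row_full_inj fp); rewrite mulmxA e1 mulmxBl ef -mulmxA up0 mulmx0 subr0 mulmx1 //.
Qed.

Lemma hom_span V W : exists n (g : 'I_n -> 'M[K]_(rdim V, rdim W)),
  (forall k, rhom V W (g k)) /\
  forall f, rhom V W f -> exists c : 'I_n -> K, f = \sum_k c k *: g k.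
Proof.
pose L (A : 'M[K]_(rdim V)) (B : 'M[K]_(rdim W)) := lin_mx (mulmx A) - lin_mx (mulmxr B).
pose S := row_mx (L (ra V) (ra W)) (L (rb V) (rb W)).
have LE A B f : (mxvec f *m L A B == 0) = (A *m f == f *m B).
  by rewrite /L mulmxBr !mul_vec_lin -linearB mxvec_eq0 subr_eq0.
have SE f : (mxvec f <= kermx S)%MS = rhom V W f.
  rewrite sub_kermx mul_mx_row /rhom -!LE; apply/eqP/andP => [|[/eqP -> /eqP ->]].
    by rewrite -[X in _ = X]row_mx0 => /eq_row_mx[-> ->]; rewrite !eqxx.
  by rewrite row_mx0.
exists _, (fun k => vec_mx (row k (kermx S))); split=> [k|f].
  by rewrite -SE vec_mxK row_sub.
rewrite -SE => /submxP[D eD]; exists (fun k => D 0 k); apply: (can_inj mxvecK).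
by rewrite eD mulmx_sum_row linear_sum; apply: eq_bigr => k _; rewrite linearZ /= vec_mxK.
Qed.

(** The additive closure of N_0, ..., N_{r-1}, expressed like [in_add] by a factorization of the
    identity, so that no direct sum of modules has to be formed; [L] tells which module each factor
    passes through. *)
Definition fadd r (N : nat -> rep K) X := exists k (L : 'I_k -> nat)
    (i : forall j, 'M[K]_(rdim X, rdim (N (L j)))) (q : forall j, 'M[K]_(rdim (N (L j)), rdim X)),
  (forall j, [/\ (L j < r)%N, rhom X (N (L j)) (i j) & rhom (N (L j)) X (q j)]) /\
  \sum_j i j *m q j = 1%:M.

(* [wt i] is a weight on the basis vectors of [N i]; since the components of [s i] lower
   it, long compositions of radical maps vanish. *)
Section Half.
Variables (r : nat) (N C D : nat -> rep K).
Variables (s : forall i, 'M[K]_(rdim (N i), rdim (C i))).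
Variables (t : forall i, 'M[K]_(rdim (C i), rdim (D i))).
Variables (wt : nat -> nat -> nat) (a0 : nat) (e : 'rV[K]_(rdim (N a0))).
Variable X : rep K.

Definition lowers m n (w w' : nat -> nat) (f : 'M[K]_(m, n)) :=
  forall x y, f x y != 0 -> (w' y < w x)%N.

Hypothesis (a0r : (a0 < r)%N) (genN : rgen (N a0) e).
Hypothesis ht : forall i, (i < r)%N -> rhom (C i) (D i) (t i).
Hypothesis st : forall i, (i < r)%N -> s i *m t i = 0.
Hypothesis HC : forall i, (i < r)%N -> exists k (L : 'I_k -> nat)
    (p : forall j, 'M[K]_(rdim (C i), rdim (N (L j))))
    (q : forall j, 'M[K]_(rdim (N (L j)), rdim (C i))),
  (forall j, [/\ (L j < r)%N, rhom (C i) (N (L j)) (p j), rhom (N (L j)) (C i) (q j)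
                & lowers (wt i) (wt (L j)) (s i *m p j)]) /\
  \sum_j p j *m q j = 1%:M.
Hypothesis HD : forall i, (i < r)%N -> fadd r N (D i).
(** The left almost split property, in the form the elimination uses: a map that does not factor
    through [s i] is a retraction onto its target. *)
Hypothesis HR : forall i j (f : 'M[K]_(rdim (N i), rdim (N j))), (i < r)%N -> (j < r)%N ->
  rhom (N i) (N j) f ->
  (exists2 g, rhom (C i) (N j) g & f = s i *m g) \/
  (exists2 g, rhom (N j) (N i) g & g *m f = 1%:M).
Hypothesis HE : forall i (f : 'M[K]_(rdim (C i), rdim X)), (i < r)%N ->
  rhom (C i) X f -> s i *m f = 0 -> exists2 h, rhom (D i) X h & f = t i *m h.

Section Family.
Variables (I : finType) (L : I -> nat) (g : forall k, 'M[K]_(rdim (N (L k)), rdim X)).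
Hypothesis (Lr : forall k, (L k < r)%N) (hg : forall k, rhom (N (L k)) X (g k)).

Definition factors (A : {set I}) V (f : 'M[K]_(rdim V, rdim X)) :=
  exists2 phi : forall k, 'M[K]_(rdim V, rdim (N (L k))),
    (forall k, rhom V (N (L k)) (phi k)) & f = \sum_(k in A) phi k *m g k.

Definition generates A :=
  forall j (f : 'M[K]_(rdim (N j), rdim X)), (j < r)%N -> rhom (N j) X f -> factors A f.

Lemma factors_fadd A V (f : 'M[K]_(rdim V, rdim X)) :
  generates A -> fadd r N V -> rhom V X f -> factors A f.
Proof.
move=> gA [k [M [i [q [hiq iq]]]]] hf.
have qf j : exists phi : forall l, 'M[K]_(rdim (N (M j)), rdim (N (L l))),
    (forall l, rhom (N (M j)) (N (L l)) (phi l)) /\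
    q j *m f = \sum_(l in A) phi l *m g l.
  have [Mj hi hq] := hiq j.
  by have [phi h1 h2] := gA (M j) (q j *m f) Mj (rhomM hq hf); exists phi.
have [phi hphi] := fin_all_exists qf.
exists (fun l => \sum_j i j *m phi j l).
  by move=> l; apply: rhom_sum => j _; have [Mj hi hq] := hiq j; apply: rhomM hi (proj1 (hphi j) l).
rewrite -[f]mul1mx -iq mulmx_suml; under [RHS]eq_bigr do rewrite mulmx_suml.
rewrite [RHS]exchange_big /=; apply: eq_bigr => j _.
rewrite -mulmxA (proj2 (hphi j)) mulmx_sumr; apply: eq_bigr => l _; by rewrite mulmxA.
Qed.

(** Redundant members are discarded while there are any; whether one exists is decided classically,
    [generates] being a mere proposition. *)
Lemma generates_min A : generates A ->
  exists2 B, generates B & forall k, k \in B -> ~ generates (B :\ k).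
Proof.
have [n] := ubnP #|A|; elim: n A => // n IH A; rewrite ltnS => An gA.
case: (classic (exists2 k, k \in A & generates (A :\ k))) => [[k kA gk]|h].
  by apply: IH gk; rewrite (leq_trans _ An) // [#|A|](cardsD1 k) kA.
by exists A => // k kA gk; apply: h; exists k.
Qed.

Section Minimal.
Variable A : {set I}.
Hypotheses (gA : generates A) (mA : forall k, k \in A -> ~ generates (A :\ k)).

Definition null i (phi : forall k, 'M[K]_(rdim (N i), rdim (N (L k)))) :=
  (forall k, rhom (N i) (N (L k)) (phi k)) /\ \sum_(k in A) phi k *m g k = 0.

(** If [phi k] were a retraction with section [u], the relation would express [g k] through the
    other members and make it redundant. *)
Lemma null_radical i phi k : (i < r)%N -> null phi -> k \in A ->
  exists2 psi, rhom (C i) (N (L k)) psi & phi k = s i *m psi.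
Proof.
move=> ir [hphi nphi] kA; case: (HR ir (Lr k) (hphi k)) => // -[u hu u1].
case: (mA kA) => j f jr hf; have [chi hchi ->] := gA jr hf.
(* Substituting g_k = - sum of u phi_l g_l over the remaining l eliminates [k] from the
   factorization [chi]. *)
exists (fun l => chi l - chi k *m u *m phi l).
  by move=> l; apply: rhomB => //; apply: rhomM => //; apply: rhomM.
rewrite (big_setD1 k kA); under [RHS]eq_bigr do rewrite mulmxBl -!mulmxA.
rewrite sumrB -!mulmx_sumr.
have -> : \sum_(l in A :\ k) phi l *m g l = - (phi k *m g k).
  by apply/eqP; rewrite -addr_eq0 addrC; apply/eqP; apply: etrans nphi; rewrite [RHS](big_setD1 k kA).
by rewrite !mulmxN opprK (mulmxA u) u1 mul1mx addrC.
Qed.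

(** The bound [m] on the weights occurring in the vector [v] carries the induction: after moving [v]
    into the summands of C_i, only smaller weights are left, and at [m = 0] the vector is zero. *)
Lemma null_low m i phi (v : 'rV[K]_(rdim (N i))) : (i < r)%N -> null phi ->
  (forall x, v 0 x != 0 -> (wt i x < m)%N) -> forall k, k \in A -> v *m phi k = 0.
Proof.
elim: m i phi v => [|m IH] i phi v ir nphi hv k kA.
  suff -> : v = 0 by rewrite mul0mx.
  by apply/rowP => x; rewrite mxE; apply/eqP/negPn/negP => /hv.
have rad l : exists psi : 'M[K]_(rdim (C i), rdim (N (L l))),
    rhom (C i) (N (L l)) psi /\ (l \in A -> phi l = s i *m psi).
  case lA: (l \in A); last by exists 0; split=> //; apply: rhom0.
  by have [psi h1 h2] := null_radical ir nphi lA; exists psi.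
have [psi hpsi] := fin_all_exists rad.
have [h hh eh] : exists2 h, rhom (D i) X h & \sum_(l in A) psi l *m g l = t i *m h.
  apply: HE => //; first by apply: rhom_sum => l _; apply: rhomM (hg l); exact: (hpsi l).1.
  rewrite mulmx_sumr -{2}(proj2 nphi); apply: eq_bigr => l lA.
  by rewrite mulmxA (hpsi l).2.
have [theta htheta et] := factors_fadd gA (HD ir) hh.
(* Since [s i] followed by [t i] is zero, this correction leaves [phi] unchanged, while the sum of
   the [chi l g l] now vanishes on all of C_i. *)
pose chi l := psi l - t i *m theta l.
have hchi l : rhom (C i) (N (L l)) (chi l).
  by apply: rhomB; [exact: (hpsi l).1 | apply: rhomM (htheta l); apply: ht].
have nchi : \sum_(l in A) chi l *m g l = 0.
  under eq_bigr do rewrite mulmxBl -mulmxA.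
  by rewrite sumrB eh et mulmx_sumr subrr.
have phiE : phi k = s i *m chi k.
  by rewrite mulmxBr mulmxA st // mul0mx subr0 (hpsi k).2.
have [n [M [p [q [hpq pq]]]]] := HC ir.
rewrite phiE -[chi k]mul1mx -pq mulmx_suml !mulmx_sumr big1 // => j _.
have [Mj hp hq low] := hpq j.
rewrite -(mulmxA (p j)) !mulmxA -(mulmxA _ (q j)) -(mulmxA v).
apply: (IH (M j) (fun l => q j *m chi l)) => //.
  split=> [l|]; first exact: rhomM.
  by under eq_bigr do rewrite -mulmxA; rewrite -mulmx_sumr nchi mulmx0.
(* A nonzero coordinate [y] of the image must come from a coordinate [x] of [v] through a nonzero
   matrix entry, and such an entry lowers the weight. *)
move=> y; rewrite mxE => vy; have [x] : exists x, v 0 x * (s i *m p j) x y != 0.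
  apply/existsP; apply: contraR vy => /existsPn /= vy.
  by rewrite big1 // => x _; apply/eqP/negPn/vy.
by rewrite mulf_eq0 negb_or => /andP[/hv vx /low xy]; apply: leq_trans xy vx.
Qed.

Lemma null0 i phi k : (i < r)%N -> null (i := i) phi -> k \in A -> phi k = 0.
Proof.
move=> ir nphi kA; apply/row_matrixP => x; rewrite row0 rowE.
apply: (null_low (m := (\max_(y < rdim (N i)) wt i y).+1) ir nphi _ kA) => y _.
by rewrite ltnS; apply: (@leq_bigmax _ (fun y : 'I_(rdim (N i)) => wt i y)).
Qed.

(** N_{a0} is free on [e], so vectors of the modules are maps from it: generation says that every
    vector of [X] is a combination of images under the [g k], and [null0] says that this combination
    is unique. The coefficients therefore assemble to an inverse of the family. *)
Lemma minimal_fadd : fadd r N X.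
Proof.
have uniq0 (n : forall k, 'rV[K]_(rdim (N (L k)))) :
    \sum_(k in A) n k *m g k = 0 -> forall k, k \in A -> n k = 0.
  move=> n0 k kA.
  have ex l : exists f : 'M[K]_(rdim (N a0), rdim (N (L l))),
      rhom (N a0) (N (L l)) f /\ e *m f = n l.
    by have [f hf ef] := rgen_hom (n l) genN; exists f.
  have [phi hphi] := fin_all_exists ex.
  rewrite -(hphi k).2 (null0 a0r (phi := phi)) ?mulmx0 //.
  have hphi1 l := (hphi l).1.
  split=> //; apply: (rgen_inj genN); first by apply: rhom_sum => l _; apply: rhomM.
    exact: rhom0.
  rewrite mulmx0 mulmx_sumr -[RHS]n0; apply: eq_bigr => l _.
  by rewrite mulmxA (hphi l).2.
have ex x : exists u : forall k, 'rV[K]_(rdim (N (L k))),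
    \sum_(k in A) u k *m g k = row x 1%:M.
  have [f hf ef] := rgen_hom (row x 1%:M) genN.
  have [phi hphi ephi] := gA a0r hf; exists (fun k => e *m phi k).
  by rewrite -ef ephi mulmx_sumr; apply: eq_bigr => k _; rewrite mulmxA.
have [u hu] := fin_all_exists ex.
pose U k := \matrix_(x, y) u x k 0 y : 'M[K]_(rdim X, rdim (N (L k))).
have rU x k : row x (U k) = u x k by apply/rowP => y; rewrite !mxE.
have U1 : \sum_(k in A) U k *m g k = 1%:M.
  apply/row_matrixP => x; rewrite linear_sum -hu; apply: eq_bigr => k _.
  by rewrite /= row_mul rU.
(* By uniqueness of coefficients: row by row, the defects of the [U k] form a vector relation,
   because the sum of the [U k g k] is the identity. *)
have hU k : k \in A -> rhom X (N (L k)) (U k).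
  move=> kA; apply/rhomP => c; apply/eqP; rewrite -subr_eq0; apply/eqP/row_matrixP => x.
  rewrite row0; move: k kA; apply: uniq0.
  transitivity (row x ((act X c *m \sum_(k in A) U k *m g k) - (\sum_(k in A) U k *m g k) *m act X c)).
    rewrite mulmx_sumr mulmx_suml -sumrB linear_sum; apply: eq_bigr => k _.
    by rewrite -row_mul mulmxBl -[U k *m act _ c *m g k]mulmxA (rhomP _ (hg k)) !mulmxA.
  by rewrite U1 mulmx1 mul1mx subrr row0.
exists #|A|, (fun j => L (enum_val j)), (fun j => U (enum_val j)), (fun j => g (enum_val j)).
split=> [j|]; first by split=> //; apply: hU; apply: enum_valP.
by rewrite -U1 [RHS]big_enum_val.
Qed.
End Minimal.
End Family.

Lemma add_of_no_ext : fadd r N X.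
Proof.
have [n hn] := fin_all_exists (fun j : 'I_r => hom_span (N j) X).
have [g0 hg0] := fin_all_exists hn.
pose I : finType := {j : 'I_r & 'I_(n j)}.
pose L (x : I) : nat := tag x.
pose g (x : I) : 'M[K]_(rdim (N (L x)), rdim X) := g0 (tag x) (tagged x).
have Lr x : (L x < r)%N by apply: ltn_ord.
have hg x : rhom (N (L x)) X (g x) by apply: (hg0 _).1.
(* The coefficient family is a Kronecker delta; the cast is due to the target N_{L z} depending on
   the index. *)
have self x : factors g setT (g x).
  exists (fun y => match x =P y with
    | ReflectT E => ecast z ('M[K]_(rdim (N (L x)), rdim (N (L z)))) E 1%:M
    | ReflectF _ => 0 end).
    move=> y; case: (x =P y) => [xy|_]; last exact: rhom0.
    by case: y / xy; apply: rhom1.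
  rewrite (bigD1 x) ?inE //= big1 ?addr0.
    by case: (x =P x) => // E; rewrite (eq_irrelevance E (erefl x)) mul1mx.
  move=> y /andP[_ /eqP yx]; case: (x =P y) => [xy|_]; last by rewrite mul0mx.
  by case: yx.
have gen : generates g setT.
  move=> j f jr hf; have [c fE] := (hg0 (Ordinal jr)).2 f hf.
  have ex k : exists phi : forall x, 'M[K]_(rdim (N j), rdim (N (L x))),
     (forall x, rhom (N j) (N (L x)) (phi x)) /\
     g0 (Ordinal jr) k = \sum_(x in setT) phi x *m g x.
    by have [phi h1 h2] := self (Tagged (fun j : 'I_r => 'I_(n j)) k); exists phi.
  have [phi hphi] := fin_all_exists ex.
  exists (fun x => \sum_k c k *: phi k x).
    by move=> x; apply: rhom_sum => k _; apply: rhomZ; apply: (hphi k).1.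
  rewrite fE; under eq_bigr do rewrite (hphi _).2 scaler_sumr.
  rewrite exchange_big; apply: eq_bigr => x _; rewrite mulmx_suml.
  by apply: eq_bigr => k _; rewrite scalemxAl.
have [B gB mB] := generates_min gen.
exact: (minimal_fadd Lr hg gB mB).
Qed.
End Half.

(** * Closure properties of add M and the approximation argument *)

Lemma dsum_maps V W : exists p j p' j',
  [/\ rhom (dsum V W) V p, rhom V (dsum V W) j, rhom (dsum V W) W p' & rhom W (dsum V W) j'] /\
  [/\ j *m p = 1%:M, j *m p' = 0, j' *m p = 0, j' *m p' = 1%:M & p *m j + p' *m j' = 1%:M].
Proof.
have dE c : act (dsum V W) c = block_mx (act V c) 0 0 (act W c) by case: c.
exists (col_mx 1%:M 0 : 'M_(rdim V + rdim W, _)), (row_mx 1%:M 0 : 'M_(_, rdim V + rdim W)).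
exists (col_mx 0 1%:M : 'M_(rdim V + rdim W, _)), (row_mx 0 1%:M : 'M_(_, rdim V + rdim W)).
split; split; try (apply/rhomP => c; rewrite dE).
- by rewrite [LHS]mul_block_col mul_col_mx !(mul0mx, mulmx0, mul1mx, mulmx1, addr0, add0r).
- by rewrite [RHS]mul_row_block mul_mx_row !(mul0mx, mulmx0, mul1mx, mulmx1, addr0, add0r).
- by rewrite [LHS]mul_block_col mul_col_mx !(mul0mx, mulmx0, mul1mx, mulmx1, addr0, add0r).
- by rewrite [RHS]mul_row_block mul_mx_row !(mul0mx, mulmx0, mul1mx, mulmx1, addr0, add0r).
- by rewrite mul_row_col !(mul0mx, mulmx0, mul1mx, mulmx1, addr0, add0r).
- by rewrite mul_row_col !(mul0mx, mulmx0, mul1mx, mulmx1, addr0, add0r).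
- by rewrite mul_row_col !(mul0mx, mulmx0, mul1mx, mulmx1, addr0, add0r).
- by rewrite mul_row_col !(mul0mx, mulmx0, mul1mx, mulmx1, addr0, add0r).
rewrite !mul_col_row add_block_mx !(mul0mx, mulmx0, mul1mx, mulmx1, addr0, add0r).
by rewrite -scalar_mx_block.
Qed.

(** Extends [in_add], which is the case of the identity, to all maps: maps through add M are closed
    under sums and compositions, and this yields the closure properties of add M at once. *)
Definition factors_add M V W (f : 'M[K]_(rdim V, rdim W)) :=
  exists k (i : 'I_k -> 'M[K]_(rdim V, rdim M)) (q : 'I_k -> 'M[K]_(rdim M, rdim W)),
  (forall j, rhom V M (i j) /\ rhom M W (q j)) /\ \sum_j i j *m q j = f.

Lemma factors_addD M V W (f g : 'M[K]_(rdim V, rdim W)) : factors_add M f -> factors_add M g -> factors_add M (f + g).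
Proof.
move=> [k [i [q [hiq <-]]]] [k' [i' [q' [hiq' <-]]]].
exists (k + k')%N, (fun l => match split l with inl x => i x | inr y => i' y end),
  (fun l => match split l with inl x => q x | inr y => q' y end).
split; first by move=> l; case: (split l) => x.
rewrite big_split_ord; congr (_ + _); apply: eq_bigr => x _.
  by rewrite (unsplitK (inl x)).
by rewrite (unsplitK (inr x)).
Qed.

Lemma factors_add_sum M V W k (F : 'I_k -> 'M[K]_(rdim V, rdim W)) :
  (forall j, factors_add M (F j)) -> factors_add M (\sum_j F j).
Proof.
move=> h; apply: big_ind => //; last by move=> f g; apply: factors_addD.
exists 0%N, (fun=> 0), (fun=> 0); split; first by case.
by rewrite big_ord0.
Qed.

Lemma factors_addM M V V' W W' (f : 'M[K]_(rdim V, rdim W)) (l : 'M[K]_(rdim V', rdim V))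
    (r : 'M[K]_(rdim W, rdim W')) :
  rhom V' V l -> rhom W W' r -> factors_add M f -> factors_add M (l *m f *m r).
Proof.
move=> hl hr [k [i [q [hiq <-]]]]; exists k, (fun j => l *m i j), (fun j => q j *m r); split.
  by move=> j; have [hi hq] := hiq j; rewrite !rhomM.
by rewrite mulmx_sumr mulmx_suml; apply: eq_bigr => j _; rewrite !mulmxA.
Qed.

Lemma in_add_family M X k (Z : 'I_k -> rep K) (i : forall j, 'M[K]_(rdim X, rdim (Z j)))
    (q : forall j, 'M[K]_(rdim (Z j), rdim X)) :
  (forall j, rhom X (Z j) (i j)) -> (forall j, rhom (Z j) X (q j)) ->
  \sum_j i j *m q j = 1%:M -> (forall j, in_add M (Z j)) -> in_add M X.
Proof.
move=> hi hq iq MZ; rewrite /in_add -iq; apply: factors_add_sum => j.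
by rewrite -[i j]mulmx1; apply: factors_addM => //; apply: MZ.
Qed.

Lemma in_add_trans V W X : in_add V W -> in_add W X -> in_add V X.
Proof.
move=> VW [k [i [q [hiq iq]]]].
by apply: (in_add_family (Z := fun=> W) _ _ iq) => // j; have [] := hiq j.
Qed.

Lemma in_add_fadd r N M X :
  (forall j, (j < r)%N -> in_add M (N j)) -> fadd r N X -> in_add M X.
Proof.
move=> MN [k [L [i [q [hiq iq]]]]].
by apply: (in_add_family _ _ iq) => j; have [Lr hi hq] := hiq j => //; apply: MN.
Qed.

Lemma in_add_sum M X V W p j p' j' :
  rhom X V p -> rhom V X j -> rhom X W p' -> rhom W X j' -> p *m j + p' *m j' = 1%:M ->
  in_add M V -> in_add M W -> in_add M X.
Proof.
move=> hp hj hp' hj' pj MV MW; rewrite /in_add -pj.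
by rewrite -[p]mulmx1 -[p']mulmx1; apply: factors_addD; apply: factors_addM.
Qed.

Lemma in_add_iso V W : iso V W -> in_add V W.
Proof.
move=> [f [g [hf hg fg gf]]]; exists 1%N, (fun=> g), (fun=> f).
by rewrite big_ord1; split.
Qed.

Lemma in_add_refl (M : rep K) : in_add M M.
Proof.
exists 1%N, (fun=> 1%:M), (fun=> 1%:M).
by rewrite big_ord1 mulmx1; split=> // _; rewrite rhom1.
Qed.

Lemma in_add_dsum M V W : in_add M V -> in_add M W -> in_add M (dsum V W).
Proof.
have [p [j [p' [j' [[hp hj hp' hj'] [_ _ _ _ e]]]]]] := dsum_maps V W.
exact: in_add_sum hp hj hp' hj' e.
Qed.

Lemma in_add_dsuml V W : in_add (dsum V W) V.
Proof.
have [p [j [p' [j' [[hp hj _ _] [e _ _ _ _]]]]]] := dsum_maps V W.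
by exists 1%N, (fun=> j), (fun=> p); rewrite big_ord1; split.
Qed.

Lemma in_add_dsumr V W : in_add (dsum V W) W.
Proof.
have [p [j [p' [j' [[_ _ hp hj] [_ _ _ e _]]]]]] := dsum_maps V W.
by exists 1%N, (fun=> j'), (fun=> p'); rewrite big_ord1; split.
Qed.

Lemma ext1_dsuml V W Y : ext1_zero V Y -> ext1_zero W Y -> ext1_zero (dsum V W) Y.
Proof.
have [p [j [p' [j' [[hp hj hp' hj'] [_ _ _ _ pj]]]]]] := dsum_maps V W.
move=> VY WY; apply: ext1_zeroP => e ce.
have [h hh] := ext1_coboundary VY (cocycleMl hj ce).
have [h' hh'] := ext1_coboundary WY (cocycleMl hj' ce).
exists (p *m h + p' *m h') => c; rewrite -[e c]mul1mx -pj mulmxDl -!mulmxA hh hh'.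
rewrite /coboundary !mulmxBr mulmxDr mulmxDl !mulmxA (rhomP _ hp c) (rhomP _ hp' c).
by rewrite opprD addrACA.
Qed.

Lemma ext1_dsumr X V W : ext1_zero X V -> ext1_zero X W -> ext1_zero X (dsum V W).
Proof.
have [p [j [p' [j' [[hp hj hp' hj'] [_ _ _ _ pj]]]]]] := dsum_maps V W.
move=> XV XW; apply: ext1_zeroP => e ce.
have [h hh] := ext1_coboundary XV (cocycleMr hp ce).
have [h' hh'] := ext1_coboundary XW (cocycleMr hp' ce).
exists (h *m j + h' *m j') => c; rewrite -[e c]mulmx1 -pj mulmxDr !mulmxA hh hh'.
rewrite /coboundary !mulmxBl mulmxDr mulmxDl !mulmxA -!mulmxA -(rhomP _ hj c) -(rhomP _ hj' c).
by rewrite !mulmxA opprD addrACA.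
Qed.

Lemma in_add_dim0 M X : rdim X = 0%N -> in_add M X.
Proof.
move=> X0; exists 0%N, (fun=> 0), (fun=> 0); split=> [[]//|].
rewrite big_ord0; apply/matrixP => -[i ilt]; exfalso; by rewrite X0 in ilt.
Qed.

Lemma in_add_ext1_l M X Y : in_add M X -> ext1_zero M Y -> ext1_zero X Y.
Proof.
move=> [k [i [q [hiq iq]]]] ext.
by apply: (ext1_add_l (Z := fun=> M) _ _ iq) => // j; have [] := hiq j.
Qed.

Lemma in_add_ext1_r M X Y : in_add M Y -> ext1_zero X M -> ext1_zero X Y.
Proof.
move=> [k [i [q [hiq iq]]]] ext.
by apply: (ext1_add_r (Z := fun=> M) _ _ iq) => // j; have [] := hiq j.
Qed.

Lemma rep0_rels : @rels K 0 0 0.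
Proof. by rewrite /rels !mul0mx !addr0 eqxx. Qed.

(** Hom(M, X) is finite dimensional, so a direct sum with one copy of [M] for each element of a
    spanning family serves as the approximation. *)
Lemma right_approx M X : exists P (G : 'M[K]_(rdim P, rdim X)),
  [/\ in_add M P, rhom P X G &
      forall f, rhom M X f -> exists2 u, rhom M P u & f = u *m G].
Proof.
have [n [g [hg sg]]] := hom_span M X.
have [P [G [MP hG fG]]] : exists P (G : 'M[K]_(rdim P, rdim X)),
    [/\ in_add M P, rhom P X G & forall k : 'I_n, exists2 u, rhom M P u & g k = u *m G].
  suff [P [G [MP hG fG]]] : exists P (G : 'M[K]_(rdim P, rdim X)), [/\ in_add M P, rhom P X G &
      forall k, k \in enum 'I_n -> exists2 u, rhom M P u & g k = u *m G].
    by exists P, G; split=> // k; apply: fG; rewrite mem_enum.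
  elim: (enum 'I_n) => [|k ks [P [G [MP hG fG]]]].
    exists (Rep 0 0 0 rep0_rels), 0; split=> //; [exact: in_add_dim0 | exact: rhom0].
  have [p [j [p' [j' [[hp hj hp' hj'] [e1 e2 e3 e4 e]]]]]] := dsum_maps M P.
  exists (dsum M P), (p *m g k + p' *m G); split.
  - by apply: in_add_dsum => //; apply: in_add_refl.
  - by apply: rhomD; apply: rhomM.
  move=> l; rewrite inE => /orP[/eqP ->|/fG[u hu ->]].
    by exists j => //; rewrite mulmxDr !mulmxA e1 e2 mul1mx mul0mx addr0.
  exists (u *m j'); first exact: rhomM.
  by rewrite mulmxDr -!(mulmxA u) !(mulmxA j') e3 e4 mul0mx mulmx0 mul1mx add0r.
exists P, G; split=> // f /sg[c ->].
have ex k : exists u, rhom M P u /\ g k = u *m G by have [u hu eu] := fG k; exists u.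
have [u hu] := fin_all_exists ex; exists (\sum_k c k *: u k).
  by apply: rhom_sum => k _; apply: rhomZ; apply: (hu k).1.
rewrite mulmx_suml; apply: eq_bigr => k _.
by rewrite -scalemxAl (hu k).2.
Qed.

(* One half of the cluster tilting condition implies the other: the kernel of a
   right approximation of [X] has no extensions by [M], hence lies in add M. *)
Lemma cluster_tilting2_half M :
  (forall X (v : 'rV[K]_(rdim X)), exists k (u : 'I_k -> 'rV[K]_(rdim M)) f,
     (forall j, rhom M X (f j)) /\ v = \sum_j u j *m f j) ->
  ext1_zero M M -> (forall X, ext1_zero M X -> in_add M X) -> cluster_tilting2 M.
Proof.
move=> gM MM H; split=> X; split; last exact: H.
- by move=> MX; apply: in_add_ext1_l MX MM.
- move=> ext; have [P [G [MP hG fG]]] := right_approx M X.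
  have full : row_full G.
    rewrite -sub1mx; apply/row_subP => x; have [k [u [f [hf ->]]]] := gM X (row x 1%:M).
    apply: summx_sub => j _; have [w _ ->] := fG _ (hf j).
    by rewrite mulmxA submxMl.
  have [N [i [hi fi ei]]] := ker_rep hG.
  have iG : i *m G = 0 by apply/eqP; rewrite -sub_kermx; move/eqmxP: ei => <-.
  (* A piece of the long exact sequence: in [P] the cocycle becomes the coboundary of some [h]. Then
     [h G] is a homomorphism, lifts to [u] through the approximation, and [h - u] takes values in
     [N]. *)
  have MN : ext1_zero M N.
    apply: ext1_zeroP => c cc.
    have [h hh] := ext1_coboundary (in_add_ext1_r MP MM) (cocycleMr hi cc).
    have hGh : rhom M X (h *m G).
      apply/rhomP => b; have := congr1 (mulmxr G) (hh b).
      rewrite /= /coboundary mulmxBl -mulmxA iG mulmx0 -[h *m _ *m G]mulmxA (rhomP _ hG b).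
      by rewrite !mulmxA => /esym/eqP; rewrite subr_eq0 => /eqP.
    have [u hu hu'] := fG _ hGh.
    have [d ed] : exists d, d *m i = h - u.
      have /submxP[d ->] : (h - u <= i)%MS; last by exists d.
      by move/eqmxP: ei => ->; rewrite sub_kermx mulmxBl hu' subrr.
    exists d => b; apply: (row_free_inj fi); rewrite hh /coboundary mulmxBl.
    rewrite -!mulmxA (rhomP _ hi b) ed (mulmxA d) ed mulmxBr mulmxBl (rhomP _ hu b).
    by rewrite opprB addrA subrK.
  (* [N] lies in add M, so the sequence N -> P -> X splits and [X] is a summand of [P]. *)
  have XN : ext1_zero X N by apply: in_add_ext1_r ext; apply: H.
  have [s [hs sG]] := XN P i G hi hG fi full ei.
  have [k [a [b [hab ab]]]] := MP.
  exists k, (fun j => s *m a j), (fun j => b j *m G); split.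
    by move=> j; have [h1 h2] := hab j; rewrite !rhomM.
  under eq_bigr do rewrite mulmxA -(mulmxA s).
  by rewrite -mulmx_suml -mulmx_sumr ab mulmx1.
- by move=> MX; apply: in_add_ext1_r MX MM.
Qed.

End Tilting.

(** * Integer matrices *)

(* mathcomp takes the key %Z for int. *)
Delimit Scope Z_scope with stdZ.
(** Binary integers keep the checks by [vm_compute] fast. Missing entries read as 0, so the tables
    omit trailing zeros and [[::]] is the zero matrix of every size. *)
Definition zlist := seq (seq Z).
Definition ent (A : zlist) i j : Z := nth Z0 (nth [::] A i) j.
Definition lmk m n (f : nat -> nat -> Z) : zlist := mkseq (fun i => mkseq (f i) n) m.
Definition lsum n (f : nat -> Z) : Z := foldr (fun k z => Z.add (f k) z) Z0 (iota 0 n).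
Definition lmul m n p (A B : zlist) : zlist :=
  lmk m p (fun i j => lsum n (fun k => Z.mul (ent A i k) (ent B k j))).
Definition ladd m n (A B : zlist) : zlist := lmk m n (fun i j => Z.add (ent A i j) (ent B i j)).
Definition lscal m n z (A : zlist) : zlist := lmk m n (fun i j => Z.mul z (ent A i j)).
Definition lid n z : zlist := lmk n n (fun i j => if i == j then z else Z0).
Definition lbig m n k (F : nat -> zlist) : zlist :=
  foldr (fun x A => ladd m n (F x) A) [::] (iota 0 k).
Definition alln k (P : nat -> bool) := all P (iota 0 k).
Definition leqm m n (A B : zlist) : bool :=
  alln m (fun i => alln n (fun j => Z.eqb (ent A i j) (ent B i j))).

Lemma allnP k (P : nat -> bool) : reflect (forall i, (i < k)%N -> P i) (alln k P).
Proof.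
apply: (iffP allP) => h i.
  by move=> ik; apply: h; rewrite mem_iota.
by rewrite mem_iota => /andP[_]; apply: h.
Qed.

Lemma ent_lmk m n f i j : (i < m)%N -> (j < n)%N -> ent (lmk m n f) i j = f i j.
Proof. by move=> im jn; rewrite /ent nth_mkseq // nth_mkseq. Qed.

Section Zmx.
Context {K : fieldType}.

Definition zr (z : Z) : K := (int_of_Z z)%:~R.

Lemma zrD x y : zr (Z.add x y) = zr x + zr y.
Proof. by rewrite /zr (rmorphD int_of_Z) rmorphD. Qed.
Lemma zrM x y : zr (Z.mul x y) = zr x * zr y.
Proof. by rewrite /zr (rmorphM int_of_Z) rmorphM. Qed.
Lemma zr0 : zr Z0 = 0. Proof. by []. Qed.
Lemma zr1 : zr 1%stdZ = 1. Proof. by []. Qed.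

Lemma zr_lsum n (f : nat -> Z) : zr (lsum n f) = \sum_(k < n) zr (f k).
Proof.
rewrite -(big_mkord xpredT (fun k => zr (f k))) /index_iota subn0 /lsum.
by elim: (iota 0 n) => [|k s IH]; rewrite ?big_nil //= big_cons zrD IH.
Qed.

Definition zmx m n (A : zlist) : 'M[K]_(m, n) := \matrix_(i < m, j < n) zr (ent A i j).

Lemma zmx_eq m n A B : leqm m n A B -> zmx m n A = zmx m n B.
Proof.
move=> /allnP h; apply/matrixP => i j; rewrite !mxE.
by move/allnP: (h i (ltn_ord i)) => /(_ j (ltn_ord j))/Z.eqb_eq ->.
Qed.

Lemma zmx0 m n : zmx m n [::] = 0.
Proof. by apply/matrixP => i j; rewrite !mxE /ent !nth_nil. Qed.

Lemma zmxM m n p A B : zmx m n A *m zmx n p B = zmx m p (lmul m n p A B).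
Proof.
apply/matrixP => i j; rewrite !mxE ent_lmk // zr_lsum; apply: eq_bigr => k _.
by rewrite !mxE zrM.
Qed.

Lemma zmxD m n A B : zmx m n A + zmx m n B = zmx m n (ladd m n A B).
Proof. by apply/matrixP => i j; rewrite !mxE ent_lmk // zrD. Qed.

Lemma zmxZ m n z A : zr z *: zmx m n A = zmx m n (lscal m n z A).
Proof. by apply/matrixP => i j; rewrite !mxE ent_lmk // zrM. Qed.

Lemma zmx_id n z : zmx n n (lid n z) = (zr z)%:M.
Proof.
apply/matrixP => i j; rewrite !mxE ent_lmk // -val_eqE.
by case: eqP; rewrite ?mulr1n ?mulr0n.
Qed.

Lemma zmx_big m n k (F : nat -> zlist) : \sum_(x < k) zmx m n (F x) = zmx m n (lbig m n k F).
Proof.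
rewrite -(big_mkord xpredT (fun x => zmx m n (F x))) /index_iota subn0 /lbig.
elim: (iota 0 k) => [|x s IH]; first by rewrite big_nil zmx0.
by rewrite big_cons IH zmxD.
Qed.

Lemma zker m n p c A B U V : zr c != 0 ->
  leqm m m (ladd m m (lmul m n m A U) (lmul m p m V B)) (lid m c) ->
  (kermx (zmx m n A) <= zmx p m B)%MS.
Proof.
move=> c0 /zmx_eq; rewrite zmx_id -zmxD -!zmxM => h.
have : kermx (zmx m n A) *m (zr c)%:M = kermx (zmx m n A) *m zmx m p V *m zmx p m B.
  by rewrite -h mulmxDr !mulmxA mulmx_ker mul0mx add0r.
rewrite mul_mx_scalar => /(congr1 ( *:%R (zr c)^-1)).
by rewrite scalerA mulVf // scale1r scalemxAl => ->; rewrite submxMl.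
Qed.

Lemma zfull m n c A V : zr c != 0 -> leqm n n (lmul n m n V A) (lid n c) -> row_full (zmx m n A).
Proof.
move=> c0 /zmx_eq; rewrite zmx_id -zmxM => h; apply/row_fullP.
exists ((zr c)^-1 *: zmx n m V); by rewrite -scalemxAl h scale_scalar_mx mulVf.
Qed.

Lemma zfree m n c A U : zr c != 0 -> leqm m m (lmul m n m A U) (lid m c) -> row_free (zmx m n A).
Proof.
move=> c0 /zmx_eq; rewrite zmx_id -zmxM => h; apply/row_freeP.
exists ((zr c)^-1 *: zmx n m U); by rewrite -scalemxAr h scale_scalar_mx mulVf.
Qed.

Lemma zmul0 m n p A B : leqm m p (lmul m n p A B) [::] -> zmx m n A *m zmx n p B = 0.
Proof. by move=> /zmx_eq; rewrite -zmxM zmx0. Qed.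

Lemma zmulE m n p A B C : leqm m p (lmul m n p A B) C -> zmx m n A *m zmx n p B = zmx m p C.
Proof. by move=> /zmx_eq; rewrite -zmxM. Qed.

Lemma zrow m n A i : row i (zmx m n A) = zmx 1 n [:: nth [::] A i].
Proof. by apply/rowP => j; rewrite !mxE. Qed.

Definition lrels d A B := leqm d d (lmul d d d A A) [::] &&
  leqm d d (ladd d d (ladd d d (lmul d d d A B) (lmul d d d B B))
                     (lmul d d d (lmul d d d B B) A)) [::].

Lemma zrels d A B : lrels d A B -> rels d (zmx d d A) (zmx d d B).
Proof.
move=> /andP[/zmx_eq h1 /zmx_eq h2]; rewrite /rels !zmxM !zmxD.
by rewrite h1 h2 zmx0 eqxx.
Qed.

(* b^2 = aba - ab and bab = ab^2 = 0, so these words span the algebra. *)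
Definition word (V : rep K) (k : nat) : 'M[K]_(rdim V) :=
  match k with
  | 0 => 1%:M | 1 => ra V | 2 => rb V | 3 => ra V *m rb V | 4 => rb V *m ra V
  | _ => ra V *m rb V *m ra V
  end.

Lemma word_hom V W (f : 'M[K]_(rdim V, rdim W)) k : rhom V W f -> word V k *m f = f *m word W k.
Proof.
move=> /rhomP h; have ha : ra V *m f = f *m ra W := h false.
have hb : rb V *m f = f *m rb W := h true.
move: k => [|[|[|[|[|k]]]]] //=; first by rewrite mulmx1 mul1mx.
- by rewrite -mulmxA hb mulmxA ha mulmxA.
- by rewrite -mulmxA ha mulmxA hb mulmxA.
by rewrite -mulmxA ha mulmxA -(mulmxA _ _ f) hb mulmxA ha !mulmxA.
Qed.

(* Row [k] holds the coordinates of [w_k c] (in [lmat]: of [c w_k]) in the basis [w] of words;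
   [c] is b for [true] and a for [false]. *)
Definition rmat (c : bool) : zlist :=
  if c then [:: [:: 0; 0; 1]; [:: 0; 0; 0; 1]; [:: 0; 0; 0; -1; 0; 1]]%stdZ
  else [:: [:: 0; 1]; [::]; [:: 0; 0; 0; 0; 1]; [:: 0; 0; 0; 0; 0; 1]]%stdZ.

Definition lmat (c : bool) : zlist :=
  if c then [:: [:: 0; 0; 1]; [:: 0; 0; 0; 0; 1]; [:: 0; 0; 0; -1; 0; 1]; [::]; [:: 0; 0; 0; 0; 0; -1]]%stdZ
  else [:: [:: 0; 1]; [::]; [:: 0; 0; 0; 1]; [::]; [:: 0; 0; 0; 0; 0; 1]]%stdZ.

Lemma zrN1 : zr (-1)%stdZ = -1. Proof. by []. Qed.

Lemma word_r V c k : (k < 6)%N ->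
  word V k *m act V c = \sum_(l < 6) zr (ent (rmat c) k l) *: word V l.
Proof.
case: c; move: k => [|[|[|[|[|[|k]]]]]] // _;
  rewrite !big_ord_recl big_ord0 /ent /= ?zr0 ?zr1 ?zrN1 ?scale0r ?scale1r ?scaleN1r ?addr0 ?add0r ?mul1mx //.
- by rewrite bb addrC.
- by rewrite abb.
- by rewrite bab.
- by rewrite -!mulmxA (mulmxA (rb V)) bab mulmx0.
- by rewrite aa.
- by rewrite -mulmxA aa mulmx0.
- by rewrite -mulmxA aa mulmx0.
Qed.

Lemma word_l V c k : (k < 6)%N ->
  act V c *m word V k = \sum_(l < 6) zr (ent (lmat c) k l) *: word V l.
Proof.
case: c; move: k => [|[|[|[|[|[|k]]]]]] // _;
  rewrite !big_ord_recl big_ord0 /ent /= ?zr0 ?zr1 ?zrN1 ?scale0r ?scale1r ?scaleN1r ?addr0 ?add0r ?mulmx1 ?mulmxA //.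
- by rewrite bb addrC.
- by rewrite bab.
- by rewrite bba.
- by rewrite bab mul0mx.
- by rewrite aa.
- by rewrite aa mul0mx.
- by rewrite aa !mul0mx.
Qed.

End Zmx.

(** * The modules N_i and their certificates *)

(* Integer matrices of the basic modules: 0-4 are N_0 = DA, N_1, N_2, N_3, N_4 = A, 5 is
   the zero module and 6-9 are the syzygies of N_0, ..., N_3. *)
Definition basic_dim := [:: 6; 8; 5; 8; 6; 0; 6; 4; 1; 4]%N.

Definition basic_a : seq zlist :=
 [:: [:: [::]; [:: 1]; [::]; [:: 0; 0; 1]; [::]; [:: 0; 0; 0; 0; 1]];
 [:: [::]; [:: 1]; [:: 0; 0; 0; 0; 0; -1]; [::]; [:: 0; 0; 0; 1]; [::]; [::]; [:: 0; 0; 0; 0; 0;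
  0; 1]];
 [:: [::]; [:: 1]; [::]; [::]; [:: 0; 0; 0; 1]];
 [:: [::]; [:: 1]; [::]; [:: 0; 0; 1]; [:: 0; 0; 0; 0; 0; 0; 0; -1]; [::]; [:: 0; 0; 0; 0; 0; 1]];
 [:: [:: 0; 1]; [::]; [:: 0; 0; 0; 0; 1]; [:: 0; 0; 0; 0; 0; 1]];
 [::];
 [:: [:: 0; 0; 0; 0; 0; -1]; [:: 0; 0; 0; 1; 0; 1]; [:: 0; 0; 0; 0; 1]];
 [:: [:: 0; 0; 0; 1]; [:: 0; 0; 1]];
 [::];
 [:: [:: 0; 0; 1]; [:: 0; 0; 0; 1]]]%stdZ.

Definition basic_b : seq zlist :=
 [:: [:: [::]; [::]; [:: 1]; [:: 0; 0; -1]; [:: 0; 1]; [:: 0; 0; 1; 0; -1]];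
 [:: [::]; [::]; [:: 1; -1; 0; 0; 0; 1]; [::]; [::]; [:: 0; 0; 0; 1]; [:: 0; 0; 0; 0; 1]; [:: 0;
  0; 0; 0; 0; 1; -1]];
 [:: [::]; [::]; [:: 1]; [:: 0; 1]; [:: 0; 0; 1; -1]];
 [:: [::]; [:: 0; 0; 0; 0; 0; -1]; [:: 1]; [:: 0; 0; -1]; [:: 0; 1; 0; 0; 0; 0; 0; 1]; [::];
  [::]; [:: 0; 0; 0; 0; 0; 0; 1]];
 [:: [:: 0; 0; 1]; [:: 0; 0; 0; 1]; [:: 0; 0; 0; -1; 0; 1]];
 [::];
 [:: [:: 0; 0; 1]; [:: 0; 0; -1; 0; 1]];
 [:: [:: 0; 1]];
 [::];
 [:: [:: 0; 0; 0; 1]]]%stdZ.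

(* The sequences N_i -> C_i -> D_i -> N_{i-1}. *)
Definition src : seq zlist :=
 [:: [:: [::]; [:: 1]; [:: 0; 0; 0; 0; 0; 0; 0; 0; 1; 0; 0; 0; 0; 1]; [:: 0; 0; 0; 0; 0; 0; 0; 0; 0;
  1; -1; 0; 0; 0; 1]; [:: 0; 0; 1; 0; 0; 0; 0; 0; -1]; [:: 0; 0; 0; 1; 0; 0; 0; 0; 0; -1; 2]];
 [:: [:: 0; 0; 0; 0; 0; 0; 0; 0; 0; 0; 0; -1; 0; 0; 0; 0; 0; -1]; [:: 0; 0; 0; 0; 0; 0; 0; 0; 0;
  -1; 0; -1; 0; 0; 0; -1; 1; 1]; [:: 0; 0; 0; -1; 0; 0; 0; 1; 0; 0; 0; 0; 0; 0; -1; -1]; [:: 1];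
  [:: 0; 1]; [:: 0; 0; 1; 0; 0; 0; 0; 0; 0; 0; 0; 0; 0; 0; 0; 0; 1; 1]; [:: 0; 0; 0; 0; 1; 0; 0;
  0; 0; 0; 0; 0; 0; 0; 0; 0; 1]; [:: 0; 0; 0; 0; 0; 1; 0; 0; 0; 0; 0; 0; 0; 1; 1]];
 [:: [:: 0; 0; 0; 1]; [:: 0; 0; 0; 0; 1]; [:: 0; 0; 0; 0; 0; 1]; [:: 0; 0; 0; 0; 0; 0; 1]; [:: 0;
  0; 0; 0; 0; 0; 0; 1]];
 [:: [:: 1]; [:: 0; 1; 0; 0; 0; 0; 0; 0; -1]; [:: 0; 0; 1]; [:: 0; 0; 0; 1]; [:: 0; 0; 0; 0; 1;
  0; 0; 0; 0; 0; -1]; [:: 0; 0; 0; 0; 0; 0; 1]; [:: 0; 0; 0; 0; 0; 0; 0; 1]; [:: 0; 0; 0; 0; 0;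
  0; 0; 0; 0; 1]];
 [:: [:: 0; 0; -1; 0; 0; 0; 0; 0; 0; 0; 0; 0; -1]; [:: 0; 0; 0; 0; 0; 1; 0; 0; 0; 0; 0; 0; 0; 0;
  0; 1]; [:: -1; 1; 0; 0; 0; -1; 0; 0; 0; -1; 0; 0; 0; 0; 0; -1]; [:: 0; 0; 0; 1; 0; 0; 0; 0; 0;
  0; 0; 0; 0; 0; 1]; [:: 1; 0; 0; 0; 0; 0; 0; 0; -1]; [:: 0; 0; 0; 0; 0; 0; 0; 0; 0; 0; 0; 0; 0;
  1]]]%stdZ.

Definition mid : seq zlist :=
 [:: [:: [::]; [:: 0; 0; 0; 0; 0; 0; 0; 0; -1]; [:: -1]; [:: 0; -1; 1]; [:: 0; 0; 0; 0; 0; 0; 0; 0;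
  0; 0; -1]; [:: 0; 0; 0; 0; 0; 0; 1]; [:: 0; 0; 0; 0; 0; 0; 0; 1]; [:: 0; 0; 0; 0; 0; 0; 0; 0;
  0; 1]; [:: -1]; [:: 0; -1; -1]; [:: 0; 0; -1]; [:: 0; 0; 0; -1]; [:: 0; 0; 0; 0; -1; -1]; [::
  1]; [:: 0; 1]; [:: 0; 0; 0; 0; 1]];
 [:: [::]; [::]; [:: 0; 0; 0; -1; 0; 0; 0; 0; 1; 0; 0; 0; 0; 1]; [:: 0; 0; 0; 0; -1; 1; 0; 0; 0;
  1; -1; 0; 0; 0; 1]; [:: 0; 0; 0; -1; 0; 0; 0; 0; 1; 0; 0; 0; 0; 2]; [:: 0; 0; 0; 0; -1; 0; 0;
  0; 0; 1; 0; 0; 0; 0; 2]; [:: 0; 0; -1; 0; 0; 0; 0; 0; 0; 0; 0; -1; 1]; [:: 0; 0; 0; 0; 0; 1;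
  0; 0; 0; 0; -1; 0; 0; 0; 0; -1]; [:: -1; 1; 0; 0; 0; -1; 0; 0; 0; 1; 1; 0; 0; 0; 0; 1]; [:: 0;
  0; 0; 1; 0; 0; 0; 0; -1; 0; 0; 0; 0; 0; -1]; [:: 1; 0; 0; 0; 0; 0; 0; 0; 1]; [:: 0; 0; 0; 0;
  0; 0; 0; 0; 0; 0; 0; 0; 0; -1]; [:: 0; 0; 0; 0; 0; 0; 1; 0; 0; 0; 0; 0; -1; 0; 0; -2]; [:: 0;
  0; 0; 0; 0; 0; 0; 0; 0; 0; 0; 0; 0; 0; 0; 1]; [:: 0; 0; 0; 0; 1; 0; 0; 0; 0; -1; 0; 0; 0; 0;
  -2; -1]; [:: 0; 0; 0; 0; 0; 0; 0; 0; 0; 0; 0; 0; 0; 0; 1]; [:: 0; 0; 0; 1; 0; 0; 0; 0; -1; 0;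
  0; 0; 0; -2]; [:: 0; 0; 0; 0; 0; 0; 0; 0; 0; 0; 0; 0; 0; 1]];
 [:: [:: 0; 0; 0; 0; 0; 0; 0; 0; 0; 0; -1]; [:: -1; 0; 0; 0; 0; 0; 0; 0; -1; 0; -1]; [:: 0; 0; 1;
  0; 0; 0; 1]];
 [:: [::]; [:: 1]; [::]; [::]; [:: 0; 0; 1]; [:: 0; 0; 0; 1]; [::]; [::]; [:: 1]; [::]; [:: 0; 0;
  1]];
 [:: [:: 1]; [:: 1; 1; 0; 0; 0; 0; 0; 0; 0; 0; 0; 0; 0; 0; 0; 0; -1; -1]; [:: 0; 0; 0; 0; -1; 0;
  0; 0; 0; 1; 0; 0; 0; 1; 1]; [:: 0; 0; 0; 0; 0; 0; -1]; [:: 0; 0; 0; 0; 0; 0; 0; -1]; [:: 0; 0;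
  0; 0; 0; 0; 0; 0; -1; 0; 0; 0; 0; 0; 0; 0; -1]; [:: 0; 0; 0; 0; 0; 0; 0; 0; 0; 0; -1; 0; 0; 0;
  0; 0; -1; 1]; [:: 0; 0; 0; 0; 0; 0; 0; 0; 0; 0; 0; -1; 0; -1; -1; 1]; [:: 1]; [:: 0; 1; 0; 0;
  0; 0; 0; 0; 0; 0; 0; 0; 0; 0; 0; 0; -1; -1]; [:: 0; 0; 1]; [:: 0; 0; 0; 1]; [:: 0; 0; 0; 0; 1;
  0; 0; 0; 0; -1; 0; 0; 0; -1; -1]; [::]; [:: 0; 0; 0; 0; 0; 0; 1]; [:: 0; 0; 0; 0; 0; 0; 0; 0;
  1; 0; 0; 0; 0; 0; 0; 0; 1]]]%stdZ.

Definition epi : seq zlist :=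
 [:: [::];
 [:: [:: -1]; [:: -1; -1]; [:: 0; 0; 0; -1; 1]; [:: 1]; [:: 0; 1]; [:: 0; 0; 1]; [:: 0; 0; 0; 0;
  1]; [:: 0; 0; 0; 0; 0; 1]; [:: 1]; [:: 0; 1]; [:: 0; 0; 1]; [:: 0; 0; 0; 1]; [:: 0; 0; 0; 0;
  1]];
 [:: [:: 0; 0; 0; -1]; [:: 0; 0; 0; 0; -1]; [:: 0; 0; 0; 0; 0; -1]; [:: 0; 0; 0; 0; 0; 0; -1];
  [:: 0; 0; 0; 0; 0; 0; 0; -1]; [:: 0; 0; -1]; [:: 0; 0; 0; 0; 0; 1]; [:: -1; 1; 0; 0; 0; -1];
  [:: 0; 0; 0; 1]; [:: 1]];
 [:: [::]; [:: 0; 0; -1]; [::]; [::]; [:: 0; 0; 0; 0; -1]; [:: 1]; [:: 0; 1]; [:: 0; 0; 0; 1]];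
 [:: [::]; [:: -1]; [::]; [::]; [:: 0; 0; -1]; [:: 0; 0; 0; -1]; [::]; [::]; [:: 1; 0; 0; 0; 0;
  1]; [:: 0; 1; -1; 0; 0; 0; 1]; [:: 1; 0; 0; 0; 0; 2]; [:: 0; 1; 0; 0; 0; 0; 2]; [:: 0; 0; 0;
  0; -1; 0; 0; -1]; [:: 0; 0; 0; 0; 0; 0; 0; 1]; [:: 0; -1; 0; 0; 0; 0; -1; -1]; [:: 0; 0; 0; 0;
  0; 0; 1]; [:: -1; 0; 0; 0; 0; -1]; [:: 0; 0; 0; 0; 0; 1]]]%stdZ.

(* A certificate [(c, (U, V))] for maps f, g means f U + V g = c, so that ker f lies in
   the image of g; here and below [(c, U)] is a one-sided inverse up to the scalar c. *)
Definition cert_mid : seq (Z * (zlist * zlist)) :=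
 [:: (2, ([:: [:: 0; 0; -2]; [:: 0; 0; 0; -1; 0; 0; 0; 0; 0; -1]; [:: 0; 0; 0; 1; 0; 0; 0; 0; 0; -1];
  [:: 0; 0; 0; 0; 0; 0; 0; 0; 0; 0; 0; -2]; [:: 0; 0; 0; 0; 0; 0; 0; 0; 0; 0; 0; 0; 0; 0; 0; 2];
  [:: 0; 0; 0; 0; 0; 0; 0; 0; 0; 0; 0; 0; -2; 0; 0; -2]; [:: 0; 0; 0; 0; 0; 2]; [:: 0; 0; 0; 0;
  0; 0; 2]; [:: 0; -2]; [:: 0; 0; 0; 0; 0; 0; 0; 2]; [:: 0; 0; 0; 0; -2]], [:: [:: 0; 2]; [::];
  [::]; [::]; [::]; [::]; [::]; [::]; [:: 0; 0; 0; 0; -2]; [::]; [:: 0; 0; 0; 0; 0; 1]; [::];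
  [::]; [:: 0; 0; 2; 0; 2]; [:: 0; 0; 0; 2; 0; 1]]));
 (1, ([:: [:: 0; 0; 0; 0; 0; 0; 0; 0; 0; 0; 1]; [:: 0; 0; 0; 0; 0; 0; 0; 1; 1; 0; 1]; [:: 0; 0;
  0; 0; 0; 0; -1]; [:: 0; 0; -2; 0; 1]; [:: 0; 0; -4; 0; 2; -1; 0; 0; 0; -2]; [:: 0; 0; -2; 1;
  1; -1; 0; 0; 0; -1]; [:: 0; 0; -4; 2; 2; -2; 0; -2; 0; -2; 0; 0; 1]; [::]; [::]; [::]; [::];
  [::]; [::]; [:: 0; 0; -1; 0; 1]; [:: 0; 0; -2; 0; 1; 0; 0; 0; 0; -1]; [:: 0; 0; -2; 1; 1; -1;
  0; -1; 0; -1]], [:: [:: 0; 0; 0; 1]; [:: 0; 0; 0; 0; 1]; [::]; [::]; [::]; [::]; [::]; [::];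
  [::]; [::]; [::]; [:: -1; 0; 0; 0; 0; -1; 1]; [::]; [:: 1; -1; 1; 0; 0; 2; -1; 1]; [:: -1; 1;
  -1; 0; 0; -2; 1]; [:: 1; -1; 0; 0; 0; 2; -1]; [:: 0; 0; 0; 0; 0; 0; 1]; [:: 0; 0; 0; 0; 0; 1;
  -1]]));
 (1, ([:: [:: 1; -1]; [::]; [:: 0; 0; 1]; [::]; [::]; [::]; [::]; [::]; [::]; [::]; [:: -1]], [::
  [::]; [::]; [::]; [:: 1]; [:: 0; 1]; [:: 0; 0; 1]; [:: 0; 0; 0; 1]; [:: 0; 0; 0; 0; 1]]));
 (1, ([:: [:: 0; 1]; [::]; [:: 0; 0; 0; 0; 1]; [:: 0; 0; 0; 0; 0; 1]], [:: [:: 1]; [::]; [:: 0;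
  0; 1]; [:: 0; 0; 0; 1]; [::]; [::]; [:: 0; 0; 0; 0; 0; 1]; [:: 0; 0; 0; 0; 0; 0; 1]; [:: 0;
  -1]; [:: 0; 0; 0; 0; 0; 0; 0; 1]; [:: 0; 0; 0; 0; -1]]));
 (1, ([:: [:: 1]; [:: -1; 1]; [:: 0; 0; 0; 0; 0; 0; 0; 0; 0; 0; 1]; [:: 0; 0; 0; 0; 0; 0; 0; 0;
  0; 0; 0; 1]; [:: 0; 0; -1]; [::]; [:: 0; 0; 0; -1]; [:: 0; 0; 0; 0; -1]; [:: 0; 0; 0; 0; 0;
  -1]; [::]; [:: 0; 0; 0; 0; 0; 0; -1]; [:: 0; 0; 0; 0; 0; 0; 0; -1]], [:: [::]; [::]; [::];
  [::]; [::]; [::]; [::]; [::]; [:: 0; 0; 0; 0; -1]; [:: 0; -1; -1]; [::]; [::]; [:: -1]; [:: 0;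
  0; 0; 0; 0; 1]; [:: 0; 0; 0; 1]; [:: 0; 1]]))]%stdZ.

Definition cert_epi : seq (Z * (zlist * zlist)) :=
 [:: (2, ([::], [:: [:: 0; 0; -2]; [:: 0; 0; 0; -1; 0; 0; 0; 0; 0; -1]; [:: 0; 0; 0; 1; 0; 0; 0; 0;
  0; -1]; [:: 0; 0; 0; 0; 0; 0; 0; 0; 0; 0; 0; -2]; [:: 0; 0; 0; 0; 0; 0; 0; 0; 0; 0; 0; 0; 0;
  0; 0; 2]; [:: 0; 0; 0; 0; 0; 0; 0; 0; 0; 0; 0; 0; -2; 0; 0; -2]; [:: 0; 0; 0; 0; 0; 2]; [:: 0;
  0; 0; 0; 0; 0; 2]; [:: 0; -2]; [:: 0; 0; 0; 0; 0; 0; 0; 2]; [:: 0; 0; 0; 0; -2]]));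
 (1, ([:: [:: -1]; [:: 1; -1]; [:: 0; 0; 0; 0; 0; 1]; [:: 0; 0; -1; 0; 0; 0; 1]; [:: 0; 0; 0; 0;
  0; 0; 1]; [:: 0; 0; 0; 0; 0; 0; 0; 1]], [:: [::]; [::]; [::]; [:: 0; 0; -2; 0; 1; 0; 0; 0; 0;
  0; 1]; [:: 0; 0; -4; 0; 2; -1; 0; 1; 1; -2]; [::]; [::]; [::]; [:: 0; 0; 0; 0; 0; 0; 0; 0; 0;
  0; 1]; [:: 0; 0; 0; 0; 0; 0; 0; 1; 1]; [:: 0; 0; 2; -1; -1; 1; 0; 0; 0; 1]; [:: 0; 0; 4; -2;
  -2; 2; -1; 2; 0; 2; 0; 0; -1]; [:: 0; 0; 4; -2; -2; 2; 0; 2; 0; 2; 0; 0; -1]; [:: 0; 0; -1; 0;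
  1]; [:: 0; 0; -2; 0; 1; 0; 0; 0; 0; -1]; [:: 0; 0; -2; 1; 1; -1; 0; -1; 0; -1]]));
 (1, ([:: [:: 0; 0; 0; 0; 0; 0; 0; 0; 0; 1]; [:: 0; 0; -1; 0; 0; 0; 0; 1; 0; 1]; [:: 0; 0; 0; 0;
  0; -1]; [:: -1]; [:: 0; -1]; [:: 0; 0; -1]; [:: 0; 0; 0; -1]; [:: 0; 0; 0; 0; -1]], [:: [::];
  [::]; [::]; [::]; [::]; [::]; [:: 0; 0; 1]; [::]; [:: 1; -1]; [::]; [:: -1]]));
 (1, ([:: [:: 0; 0; 0; 0; 0; 1]; [:: 0; 0; 0; 0; 0; 0; 1]; [:: 0; -1]; [:: 0; 0; 0; 0; 0; 0; 0;
  1]; [:: 0; 0; 0; 0; -1]], [:: [:: 0; 1]; [::]; [:: 0; 0; 0; 0; 1]; [:: 0; 0; 0; 0; 0; 1]]));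
 (1, ([:: [:: 0; -1]; [:: 0; 0; 0; 0; -2; 0; 0; 0; 0; 2; 0; -1]; [:: 0; 0; 0; 0; -1]; [:: 0; 0;
  0; 0; 0; -1]; [:: 0; 0; 0; 0; 0; 0; 0; 0; 0; 0; 0; 0; -1; -1]; [:: 0; 1; 0; 0; 0; 0; 0; 0; 1];
  [:: 0; 0; 0; 0; 1; 0; 0; 0; 0; -1; 0; 1]; [:: 0; 0; 0; 0; 0; 0; 0; 0; 0; 0; 0; 0; 0; 1]], [::
  [:: 1]; [::]; [:: 0; 0; 0; 0; 0; 0; 0; 0; 0; 0; 1]; [:: 0; 0; 0; 0; 0; 0; 0; 0; 0; 0; 0; 1];
  [::]; [::]; [:: 0; 0; 0; -1]; [:: 0; 0; 0; 0; -1]; [::]; [::]; [:: 1; -1; 0; 0; 0; 2; -1];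
  [::]; [::]; [::]; [:: 0; 0; 1]; [:: 0; 0; 1; 0; 0; 0; 0; 1]; [:: 0; 0; 0; 0; 0; -1]; [:: 1;
  -1; 0; 0; 0; 1]]))]%stdZ.

Definition cert_epi_full : seq (Z * zlist) :=
 [:: (1, [::]);
 (1, [:: [:: -1]; [:: 1; -1]; [:: 0; 0; 0; 0; 0; 1]; [:: 0; 0; -1; 0; 0; 0; 1]; [:: 0; 0; 0; 0;
  0; 0; 1]; [:: 0; 0; 0; 0; 0; 0; 0; 1]]);
 (1, [:: [:: 0; 0; 0; 0; 0; 0; 0; 0; 0; 1]; [:: 0; 0; -1; 0; 0; 0; 0; 1; 0; 1]; [:: 0; 0; 0; 0;
  0; -1]; [:: -1]; [:: 0; -1]; [:: 0; 0; -1]; [:: 0; 0; 0; -1]; [:: 0; 0; 0; 0; -1]]);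
 (1, [:: [:: 0; 0; 0; 0; 0; 1]; [:: 0; 0; 0; 0; 0; 0; 1]; [:: 0; -1]; [:: 0; 0; 0; 0; 0; 0; 0;
  1]; [:: 0; 0; 0; 0; -1]]);
 (1, [:: [:: 0; -1]; [:: 0; 0; 0; 0; -2; 0; 0; 0; 0; 2; 0; -1]; [:: 0; 0; 0; 0; -1]; [:: 0; 0; 0;
  0; 0; -1]; [:: 0; 0; 0; 0; 0; 0; 0; 0; 0; 0; 0; 0; -1; -1]; [:: 0; 1; 0; 0; 0; 0; 0; 0; 1];
  [:: 0; 0; 0; 0; 1; 0; 0; 0; 0; -1; 0; 1]; [:: 0; 0; 0; 0; 0; 0; 0; 0; 0; 0; 0; 0; 0; 1]])]%stdZ.

(* The arrows N_i -> N_j send a basis vector to basis vectors of smaller weight: this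
   witnesses the nilpotency of the radical of End M. *)
Definition wts : seq (seq nat) :=
 [:: [:: 0; 2; 4; 10; 6; 12];
 [:: 5; 7; 11; 1; 3; 7; 7; 13];
 [:: 2; 4; 8; 8; 14];
 [:: 1; 9; 5; 11; 15; 3; 5; 9];
 [:: 16; 10; 10; 6; 6; 4]]%N.

(* Minimal projective resolutions P_2 -> P_1 -> P_0 -> N_i, with P_1 -> P_0 factored
   through the syzygy of N_i. *)
Definition projcov0 : seq zlist :=
 [:: [:: [:: 0; 0; 0; 1]; [:: 0; 0; 1]; [:: 0; 0; -1]; [:: 1]; [::]; [::]; [:: 0; 0; 0; 0; 0; 1]; [::
  0; 0; 0; 0; 1]; [:: 0; 0; 1; 0; -1]; [:: 0; 1]; [::]; [:: 1]];
 [:: [:: 0; 0; 1]; [:: 0; 0; 0; 0; 0; -1]; [:: 1; -1; 0; 0; 0; 1]; [:: 0; 0; 0; -1]; [:: -1];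
  [::]; [:: 0; 0; 0; 0; 0; 0; 0; 1]; [:: 0; 0; 0; 0; 0; 0; 1]; [:: 0; 0; 0; 0; 0; 1; -1]; [:: 0;
  0; 0; 0; 1]; [::]; [:: 0; 0; 0; 1]];
 [:: [:: 0; 0; 0; 0; 1]; [:: 0; 0; 0; 1]; [:: 0; 0; 1; -1]; [:: 0; 1]; [::]; [:: 1]];
 [:: [:: 0; 0; 0; 1]; [:: 0; 0; 1]; [:: 0; 0; -1]; [:: 1]; [::]; [::]; [:: 0; 0; 0; 0; 1]; [:: 0;
  0; 0; 0; 0; 0; 0; -1]; [:: 0; 1; 0; 0; 0; 0; 0; 1]; [:: 0; 0; 0; 0; 0; 0; -1]; [:: 1]; [:: 0;
  0; 0; 0; 0; -1]];
 [:: [:: 1]; [:: 0; 1]; [:: 0; 0; 1]; [:: 0; 0; 0; 1]; [:: 0; 0; 0; 0; 1]; [:: 0; 0; 0; 0; 0; 1]]]%stdZ.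

Definition pres1 : seq zlist :=
 [:: [:: [:: 0; 1; 0; 0; 0; 0; 0; -1; -1]; [:: 0; 0; 0; 0; 0; 0; 0; 0; 0; 0; -1]; [:: 0; 0; 0; 1; 0;
  0; 0; 0; 0; 0; 0; -1]; [::]; [:: 0; 0; 0; 0; 0; 1]; [::]; [:: 0; 0; 1; 0; 0; 0; 0; 1; 1]; [::
  0; 0; 0; 0; 1; 0; 0; 0; 0; 0; 1]; [:: 0; 0; 0; -1; 0; 1; 0; 0; 0; 0; 0; 1]; [::]; [:: 0; 0; 0;
  0; 0; -1]];
 [:: [:: 0; 1; 0; 0; 0; 0; 0; 1; 1]; [:: 0; 0; 0; 0; 0; 0; 0; 0; 0; 0; 1]; [:: 0; 0; 0; 1; 0; 0;
  0; 0; 0; 0; 0; 1]; [::]; [:: 0; 0; 0; 0; 0; 1]];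
 [:: [:: 0; 0; 0; 0; 1]];
 [:: [:: 0; 1; 1]; [:: 0; 0; 0; 0; 1]; [:: 0; 0; 0; 0; 0; 1]; [::]; [::]; [::]; [:: 0; 0; 0; 1;
  0; 0; 0; 0; 0; 0; -1]; [:: 0; 0; 0; 0; 0; 1]];
 [::]]%stdZ.

Definition pres2 : seq zlist :=
 [:: [:: [:: 0; 0; 1; 0; 0; 0; 0; 0; 1; 0; 1]; [:: 0; 0; 0; 0; 1; 0; 0; 0; 0; 0; 1]; [:: 0; 0; 0; -1;
  0; 1; 0; 0; 0; -1; 0; 1]; [::]; [:: 0; 0; 0; 0; 0; -1; 0; 0; 0; 0; 0; -1]; [::]; [:: 0; 0; 0;
  1]; [:: 0; 0; 0; 0; 0; 1]];
 [:: [:: 0; 0; 0; 1]; [:: 0; 0; 0; 0; 0; 1]];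
 [:: [:: 0; 1]; [::]; [:: 0; 0; 0; 1]; [::]; [:: 0; 0; 0; 0; 0; 1]; [::]; [:: 0; 0; 1]; [:: 0; 0;
  0; 0; 1]; [:: 0; 0; 0; -1; 0; 1]; [::]; [:: 0; 0; 0; 0; 0; -1]];
 [:: [:: 0; 0; 1; 0; 0; 0; 0; -1]; [:: 0; 0; 0; 0; 1]; [:: 0; 0; 0; -1; 0; 1; 0; 0; 0; -1]; [::];
  [:: 0; 0; 0; 0; 0; -1; 0; 0; 0; 0; 0; -1]; [::]; [:: 0; 0; 0; 0; 0; 0; 0; 0; 1]; [:: 0; 0; 0;
  0; 0; 0; 0; 0; 0; 0; 1]; [:: 0; 0; 0; 0; 0; 0; 0; 0; 0; -1; 0; 1]; [::]; [:: 0; 0; 0; 0; 0; 0;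
  0; 0; 0; 0; 0; -1]];
 [::]]%stdZ.

Definition projcov1 : seq zlist :=
 [:: [:: [:: 1]; [:: 0; 0; 0; 0; 0; -1]; [:: 0; 0; 1]; [::]; [:: 0; 0; 0; 0; 1]; [::]; [:: 0; 1]; [::
  0; 0; 0; 1; 0; 1]; [:: 0; 0; -1; 0; 1]; [::]; [:: 0; 0; 0; 0; -1]];
 [:: [:: 1]; [:: 0; 0; 0; 1]; [:: 0; 1]; [::]; [:: 0; 0; 1]];
 [:: [:: 1]];
 [:: [:: 1]; [:: 0; 0; 1]; [:: 0; 0; 0; 1]; [::]; [::]; [::]; [:: 0; 1]; [:: 0; 0; 0; 1]]]%stdZ.

Definition incl : seq zlist :=
 [:: [:: [:: 0; 1; 0; 0; 0; 0; 0; -1; -1]; [:: 0; 0; 1; 0; 0; 0; 0; 1; 1]; [:: 0; 0; 0; 1; 0; 0; 0;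
  0; 0; 0; 0; -1]; [:: 0; 0; 0; 0; 1]; [:: 0; 0; 0; 0; 0; 1]; [:: 0; 0; 0; 0; 0; 0; 0; 0; 0; 0;
  1]];
 [:: [:: 0; 1; 0; 0; 0; 0; 0; 1; 1]; [:: 0; 0; 0; 1; 0; 0; 0; 0; 0; 0; 0; 1]; [:: 0; 0; 0; 0; 0;
  1]; [:: 0; 0; 0; 0; 0; 0; 0; 0; 0; 0; 1]];
 [:: [:: 0; 0; 0; 0; 1]];
 [:: [:: 0; 1; 1]; [:: 0; 0; 0; 1; 0; 0; 0; 0; 0; 0; -1]; [:: 0; 0; 0; 0; 1]; [:: 0; 0; 0; 0; 0;
  1]]]%stdZ.

(* D Hom(P_2, A) -> D Hom(P_1, A) and the inclusion of its kernel N_{i+1}. *)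
Definition dualpres : seq zlist :=
 [:: [:: [::]; [::]; [:: 1; 0; 0; 0; 0; 0; 1]; [:: 0; 1; -1; 0; 0; 0; 0; 1; -1]; [:: 0; 0; 0; 0; 0;
  0; 1]; [:: 0; 0; 1; 0; 0; 0; 0; 1]; [::]; [::]; [::]; [:: 1]];
 [:: [::]; [::]; [::]; [:: 1]];
 [:: [::]; [:: 1]; [::]; [::]; [:: 0; 0; 1]; [:: 0; 0; 0; 1]; [::]; [::]; [:: 1]; [:: 0; 1; -1];
  [::]; [:: 0; 0; 1]];
 [:: [::]; [:: 0; 0; 0; 0; 0; 0; -1]; [:: 1]; [:: 0; 1; -1]; [:: 0; 0; 0; 0; 0; 0; 0; 0; -1]; [::
  0; 0; 1; 0; 0; 0; 0; 0; 0; -1]; [::]; [::]; [:: 0; 0; 0; 0; 0; 0; 1]; [:: 0; 0; 0; 0; 0; 0; 0;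
  1; -1]; [::]; [:: 0; 0; 0; 0; 0; 0; 0; 0; 1]]]%stdZ.

Definition taumap : seq zlist :=
 [:: [:: [:: 1]; [:: 0; 1]; [:: 0; 0; 1; 0; -1; 0; 0; 0; 0; -1]; [:: 0; 0; 0; 0; 0; 0; 1]; [:: 0; 0;
  0; 0; 0; 0; 0; 1]; [:: 0; 0; 0; 0; 0; 0; 0; 0; 1]; [:: 0; 0; 0; 0; 0; 0; 0; 0; 0; 0; 1]; [::
  0; 0; 0; 0; 0; 0; 0; 0; 0; 0; 0; 1]];
 [:: [:: 1]; [:: 0; 1]; [:: 0; 0; 1]; [:: 0; 0; 0; 0; 1]; [:: 0; 0; 0; 0; 0; 1]];
 [:: [:: 1]; [:: 0; 1; 0; 0; 0; 0; 0; 0; -1]; [:: 0; 0; 1]; [:: 0; 0; 0; 1]; [:: 0; 0; 0; 0; 1;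
  0; 0; 0; 0; 0; 0; -1]; [:: 0; 0; 0; 0; 0; 0; 1]; [:: 0; 0; 0; 0; 0; 0; 0; 1]; [:: 0; 0; 0; 0;
  0; 0; 0; 0; 0; 0; 1]];
 [:: [:: 0; 0; 0; 0; 1; 0; 0; 0; 0; 0; 0; 1]; [:: 0; 0; 0; 0; 0; 0; 0; 0; 0; 0; 1]; [:: 0; 1; 0;
  0; 0; 0; 0; 0; 1; 0; -1]; [:: 0; 0; 0; 0; 0; 0; 0; 1]; [:: 1]; [:: 0; 0; 0; 0; 0; 0; 1]]]%stdZ.

Definition cert_cover0 : seq (Z * (zlist * zlist)) :=
 [:: (1, ([:: [:: 0; 0; 0; 1]; [:: 0; 0; 0; 0; 0; 0; 0; 0; 0; 1]; [:: 0; 1]; [:: 1]; [:: 0; 0; 0; 0;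
  0; 0; 0; 1]; [:: 0; 0; 0; 0; 0; 0; 1]], [:: [::]; [::]; [:: 1; 0; 0; 0; 0; 0; 1]; [::]; [:: 0;
  1; 0; 0; 0; 0; 0; 1]; [:: 0; 0; 0; 0; 1]; [::]; [::]; [:: -1]; [::]; [:: 0; -1]; [:: 0; 0;
  -1]]));
 (1, ([:: [:: 0; 0; 0; 0; -1]; [:: 0; -1; -1; 0; -1]; [:: 1]; [:: 0; 0; 0; -1]; [:: 0; 0; 0; 0;
  0; 0; 0; 0; 0; 1]; [:: 0; -1]; [:: 0; 0; 0; 0; 0; 0; 0; 1]; [:: 0; 0; 0; 0; 0; 0; 1]], [::
  [::]; [::]; [::]; [::]; [::]; [:: 0; 0; 0; 0; 1]; [::]; [::]; [:: 1]; [::]; [:: 0; 1]; [:: 0;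
  0; 1]]));
 (1, ([:: [:: 0; 0; 0; 0; 0; 1]; [:: 0; 0; 0; 1]; [:: 0; 1; 1]; [:: 0; 1]; [:: 1]], [:: [::];
  [::]; [::]; [::]; [:: 1]]));
 (1, ([:: [:: 0; 0; 0; 1]; [:: 0; 0; 0; 0; 0; 0; 0; 1; 1]; [:: 0; 1]; [:: 1]; [:: 0; 0; 0; 0; 0;
  0; 1]; [:: 0; 0; 0; 0; 0; 0; 0; 0; 0; 0; 0; -1]; [:: 0; 0; 0; 0; 0; 0; 0; 0; 0; -1]; [:: 0; 0;
  0; 0; 0; 0; 0; -1]], [:: [::]; [::]; [:: 1]; [::]; [:: 0; 1]; [:: 0; 0; 1]; [::]; [::]; [::];
  [::]; [:: 0; 0; 0; 0; 0; 0; -1]]));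
 (1, ([:: [:: 1]; [:: 0; 1]; [:: 0; 0; 1]; [:: 0; 0; 0; 1]; [:: 0; 0; 0; 0; 1]; [:: 0; 0; 0; 0;
  0; 1]], [::]))]%stdZ.

Definition cert_cover0_full : seq (Z * zlist) :=
 [:: (1, [:: [:: 0; 0; 0; 1]; [:: 0; 0; 0; 0; 0; 0; 0; 0; 0; 1]; [:: 0; 1]; [:: 1]; [:: 0; 0; 0; 0;
  0; 0; 0; 1]; [:: 0; 0; 0; 0; 0; 0; 1]]);
 (1, [:: [:: 0; 0; 0; 0; -1]; [:: 0; -1; -1; 0; -1]; [:: 1]; [:: 0; 0; 0; -1]; [:: 0; 0; 0; 0; 0;
  0; 0; 0; 0; 1]; [:: 0; -1]; [:: 0; 0; 0; 0; 0; 0; 0; 1]; [:: 0; 0; 0; 0; 0; 0; 1]]);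
 (1, [:: [:: 0; 0; 0; 0; 0; 1]; [:: 0; 0; 0; 1]; [:: 0; 1; 1]; [:: 0; 1]; [:: 1]]);
 (1, [:: [:: 0; 0; 0; 1]; [:: 0; 0; 0; 0; 0; 0; 0; 1; 1]; [:: 0; 1]; [:: 1]; [:: 0; 0; 0; 0; 0;
  0; 1]; [:: 0; 0; 0; 0; 0; 0; 0; 0; 0; 0; 0; -1]; [:: 0; 0; 0; 0; 0; 0; 0; 0; 0; -1]; [:: 0; 0;
  0; 0; 0; 0; 0; -1]]);
 (1, [:: [:: 1]; [:: 0; 1]; [:: 0; 0; 1]; [:: 0; 0; 0; 1]; [:: 0; 0; 0; 0; 1]; [:: 0; 0; 0; 0; 0;
  1]])]%stdZ.

Definition cert_cover1 : seq (Z * (zlist * zlist)) :=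
 [:: (1, ([:: [:: 1]; [:: 0; 0; 0; 0; 0; 0; 1]; [:: 0; 0; 1]; [:: 0; 1; 0; 0; 0; 0; 0; 1]; [:: 0; 0;
  0; 0; 1]; [:: 0; -1]], [:: [::]; [::]; [::]; [:: 0; 0; 0; 0; 0; 0; 1]; [::]; [:: 0; 0; 0; 0;
  0; 0; 0; 1]; [::]; [::]; [:: 1; -1]; [:: 0; 0; -1; 0; -1; 0; -1]; [:: 0; 1]; [:: 0; 0; 0; 0;
  -1; 0; 0; -1]]));
 (1, ([:: [:: 1]; [:: 0; 0; 1]; [:: 0; 0; 0; 0; 1]; [:: 0; 1]], [:: [::]; [::]; [::]; [:: 1];
  [::]; [:: 0; 1]]));
 (1, ([:: [:: 1]], [:: [::]; [:: 1]; [:: 0; 0; 0; 0; 0; 0; 1]; [:: 0; 0; 1]; [:: 0; 0; 0; 0; 0;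
  0; 0; 1]; [:: 0; 0; 0; 0; 1]]));
 (1, ([:: [:: 1]; [:: 0; 0; 0; 0; 0; 0; 1]; [:: 0; 1]; [:: 0; 0; 1]], [:: [::]; [::]; [::]; [::
  0; 0; -1; 0; -1; 0; 0; 0; 1; 0; 2]; [:: 0; 1]; [:: 0; 0; 0; 0; -1; 0; 0; 0; 0; 0; 1]; [::];
  [:: -1]; [:: 0; 0; 0; 0; 0; 0; 1]; [:: 0; 0; 0; 0; 0; 0; 0; 0; -1; 0; -1]; [:: 0; 0; 0; 0; 0;
  0; 0; 1]; [:: 0; 0; 0; 0; 0; 0; 0; 0; 0; 0; -1]]))]%stdZ.

Definition cert_cover1_full : seq (Z * zlist) :=
 [:: (1, [:: [:: 1]; [:: 0; 0; 0; 0; 0; 0; 1]; [:: 0; 0; 1]; [:: 0; 1; 0; 0; 0; 0; 0; 1]; [:: 0; 0;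
  0; 0; 1]; [:: 0; -1]]);
 (1, [:: [:: 1]; [:: 0; 0; 1]; [:: 0; 0; 0; 0; 1]; [:: 0; 1]]);
 (1, [:: [:: 1]]);
 (1, [:: [:: 1]; [:: 0; 0; 0; 0; 0; 0; 1]; [:: 0; 1]; [:: 0; 0; 1]])]%stdZ.

Definition cert_incl : seq (Z * zlist) :=
 [:: (1, [:: [::]; [:: 1]; [:: 0; 1]; [:: 0; 0; 1]; [:: 0; 0; 0; 1]; [:: 0; 0; 0; 0; 1]; [::]; [::];
  [::]; [::]; [:: 0; 0; 0; 0; 0; 1]]);
 (1, [:: [::]; [:: 1]; [::]; [:: 0; 1]; [::]; [:: 0; 0; 1]; [::]; [::]; [::]; [::]; [:: 0; 0; 0;
  1]]);
 (1, [:: [::]; [::]; [::]; [::]; [:: 1]]);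
 (1, [:: [::]; [:: 1]; [::]; [:: 0; 1]; [:: 0; 0; 1]; [:: 0; 0; 0; 1]])]%stdZ.

Definition cert_tau : seq (Z * (zlist * zlist)) :=
 [:: (1, ([:: [:: 0; 0; 1; 0; -1]; [:: 0; 0; 0; 1; 0; 1]; [:: 0; 0; 0; 0; 0; 1]; [::]; [::]; [::];
  [:: 0; 0; 0; 0; 1]], [:: [:: 1]; [:: 0; 1]; [::]; [::]; [::]; [::]; [:: 0; 0; 0; 1]; [:: 0; 0;
  0; 0; 1]; [:: 0; 0; 0; 0; 0; 1]; [:: 0; 0; -1]; [:: 0; 0; 0; 0; 0; 0; 1]; [:: 0; 0; 0; 0; 0;
  0; 0; 1]]));
 (1, ([:: [:: 0; 0; 0; 1]], [:: [:: 1]; [:: 0; 1]; [:: 0; 0; 1]; [::]; [:: 0; 0; 0; 1]; [:: 0; 0;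
  0; 0; 1]]));
 (1, ([:: [:: 0; 1]; [:: 0; 0; 0; 0; 1; 0; 0; 0; 0; 1]; [:: 0; 0; 0; 0; 1]; [:: 0; 0; 0; 0; 0;
  1]], [:: [:: 1]; [::]; [:: 0; 0; 1]; [:: 0; 0; 0; 1]; [::]; [::]; [:: 0; 0; 0; 0; 0; 1]; [::
  0; 0; 0; 0; 0; 0; 1]; [:: 0; -1]; [::]; [:: 0; 0; 0; 0; 0; 0; 0; 1]; [:: 0; 0; 0; 0; -1]]));
 (1, ([:: [:: 0; 0; 1]; [:: 0; 0; 0; 1; 0; 1]; [:: 0; 0; 0; 0; 0; 1]; [::]; [::]; [::]; [:: 0;
  -1]; [:: 0; 0; 0; 0; -1; 0; 0; 0; 0; 1]; [:: 0; 0; 0; 0; -1]], [:: [:: 0; 0; 0; 0; 1]; [::];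
  [::]; [::]; [::]; [::]; [:: 0; 0; 0; 0; 0; 1]; [:: 0; 0; 0; 1]; [:: 0; 1; 1]; [::]; [:: 0; 1];
  [:: 1]]))]%stdZ.

Definition cert_tau_free : seq (Z * zlist) :=
 [:: (1, [:: [:: 1]; [:: 0; 1]; [:: 0; 0; 1]; [::]; [::]; [::]; [:: 0; 0; 0; 1]; [:: 0; 0; 0; 0; 1];
  [:: 0; 0; 0; 0; 0; 1]; [::]; [:: 0; 0; 0; 0; 0; 0; 1]; [:: 0; 0; 0; 0; 0; 0; 0; 1]]);
 (1, [:: [:: 1]; [:: 0; 1]; [:: 0; 0; 1]; [::]; [:: 0; 0; 0; 1]; [:: 0; 0; 0; 0; 1]]);
 (1, [:: [:: 1]; [:: 0; 1]; [:: 0; 0; 1]; [:: 0; 0; 0; 1]; [:: 0; 0; 0; 0; 1]; [::]; [:: 0; 0; 0;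
  0; 0; 1]; [:: 0; 0; 0; 0; 0; 0; 1]; [::]; [::]; [:: 0; 0; 0; 0; 0; 0; 0; 1]]);
 (1, [:: [:: 0; 0; 0; 0; 1]; [:: 0; 1; 1]; [::]; [::]; [:: 1]; [::]; [:: 0; 0; 0; 0; 0; 1]; [::
  0; 0; 0; 1]; [::]; [::]; [:: 0; 1]])]%stdZ.

(** Pairs (U, V) with U a + V b equal to the differential P_1 -> P_0, where a and b act on P_0: the
    image lies in the radical, which gives minimality. The next table does the same for P_2 ->
    P_1. *)
Definition cert_rad1 : seq (zlist * zlist) :=
 [:: ([:: [:: 1; 0; 0; 0; 0; 0; -1]; [:: 0; 0; 0; 0; 0; 0; 0; 0; -1]; [:: 0; 0; 0; 0; 0; 0; 0; 0; 0;
  -1]; [::]; [:: 0; 0; 0; 1]; [::]; [:: 0; 0; 0; 0; 0; 0; 1]; [:: 0; 0; 1; 0; 0; 0; 0; 0; 1];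
  [:: 0; 0; 0; 1; 0; 0; 0; 0; 0; 1]; [::]; [:: 0; 0; 0; -1]], [:: [:: 0; 0; 0; 0; 0; 0; -1];
  [::]; [:: 0; 1]; [::]; [::]; [::]; [:: 1; 0; 0; 0; 0; 0; 1]; [::]; [:: 0; -1]]);
 ([:: [:: 1; 0; 0; 0; 0; 0; 1]; [:: 0; 0; 0; 0; 0; 0; 0; 0; 1]; [:: 0; 0; 0; 0; 0; 0; 0; 0; 0;
  1]; [::]; [:: 0; 0; 0; 1]], [:: [:: 0; 0; 0; 0; 0; 0; 1]; [::]; [:: 0; 1]]);
 ([:: [:: 0; 0; 1]], [::]);
 ([:: [:: 1]; [:: 0; 0; 1]; [:: 0; 0; 0; 1]; [::]; [::]; [::]; [:: 0; 0; 0; 0; 0; 0; 0; 0; -1];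
  [:: 0; 0; 0; 1]], [:: [:: 1]; [::]; [::]; [::]; [::]; [::]; [:: 0; 1]])]%stdZ.

Definition cert_rad2 : seq (zlist * zlist) :=
 [:: ([:: [:: 0; 0; 0; 0; 0; 0; 0; 0; 1]; [:: 0; 0; 1; 0; 0; 0; 0; 0; 1]; [:: 0; 0; 0; 1; 0; 0; 0; 0;
  0; 1]; [::]; [:: 0; 0; 0; -1; 0; 0; 0; 0; 0; -1]; [::]; [::]; [:: 0; 0; 0; 1]], [:: [:: 1; 0;
  0; 0; 0; 0; 1]; [::]; [:: 0; -1; 0; 0; 0; 0; 0; -1]; [::]; [::]; [::]; [:: 0; 1]]);
 ([:: [::]; [:: 0; 0; 0; 1]], [:: [:: 0; 1]]);
 ([:: [:: 1]; [::]; [::]; [::]; [:: 0; 0; 0; 1]; [::]; [::]; [:: 0; 0; 1]; [:: 0; 0; 0; 1]; [::];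
  [:: 0; 0; 0; -1]], [:: [::]; [::]; [:: 0; 1]; [::]; [::]; [::]; [:: 1]; [::]; [:: 0; -1]]);
 ([:: [:: 0; 0; 0; 0; 0; 0; -1]; [:: 0; 0; 1]; [:: 0; 0; 0; 1]; [::]; [:: 0; 0; 0; -1; 0; 0; 0;
  0; 0; -1]; [::]; [::]; [:: 0; 0; 0; 0; 0; 0; 0; 0; 1]; [:: 0; 0; 0; 0; 0; 0; 0; 0; 0; 1];
  [::]; [:: 0; 0; 0; 0; 0; 0; 0; 0; 0; -1]], [:: [:: 1]; [::]; [:: 0; -1; 0; 0; 0; 0; 0; -1];
  [::]; [::]; [::]; [:: 0; 0; 0; 0; 0; 0; 1]; [::]; [:: 0; 0; 0; 0; 0; 0; 0; -1]])]%stdZ.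

(** Here d_2 U + V a + W b = c on P_2, so the kernel of d_2 lies in the radical. *)
Definition cert_rad3 : seq (Z * (zlist * (zlist * zlist))) :=
 [:: (1, ([:: [::]; [::]; [:: 1]; [:: 0; 0; 0; 0; 0; 0; 1]; [:: 0; 1]; [:: 0; 0; 0; 0; 0; 0; 0; 1];
  [::]; [::]; [::]; [:: 0; 0; -1; 0; -1; 0; -1]; [::]; [:: 0; 0; 0; 0; -1; 0; 0; -1]], ([::
  [::]; [::]; [::]; [::]; [::]; [:: 0; 0; 0; 1]; [::]; [::]; [::]; [::]; [:: 0; 0; 0; 0; 0; 0;
  0; 0; 1]; [:: 0; 0; 0; 0; 0; 0; 0; 0; 0; 1]], [:: [::]; [::]; [::]; [:: 0; 1]; [::]; [::];
  [::]; [::]; [:: 0; 0; 0; 0; 0; 0; 1]; [:: 0; 0; 0; 0; 0; 0; 0; 1]])));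
 (1, ([:: [::]; [::]; [::]; [:: 1]; [::]; [:: 0; 1]], ([:: [::]; [::]; [::]; [::]; [:: 0; 0; 1];
  [:: 0; 0; 0; 1]], [:: [::]; [::]; [:: 1]; [:: 0; 1]])));
 (1, ([:: [::]; [:: 1]; [:: 0; 0; 0; 0; 0; 0; 1]; [:: 0; 0; 1]; [:: 0; 0; 0; 0; 0; 0; 0; 1]; [::
  0; 0; 0; 0; 1]], ([:: [::]; [:: 1]; [::]; [::]; [::]; [:: 0; 0; 0; 1]; [::]; [::]; [:: 0; 0;
  -1]; [::]; [:: 0; 0; 1; 0; 0; 0; 0; 0; 1]; [:: 0; 0; 0; 0; 0; 0; 0; 0; 0; 1]], [:: [::]; [::];
  [::]; [:: 0; 1]; [::]; [::]; [::]; [::]; [:: 1; 0; 0; 0; 0; 0; 1]; [:: 0; 0; 0; 0; 0; 0; 0;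
  1]])));
 (1, ([:: [::]; [::]; [:: 1]; [:: 0; 0; -1; 0; -1; 0; 0; 0; 1; 0; 2]; [:: 0; 1]; [:: 0; 0; 0; 0;
  -1; 0; 0; 0; 0; 0; 1]; [::]; [::]; [:: 0; 0; 0; 0; 0; 0; 1]; [:: 0; 0; 0; 0; 0; 0; 0; 0; -1;
  0; -1]; [:: 0; 0; 0; 0; 0; 0; 0; 1]; [:: 0; 0; 0; 0; 0; 0; 0; 0; 0; 0; -1]], ([:: [::]; [::];
  [::]; [::]; [::]; [:: 0; 0; 0; 1]; [::]; [::]; [::]; [::]; [::]; [:: 0; 0; 0; 0; 0; 0; 0; 0;
  0; 1]], [:: [::]; [::]; [::]; [:: 0; 1]; [::]; [::]; [::]; [::]; [::]; [:: 0; 0; 0; 0; 0; 0;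
  0; 1]])))]%stdZ.

(* Sequences of arrows (components of N_i -> C_i) whose compositions form a basis of
   Hom(N_i, N_j); the empty sequence is the identity. *)
Definition paths : seq (seq (seq (seq nat))) :=
 [:: [:: [:: [::]; [:: 0; 0]; [:: 1; 0]; [:: 0; 0; 1; 0]; [:: 1; 0; 0; 0]; [:: 1; 0; 1; 0]];
  [:: [:: 1; 1; 0]; [:: 0; 0; 1; 1; 0]; [:: 1; 0; 1; 1; 0]; [:: 1; 1; 0; 2; 0]; [:: 0; 0; 1; 0; 1;
  1; 0]; [:: 0; 0; 1; 1; 0; 2; 0]];
  [:: [:: 1; 1]; [:: 0; 0; 1; 1]; [:: 1; 0; 1; 1]; [:: 0; 0; 1; 0; 1; 1]];
  [:: [:: 0]; [:: 1]; [:: 0; 0; 1]; [:: 1; 0; 0]; [:: 1; 0; 1]; [:: 0; 0; 1; 0; 0]; [:: 0; 0; 1;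
  0; 1]];
  [:: [:: 1; 1; 0; 2]; [:: 0; 0; 1; 1; 0; 2]; [:: 1; 1; 0; 2; 0; 1]; [:: 0; 0; 1; 1; 0; 2; 0; 1]]];
 [:: [:: [:: 0]; [:: 0; 0; 0]; [:: 0; 1; 0]; [:: 1; 0; 0]; [:: 2; 0; 0]; [:: 2; 1; 0]; [:: 0; 1; 0;
  0; 0]; [:: 1; 1; 1; 0; 0]];
  [:: [::]; [:: 1; 0]; [:: 2; 0]; [:: 0; 1; 1; 0]; [:: 1; 0; 2; 0]; [:: 1; 1; 1; 0]; [:: 2; 0; 1;
  0]; [:: 2; 0; 2; 0]; [:: 0; 0; 0; 1; 1; 0]; [:: 0; 1; 0; 1; 1; 0]];
  [:: [:: 0; 1; 1]; [:: 1; 1; 1]; [:: 2; 1; 1]; [:: 0; 0; 0; 1; 1]; [:: 0; 1; 0; 1; 1]; [:: 1; 0;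
  0; 1; 1]];
  [:: [:: 0; 0]; [:: 0; 1]; [:: 1; 1]; [:: 2; 1]; [:: 0; 0; 0; 1]; [:: 0; 1; 0; 0]; [:: 0; 1; 0;
  1]; [:: 1; 0; 0; 1]; [:: 1; 0; 2; 1]; [:: 2; 0; 1; 1]];
  [:: [:: 1]; [:: 2]; [:: 1; 0; 2]; [:: 2; 0; 1]; [:: 2; 0; 2]; [:: 0; 1; 1; 0; 2]; [:: 1; 0; 2;
  0; 1]]];
 [:: [:: [:: 0; 0]; [:: 0; 0; 0; 0]; [:: 0; 0; 1; 0]; [:: 0; 2; 1; 0]; [:: 0; 0; 1; 0; 0; 0]];
  [:: [:: 0]; [:: 0; 2; 0]; [:: 0; 0; 1; 1; 0]; [:: 0; 2; 0; 1; 0]; [:: 0; 2; 0; 2; 0]; [:: 0; 0;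
  0; 0; 1; 1; 0]];
  [:: [::]; [:: 0; 0; 1; 1]; [:: 0; 0; 0; 0; 1; 1]; [:: 0; 0; 1; 0; 1; 1]];
  [:: [:: 0; 0; 0]; [:: 0; 0; 1]; [:: 0; 2; 1]; [:: 0; 0; 0; 0; 1]; [:: 0; 0; 1; 0; 0]; [:: 0; 0;
  1; 0; 1]];
  [:: [:: 0; 2]; [:: 0; 2; 0; 1]; [:: 0; 2; 0; 2]; [:: 0; 0; 1; 1; 0; 2]]];
 [:: [:: [:: 0]; [:: 0; 0; 0]; [:: 0; 1; 0]; [:: 1; 0; 0]; [:: 0; 0; 0; 1; 0]; [:: 0; 1; 0; 0; 0];
  [:: 1; 0; 0; 0; 0]; [:: 1; 0; 0; 1; 0]];
  [:: [:: 1; 0]; [:: 0; 1; 1; 0]; [:: 1; 0; 2; 0]; [:: 0; 0; 0; 1; 1; 0]; [:: 0; 1; 0; 1; 1; 0];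
  [:: 0; 1; 1; 0; 2; 0]; [:: 1; 0; 0; 1; 1; 0]; [:: 1; 0; 2; 0; 2; 0]; [:: 1; 0; 0; 0; 0; 1; 1;
  0]];
  [:: [:: 1]; [:: 0; 1; 1]; [:: 0; 0; 0; 1; 1]; [:: 0; 1; 0; 1; 1]; [:: 1; 0; 0; 1; 1]; [:: 1; 0;
  0; 0; 0; 1; 1]];
  [:: [::]; [:: 0; 0]; [:: 0; 1]; [:: 0; 0; 0; 1]; [:: 0; 1; 0; 0]; [:: 0; 1; 0; 1]; [:: 1; 0; 0;
  0]; [:: 1; 0; 0; 1]; [:: 1; 0; 0; 0; 0; 1]; [:: 1; 0; 0; 1; 0; 0]];
  [:: [:: 1; 0; 2]; [:: 0; 1; 1; 0; 2]; [:: 1; 0; 2; 0; 1]; [:: 1; 0; 2; 0; 2]; [:: 0; 1; 1; 0; 2;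
  0; 1]; [:: 1; 0; 0; 1; 1; 0; 2]]];
 [:: [:: [:: 0; 0]; [:: 1; 0]; [:: 0; 0; 1; 0]; [:: 0; 1; 0; 0]; [:: 0; 2; 0; 0]; [:: 1; 1; 0; 0]];
  [:: [:: 0]; [:: 0; 1; 0]; [:: 0; 2; 0]; [:: 1; 1; 0]; [:: 0; 0; 1; 1; 0]; [:: 0; 1; 0; 2; 0];
  [:: 0; 1; 1; 1; 0]; [:: 0; 2; 0; 1; 0]];
  [:: [:: 1; 1]; [:: 0; 0; 1; 1]; [:: 0; 1; 1; 1]; [:: 0; 2; 1; 1]; [:: 0; 0; 1; 0; 1; 1]];
  [:: [:: 1]; [:: 0; 0; 1]; [:: 0; 1; 1]; [:: 0; 2; 1]; [:: 1; 0; 0]; [:: 1; 0; 1]; [:: 0; 0; 1;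
  0; 1]; [:: 1; 1; 0; 0; 0]];
  [:: [::]; [:: 0; 1]; [:: 0; 2]; [:: 0; 1; 0; 2]; [:: 0; 2; 0; 1]; [:: 0; 2; 0; 2]]]]%N.

(** For unknown images v_l in N_j of the generators of P_0, [U] absorbs the relations imposed by
    P_1, and [V] writes c v_l as a combination of the values of the listed paths, with coefficients
    linear in v. *)
Definition cert_hom : seq (seq (Z * (zlist * zlist))) :=
 [:: [:: (1, ([:: [:: 0; 1]; [:: 0; 0; 0; 0; 1; 0; 0; 0; 0; 0; -1]; [:: 0; 0; 0; 1]; [::]; [:: 0; 0; 0;
  0; 0; 1]; [::]; [:: 0; 0; 1]; [:: 0; 0; 0; 0; 1]], [:: [:: 0; 0; 0; 0; 2; 1]; [::]; [::];
  [::]; [::]; [::]; [:: 0; 0; 0; 0; 1; 1]; [:: 0; 0; 1; 2]; [:: 0; 0; 1; 1]; [:: 0; 1]; [::];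
  [:: 1]]));
  (1, ([:: [:: 0; 1]; [:: 0; 1; -1; 0; 0; 0; 0; 0; 0; 0; 1; 0; 0; 0; 0; 1]; [::]; [:: 0; 0; 0; 0;
  1]; [:: 0; 0; 0; 0; 0; 0; 1; 0; 0; 0; 0; 0; 0; 0; -1]; [:: 0; 0; 0; 0; 0; 0; 0; 0; 0; 0; 0; 0;
  0; 0; 0; -1]; [:: 0; 0; 0; 0; 0; 0; 0; 1]; [::]; [:: 0; 1; 0; 0; 0; 0; 0; 0; 0; 1]; [:: 0; 1;
  -1; 0; 0; 0; 0; 0; 0; 1; 0; 0; 0; 0; 0; 1]; [::]; [:: 0; 0; 0; 0; 0; 1]; [:: 0; 0; 0; 0; 0; 0;
  1]], [:: [:: 0; 0; 0; -1; 0; -1]; [::]; [::]; [:: 0; 0; -1; 0; -2]; [::]; [::]; [::]; [::];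
  [:: 0; 0; 0; 0; 0; -1]; [::]; [::]; [:: 0; 0; 0; 0; -1]; [:: 1; 1]; [:: 1]]));
  (1, ([:: [:: 0; 1]; [:: 0; 0; 0; 1; 0; 0; 0; 0; -1]; [:: 0; 0; 0; 0; 0; 0; 0; 0; 0; -1]; [:: 0;
  0; 0; 0; 1]; [::]; [:: 0; 0; 1]; [:: 0; 0; 0; 1]], [:: [:: 0; 0; -1; -2]; [::]; [::]; [::];
  [::]; [:: 0; 0; 0; -1]; [:: 1; 1]; [:: 1]]));
  (2, ([:: [:: 0; 1; 1; 0; 0; 0; 1; 0; 0; -1]; [:: 0; 0; 0; 0; 0; 0; 0; 0; 0; 0; 0; 0; -2]; [:: 0;
  0; 0; 2]; [::]; [::]; [:: 0; 0; 0; 0; 0; 0; 2]; [:: 0; 0; 0; 0; 0; 0; 0; 2; 0; 0; 0; 0; 0; 0;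
  0; -2]; [:: 0; 0; 0; 0; -2]; [:: 0; 0; 2]; [::]; [::]; [::]; [::]; [:: 0; -1; 1; 0; 0; 0; 1;
  0; 0; -1]; [:: 0; 0; 0; 0; 0; 0; 0; 2]], [:: [:: 0; 0; 0; 2; 0; 2]; [::]; [::]; [::]; [::];
  [:: 0; 0; 0; -2; -2; -2; -4]; [::]; [::]; [:: 0; 0; 0; 0; 0; 2]; [::]; [:: 0; 1]; [:: 2];
  [::]; [:: 0; 0; 0; 0; 0; -2; -2]; [:: 0; 1; 2]]));
  (1, ([:: [::]; [:: 1]; [:: -1; 0; 0; 0; 0; 0; -1]; [:: 0; 1; 0; 0; 0; 0; 0; -1]; [:: 0; 1; 1;
  -1; 0; 0; 0; 0; 0; -1]; [:: 0; 0; 0; 1]; [::]; [::]; [::]; [:: 0; 1]; [:: 0; 1; 1; -1; 0; 0;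
  0; 1; 1; -2]; [:: 0; 0; 0; 1; 0; 0; 0; 0; 0; 1]], [:: [::]; [::]; [::]; [::]; [:: -1; -1; -1;
  -1]; [:: 0; 0; 1; 1]; [::]; [::]; [::]; [::]; [:: 0; -1; 0; -1]; [:: 0; 0; 0; 1]]))];
 [:: (2, ([:: [:: 0; 2]; [:: 0; 0; 0; 0; 0; 0; 0; 0; 0; 0; 2]; [:: 0; 0; 0; 2]; [::]; [:: 0; 0; 0; 0;
  0; 2]], [:: [:: 0; 0; 0; 2; -2]; [::]; [:: 0; 0; 0; 2]; [::]; [:: 0; 0; 0; 0; 0; 0; 0; 2];
  [::]; [:: 0; 0; 0; -2; 2; 0; -2]; [:: 0; 0; 0; 0; 0; -2]; [:: 0; 0; 1; -1; 0; -1]; [:: 0; 2];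
  [::]; [:: 2]]));
  (3, ([:: [:: 0; 3]; [:: 0; 3; 0; 0; 0; 0; 0; 0; 0; 0; -3]; [::]; [:: 0; 0; 0; 0; 3]; [:: 0; 0;
  0; 0; 0; 0; 0; 0; 0; 0; 0; 0; 0; 0; 3]; [:: 0; 0; -3]; [:: 0; 0; 0; 0; 0; 0; 0; 3]], [:: [::
  0; 0; 0; 0; 3]; [::]; [::]; [:: 0; 0; 0; 0; 0; 0; 2; 0; 0; 1]; [::]; [:: 0; 3]; [:: 0; 0; 0;
  0; 0; 3]; [::]; [:: 0; 0; 0; 0; 0; 0; -3; 3]; [:: 0; -3; 3; 0; -3; 0; -1; 3; 0; 1]; [::]; [::
  0; 0; 0; 0; 0; 0; -1; 0; 0; 1]; [:: 0; -3; 0; 3; 0; 0; 0; 0; 3]; [:: 0; -3; 0; 3]; [::]; [::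
  3]]));
  (2, ([:: [:: 0; 2]; [:: 0; 0; 0; 0; 0; 0; 0; 0; 2]; [:: 0; 0; 0; 0; 0; 0; 0; 0; 0; 2]; [:: 0; 0;
  0; 0; 2]], [:: [:: 0; 0; 0; 0; 0; 2]; [::]; [:: 1; 1; -1]; [:: 0; 2]; [::]; [:: 0; 0; 0; 0; 1;
  -1]; [:: 1; -1; 1; 2]; [:: 1; -1; 1]]));
  (2, ([:: [:: 0; 2]; [:: 0; 0; 0; 0; 0; 0; 0; 0; 0; 0; 0; 0; 2]; [:: 0; 0; 0; 2]; [::]; [::]; [::
  0; 0; 0; 0; 0; 0; 2]; [:: 0; 0; 0; 0; 0; 0; 0; 0; 0; 0; 0; 0; 0; 0; 0; 2]; [:: 0; 0; 0; 0;
  -2]], [:: [:: 0; 0; 0; 0; 0; 0; 0; 1; -1]; [::]; [:: 0; 2; -2; 2; 4; 0; 0; 0; 0; 4]; [::];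
  [::]; [:: 0; 0; 0; 0; 0; 0; 0; 1; 1]; [::]; [:: 0; 0; 2]; [:: 0; 0; 0; 0; 0; -2; 0; -1; 1];
  [:: 0; 0; 2; -2]; [:: 0; 0; 2; -2; -2; 0; 0; 0; 0; -2]; [:: 2]; [::]; [:: 0; 0; 0; 0; 0; 2; 1;
  0; -1]; [:: 0; 0; 0; 0; 0; 0; 0; 0; 0; -2]]));
  (1, ([:: [::]; [:: 1]; [:: -1; 0; 0; 0; 0; 0; 1]; [:: 0; 0; 0; 0; 0; 0; 0; 1]; [:: 0; 0; 1]; [::
  0; 0; 0; 1]], [:: [::]; [:: 1]; [::]; [::]; [:: 0; 0; 1; 0; 0; 0; 1]; [:: 0; 0; 0; 0; 0; 0;
  -1]; [::]; [::]; [:: 0; 1]; [:: 0; 0; 0; -1]; [:: 0; 0; -2; 1; -1; 2; 1]; [:: 0; 0; 1; -1; 1;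
  -1; -1]]))];
 [:: (2, ([:: [:: 0; 0; 0; 0; 2]], [:: [:: 0; 0; 0; 0; -2]; [:: 0; 0; 0; -2]; [:: 0; 0; 1; -1]; [::
  0; 2]; [::]; [:: 2]]));
  (1, ([:: [:: 0; 0; -1]; [::]; [::]; [:: 0; 0; 0; 0; 0; 0; 1]], [:: [:: 0; 0; 0; -1; 1]; [:: 0;
  1; 0; -1; 1]; [::]; [:: 0; 0; 0; -1]; [:: 0; 0; 1; 0; 0; 1]; [:: 0; 0; 1]; [::]; [:: 1]]));
  (2, ([:: [:: 0; 0; 0; 2]], [:: [:: 0; 0; 0; 1]; [:: 0; 2; 2]; [:: 0; 2]; [::]; [:: 2]]));
  (2, ([:: [:: 0; 0; 0; 0; 2]; [::]; [::]; [::]; [::]; [:: 0; 0; 0; 0; 0; 0; 0; 2]], [:: [:: 0; 0;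
  0; 0; -2]; [:: 0; 0; -2]; [:: 0; 1; -1]; [:: 2]; [::]; [:: 0; 0; 0; 0; 2; 1]; [:: 0; 1; 1;
  2]]));
  (1, ([:: [::]; [::]; [::]; [::]; [:: 1]; [:: 0; 1]], [:: [::]; [::]; [:: 1]; [:: 0; -1]; [:: 0;
  1; -1; 2]; [:: 0; -1; 1; -1]]))];
 [:: (1, ([:: [:: 0; 1]; [:: 0; 0; 0; 0; 1]; [:: 0; 0; 0; 0; 0; 1]; [::]; [::]; [::]; [:: 0; 0; 0;
  1]], [:: [:: 0; 0; 0; 0; 0; 1]; [::]; [:: 0; 0; -1; 0; -1]; [::]; [::]; [::]; [:: 0; 0; 0; 0;
  1]; [:: 0; 2; 0; 0; 0; 0; 0; 1]; [:: 0; 1]; [:: 0; 0; 0; 0; 0; 0; -1]; [:: 1]; [:: 0; 0; 0;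
  -1]]));
  (1, ([:: [:: 0; 1]; [:: 0; 1; -1; 0; 0; 0; 0; 0; 0; 0; 0; 0; 0; 0; 1]; [::]; [:: 0; 0; 0; 0; 1];
  [:: 0; 0; 0; 0; 0; 0; 1]; [:: 0; 0; 0; 0; 0; 0; 0; 1]; [::]; [::]; [:: 0; 0; 0; 0; 0; 0; 0; 0;
  0; 0; 1]; [::]; [::]; [:: 0; 0; 0; 0; 0; 0; 0; 0; 0; 0; 0; 0; 0; 0; -1]], [:: [:: 0; 0; 0; 0;
  0; -1]; [::]; [::]; [:: 0; 0; 0; 0; -1]; [::]; [:: 0; -1]; [::]; [::]; [:: 0; 0; 0; 1; 0; 0;
  0; -1]; [:: 0; 0; -1; 1; 0; 0; 0; -1]; [::]; [:: 0; 0; 0; 1]; [:: 0; 0; 0; 0; 0; 0; -1; 0;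
  -1]; [:: 0; 0; 0; 0; 0; 0; -1]; [::]; [:: -1]]));
  (1, ([:: [:: 0; 1]; [:: 0; 0; 0; 1]; [:: 0; 0; 0; 0; 1]; [::]; [::]; [:: 0; 0; 0; 0; 0; 0; 0; 0;
  -1]], [:: [:: 0; 0; 0; -1]; [::]; [:: 0; -1]; [::]; [::]; [:: 0; 0; 1]; [:: 0; 0; 0; 0; -1;
  -1]; [:: 0; 0; 0; 0; -1]; [::]; [:: -1]]));
  (1, ([:: [:: 0; 0; 1]; [:: 0; 0; 0; 0; 1]; [::]; [::]; [::]; [:: 0; -1; 1]; [:: 0; 0; 0; 0; 0;
  0; 0; 1]; [::]; [:: 0; 0; 0; 1]; [::]; [::]; [::]; [::]; [:: 0; 0; 0; 0; 0; 0; 0; 0; 0; 0; 0;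
  0; 0; 0; 0; -1]], [:: [:: 0; 0; 0; 0; 1]; [::]; [::]; [::]; [::]; [:: 0; 0; 0; 0; -1; -1]; [::
  0; 0; 1; 0; 0; 0; 0; 0; 0; 1]; [::]; [:: 0; 0; 0; 0; 0; 0; 0; 0; 0; 1]; [:: 0; 2; 0; 0; 0; 0;
  0; 1]; [:: 0; 1]; [:: 0; 0; 0; 0; 0; 0; -1]; [:: 1]; [:: 0; 0; 0; 1; 0; 0; 0; 0; 0; -1]; [::
  0; -1; 0; 0; 0; 0; 0; -1; -1]]));
  (1, ([:: [::]; [:: 1]; [::]; [:: 0; 1]; [:: 0; 1; 1; -1]; [:: 0; 0; 0; 1]; [::]; [::]; [::];
  [::]; [:: 0; 0; 0; 0; 0; 0; -1]; [:: 0; 0; 0; 0; 0; 0; 0; -1]], [:: [::]; [::]; [::]; [::];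
  [:: 0; -1; 0; 0; -1]; [:: 0; 0; 0; 0; 1]; [::]; [::]; [:: -1]; [:: 0; 0; 1]; [:: 0; 0; -1; 1;
  0; -2]; [:: 0; 0; 1; -1; 0; 1]]))];
 [:: (1, ([::], [:: [:: 0; 0; 0; -1; 1]; [:: 0; 0; 1; -1]; [:: 0; 0; 0; -1]; [:: 1]; [:: 0; -1]; [::
  0; 0; 0; 0; 0; 1]]));
  (1, ([::], [:: [:: 0; 0; 0; 0; 0; -1]; [:: 0; -1; 1; 0; 0; -1; 0; 1]; [:: -1]; [:: 0; 0; 0; 0;
  0; 0; 0; -1]; [:: 0; -1; 0; 0; 1]; [:: 0; -1]; [:: 0; 0; 0; 0; 0; 0; -1]; [:: 0; 0; 0; 1]]));
  (2, ([::], [:: [:: 0; 0; 0; 0; -2]; [:: 0; 1; -1; 1]; [:: 0; -1; -1; 1]; [:: 0; 0; -2]; [::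
  2]]));
  (2, ([::], [:: [:: 0; 0; 0; 0; 0; 2]; [:: 0; 1; 1; -1; -1]; [:: 0; 0; 0; 0; -2]; [:: 0; 0; 0; 0;
  0; 0; 0; 2]; [:: -2]; [:: 0; 0; 0; 0; 0; -2; -2]; [:: 0; 1; -1; 1; -1]; [:: 0; 0; -2]]));
  (1, ([::], [:: [:: 1]; [:: 0; -1]; [:: 0; 0; 1; 0; 1]; [:: 0; 0; 0; 0; -1]; [:: 0; 0; 0; -1; 1;
  -1]; [:: 0; 0; 0; 0; -1; 1]]))]]%stdZ.

(** The same pattern one step further: for a map P_1 -> N_j that vanishes on the image of P_2, [V]
    gives, up to the factor c, a map P_0 -> N_j through which it factors. *)
Definition cert_ext : seq (seq (Z * (zlist * zlist))) :=
 [:: [:: (1, ([:: [:: 0; 0; 1]; [:: 0; 0; 0; 0; 1]; [:: 0; 0; 0; 0; 0; 0; 0; 0; 0; -1]; [::]; [:: 0; 0;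
  0; 0; 0; 0; 0; 0; 0; -1; 0; -1]; [::]; [:: 0; 0; 0; 1; 0; 0; 0; 0; 0; -1]; [:: 0; 0; 0; 0; 0;
  1; 0; 0; 0; 0; 0; -1]], [:: [:: 0; 1]; [:: 0; 0; 0; 0; 1; 0; 0; 0; 0; 0; -1]; [::]; [::];
  [::]; [::]; [:: 0; 0; 1]; [:: 0; 0; 0; 0; 1]; [:: 0; 0; 0; -1]; [::]; [:: 0; 0; 0; -1; 0;
  -1]]));
  (1, ([:: [:: 0; 0; 1; 0; 0; 0; 0; 0; 0; 0; -1]; [:: 0; 0; 0; 0; 0; 0; 0; 0; 0; 0; -1; 0; 0; 0;
  0; 1]; [::]; [:: 0; 0; 0; 0; 0; 1]; [:: 0; 0; 0; 0; 0; 0; 1]; [:: 0; 0; 0; 0; 0; 0; 0; 0; 0;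
  0; 0; 0; 0; 0; 0; 1]; [::]; [::]; [::]; [::]; [::]; [::]; [:: 0; 0; 0; 0; 0; 0; 0; 1; 0; 0; 0;
  0; 0; 0; 0; -1]], [:: [:: 0; 1]; [:: 0; 1; -1; 0; 0; 0; 0; 0; 0; 0; 1; 0; 0; 0; 0; 1]; [::];
  [:: 0; 0; 0; 0; 1]; [:: 0; 0; 0; 0; 0; 0; 1; 0; 0; 0; 0; 0; 0; 0; -1]; [::]; [::]; [::]; [::
  0; 1; 0; 0; 0; 0; 0; 0; 0; 1]; [:: 0; 1; -1; 0; 0; 0; 0; 0; 0; 1; 0; 0; 0; 0; 0; 1]; [::]; [::
  0; 0; 0; 0; 0; 1]; [:: 0; 0; 0; 0; 0; 0; 1]; [:: 0; 0; 0; 0; 0; 0; 0; 0; 0; 0; 0; 0; 0; 0; 0;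
  1]; [:: 0; 0; 0; 0; 0; 0; 0; -1; 0; 0; 0; 0; 0; 0; 0; 1]]));
  (1, ([:: [:: 0; 0; 1]; [:: 0; 0; 0; 1]; [:: 0; 0; 0; 0; 0; 0; 0; 0; 0; 1]; [::]; [::]; [::]; [::
  0; 0; 0; 0; 1; 0; 0; 0; 0; -1]], [:: [:: 0; 1]; [:: 0; 0; 0; 1; 0; 0; 0; 0; -1]; [::]; [::];
  [::]; [:: 0; 0; 1]; [:: 0; 0; 0; 1]; [:: 0; 0; 0; 0; 0; 0; 0; 0; 0; 1]; [:: 0; 0; 0; 0; -1; 0;
  0; 0; 0; 1]]));
  (2, ([:: [:: 0; 0; 2]; [:: 0; 0; -2; 0; 0; 0; 0; 0; 0; 0; 0; 0; 2]; [:: 0; 0; 0; 0; 0; 0; 0; 0;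
  0; 0; 0; -2]; [::]; [::]; [:: 0; -2]; [:: 0; 0; 0; 0; 0; 0; 0; 2]; [::]; [:: 0; 0; 0; 2; 0; 0;
  0; 0; 0; 0; 0; -2]; [::]; [::]; [::]; [::]; [::]; [:: 0; 0; -2; 0; -2; 0; 0; 0; 0; 0; 0; 0;
  2]], [:: [:: 0; 1; 1; 0; 0; 0; 1; 0; 0; -1]; [::]; [::]; [::]; [::]; [:: 0; 0; 0; 0; 0; 0; 2];
  [:: 0; 0; 0; 0; 0; 0; 0; 2; 0; 0; 0; 0; 0; 0; 0; -2]; [::]; [:: 0; 0; 2]; [:: 0; 0; 0; 0; 0;
  0; 0; 0; 0; 0; 0; 0; 2]; [:: 0; 0; 0; -2]; [::]; [::]; [:: 0; -1; 1; 0; 0; 0; 1; 0; 0; -1];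
  [:: 0; 0; 0; 0; 0; 0; 0; 2]; [:: 0; 0; 0; 0; 2; 0; 0; 0; 0; 0; 0; 0; -2]]));
  (1, ([:: [::]; [::]; [:: 1]; [:: 0; 1]; [:: -1; 0; 0; 0; 0; 0; 1]; [:: 0; 1; 1]], [:: [::];
  [::]; [::]; [:: 0; 1; 0; 0; 0; 0; 0; -1]; [:: 0; 1; 1; -1; 0; 0; 0; 0; 0; -1]; [:: 0; 0; 0;
  1]; [::]; [:: -1; 0; 0; 0; 0; 0; 1]; [:: 1]; [:: 0; 1]; [:: 0; 1; 1; -1; 0; 0; 0; 1; 1; -2];
  [:: 0; 0; 0; 1; 0; 0; 0; 0; 0; 1]]))];
 [:: (1, ([:: [:: 0; 0; 0; 1]; [:: 0; 0; 0; 0; 0; 1]], [:: [:: 0; 1]; [:: 0; 0; 0; 0; 0; 0; 0; 0; 0;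
  0; 1]; [:: 0; 0; 0; 1]; [::]; [:: 0; 0; 0; 0; 0; 1]]));
  (1, ([:: [::]; [::]; [::]; [:: 0; 0; -1]; [:: 0; 0; 0; 0; 0; 0; 0; 1]], [:: [:: 0; 1]; [:: 0; 1;
  0; 0; 0; 0; 0; 0; 0; 0; -1]; [::]; [:: 0; 0; 0; 0; 1]; [:: 0; 0; 0; 0; 0; 0; 0; 0; 0; 0; 0; 0;
  0; 0; 1]; [:: 0; 0; -1]; [:: 0; 0; 0; 0; 0; 0; 0; 1]]));
  (1, ([:: [::]; [:: 0; 0; 0; 0; 1]], [:: [:: 0; 1]; [:: 0; 0; 0; 0; 0; 0; 0; 0; 1]; [:: 0; 0; 0;
  0; 0; 0; 0; 0; 0; 1]; [:: 0; 0; 0; 0; 1]]));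
  (1, ([:: [:: 0; 0; 0; 1]; [::]; [::]; [::]; [::]; [::]; [:: 0; 0; 0; 0; -1]], [:: [:: 0; 1]; [::
  0; 0; 0; 0; 0; 0; 0; 0; 0; 0; 0; 0; 1]; [:: 0; 0; 0; 1]; [::]; [::]; [:: 0; 0; 0; 0; 0; 0; 1];
  [:: 0; 0; 0; 0; 0; 0; 0; 0; 0; 0; 0; 0; 0; 0; 0; 1]; [:: 0; 0; 0; 0; -1]]));
  (1, ([:: [::]; [::]; [::]; [:: 1]], [:: [::]; [:: 1]; [:: -1; 0; 0; 0; 0; 0; 1]; [:: 0; 0; 0; 0;
  0; 0; 0; 1]; [:: 0; 0; 1]; [:: 0; 0; 0; 1]]))];
 [:: (1, ([:: [:: 0; 1]; [::]; [:: 0; 0; 0; 1]; [::]; [:: 0; 0; 0; 0; 0; 1]; [::]; [:: 0; 0; 1]; [::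
  0; 0; 0; 0; 1]], [:: [:: 0; 0; 0; 0; 1]]));
  (1, ([:: [:: 0; 1]; [::]; [::]; [:: 0; 0; 0; 0; 1]; [::]; [:: 0; 0; -1]; [:: 0; 0; 0; 0; 0; 0;
  0; 1]; [::]; [::]; [::]; [::]; [:: 0; 0; 0; 0; 0; 1]; [:: 0; 0; 0; 0; 0; 0; 1]], [:: [:: 0; 0;
  -1]; [::]; [::]; [:: 0; 0; 0; 0; 0; 0; 1]]));
  (1, ([:: [:: 0; 1]; [::]; [::]; [:: 0; 0; 0; 0; 1]; [::]; [:: 0; 0; 1]; [:: 0; 0; 0; 1]], [::
  [:: 0; 0; 0; 1]]));
  (1, ([:: [:: 0; 1]; [::]; [:: 0; 0; 0; 1]; [::]; [::]; [:: 0; 0; 0; 0; 0; 0; 1]; [::]; [:: 0; 0;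
  0; 0; -1]; [:: 0; 0; 1]; [::]; [::]; [::]; [::]; [::]; [:: 0; 0; 0; 0; 0; 0; 0; 1]], [:: [::
  0; 0; 0; 0; 1]; [::]; [::]; [::]; [::]; [:: 0; 0; 0; 0; 0; 0; 0; 1]]));
  (1, ([:: [::]; [:: 1]; [::]; [::]; [:: 0; 1; 1]; [:: 0; 0; 0; 1]; [::]; [::]; [::]; [:: 0; 1]],
  [:: [::]; [::]; [::]; [::]; [:: 1]; [:: 0; 1]]))];
 [:: (1, ([:: [:: 0; 0; 1]; [:: 0; 0; 0; 0; 1]; [:: 0; 0; 0; -1]; [::]; [:: 0; 0; 0; -1; 0; -1];
  [::]; [:: 0; 0; 0; 0; 0; 0; 0; 0; 1]; [:: 0; 0; 0; 0; 0; 0; 0; 0; 0; 0; 1]; [:: 0; 0; 0; 1; 0;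
  0; 0; 0; 0; -1]; [::]; [:: 0; 0; 0; 2; 0; 1; 0; 0; 0; -1; 0; -1]], [:: [:: 0; 1]; [:: 0; 0; 0;
  0; 1]; [::]; [::]; [::]; [::]; [:: 0; 0; 0; 1]; [:: 0; 0; 0; 0; 0; 1]]));
  (1, ([:: [:: 0; 0; 0; 0; 0; 0; 0; 0; 0; -1]; [:: 0; 0; -1; 0; 0; 0; 0; 1; 0; -1; 0; 0; 0; 0; 0;
  -1]; [::]; [:: 0; 0; 0; 0; 0; 1]; [:: 0; 0; 0; 0; 0; 0; 1]; [:: 0; 0; 0; 0; 0; 0; 0; 1; 0; 0;
  0; 0; 0; 0; 0; -1]; [:: 0; 0; 0; 0; 0; 0; 0; 0; 0; 0; 0; 0; 0; 0; 0; -1]; [::]; [:: 0; 0; 0;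
  0; 0; 0; 0; -1; 0; 0; 1; 0; 0; 0; 0; 1]; [::]; [::]; [:: 0; 0; 0; 0; 0; 0; 0; 0; 0; 0; 0; 0;
  0; 1]; [:: 0; 0; 0; 0; 0; 0; 0; 0; 0; 0; 0; 0; 0; 0; 1]], [:: [:: 0; 1]; [:: 0; 1; -1; 0; 0;
  0; 0; 0; 0; 0; 0; 0; 0; 0; 1]; [::]; [:: 0; 0; 0; 0; 1]; [:: 0; 0; 0; 0; 0; 0; 1]; [::]; [::];
  [::]; [:: 0; 0; 0; 0; 0; 0; 0; 0; 0; 0; 1]; [::]; [::]; [:: 0; 0; 0; 0; 0; 0; 0; 0; 0; 0; 0;
  0; 0; 0; -1]; [:: 0; 0; 0; 0; 0; 0; 0; 1]]));
  (1, ([:: [:: 0; 0; 1]; [:: 0; 0; 0; 1]; [:: 0; 0; 0; 0; 1; 0; 0; 0; 0; -1]; [:: 0; 0; 0; 0; 0;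
  0; 0; 0; 0; -1]; [::]; [:: 0; 0; 0; 0; 0; 0; 0; 1]; [:: 0; 0; 0; 0; 0; 0; 0; 0; 1]], [:: [::
  0; 1]; [:: 0; 0; 0; 1]; [::]; [::]; [::]; [:: 0; 0; 0; 0; 0; 0; 0; 0; -1]; [:: 0; 0; 0; 0;
  1]]));
  (1, ([:: [:: 0; 0; 1]; [:: 0; 0; 0; 0; 1; 0; 0; 0; 0; 0; 0; 0; -1]; [:: 0; 0; 0; -1]; [::];
  [::]; [:: 0; -1]; [:: 0; 0; 0; 0; 0; 0; 0; 1]; [:: 0; 0; 0; 0; 0; 0; 0; 0; 0; 0; 0; 0; 1]; [::
  0; 0; 0; 0; 0; 0; 0; 0; 0; 0; 1]; [::]; [:: 0; 0; 0; 1; 0; 0; 0; 0; 0; 0; 0; -1]; [::]; [::];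
  [:: 0; 0; -1; 0; 0; 0; 0; 0; 0; -1]; [:: 0; 0; 0; 0; 0; 0; 0; 0; 0; 0; 0; 0; 0; 0; 0; 1]], [::
  [:: 0; 0; 1]; [::]; [::]; [::]; [::]; [:: 0; -1; 1]; [:: 0; 0; 0; 0; 0; 0; 0; 1]; [::]; [:: 0;
  0; 0; 1]; [::]; [::]; [::]; [::]; [:: 0; 0; 0; 0; 0; 0; 0; 0; 0; 0; 0; 0; 0; 0; 0; -1]; [:: 0;
  0; 0; 0; -1]]));
  (1, ([:: [::]; [:: 0; 0; 0; 0; 0; 0; -1]; [:: 1]; [:: 0; 1]; [:: 0; 0; 0; 0; 0; 0; 0; -1; -1];
  [:: 0; 1; 1]; [::]; [::]; [::]; [:: 0; 0; 0; 0; 0; 0; 0; 1]], [:: [::]; [::]; [::]; [:: 0; 1];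
  [:: 0; 1; 1; -1]; [:: 0; 0; 0; 1]; [::]; [::]; [::]; [:: 1]; [:: 0; 0; 0; 0; 0; 0; -1]; [:: 0;
  0; 0; 0; 0; 0; 0; -1]]))]]%stdZ.
(* Modules 10-17 are A^2, (DA)^2 and the sums occurring as C_i or D_i. *)
Definition parts_table : seq (seq nat) :=
  [:: [:: 0]; [:: 1]; [:: 2]; [:: 3]; [:: 4]; [::]; [:: 6]; [:: 7]; [:: 8]; [:: 9];
      [:: 4; 4]; [:: 0; 0]; [:: 3; 3]; [:: 0; 4; 4]; [:: 0; 2]; [:: 1; 3]; [:: 2; 4];
      [:: 0; 0; 4]]%N.
(** A^m and (DA)^m = D Hom(A^m, A) for m up to 2; index 5, the zero module, is both the case m = 0
    and the default. *)
Definition free_ix m := nth 5 [:: 5; 4; 10]%N m.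
Definition dual_ix m := nth 5 [:: 5; 0; 11]%N m.
Definition omega_ix i := (6 + i)%N.
Definition src_ix i := nth 5 [:: 12; 13; 1; 14; 15]%N i.
Definition mid_ix i := nth 5 [:: 14; 15; 16; 3; 17]%N i.
Definition epi_ix i := nth 5 [:: 5; 0; 1; 2; 3]%N i.
(** Ranks of the free modules P_0, P_1, P_2 resolving N_i; the zeros at the end reflect that N_4 = A
    is free. *)
Definition rk0 i := nth 0 [:: 2; 2; 1; 2; 1]%N i.
Definition rk1 i := nth 0 [:: 2; 1; 1; 2; 0]%N i.
Definition rk2 i := nth 0 [:: 2; 1; 2; 2; 0]%N i.

(** * Boolean tests of the tables *)

Definition parts k := nth [::] parts_table k.
Definition bdim k := nth 0%N basic_dim k.
Definition dm k := sumn (map bdim (parts k)).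

Fixpoint bdiag (A : seq zlist) (L : seq nat) r c : Z :=
  if L is k :: L' then
    if (r < bdim k)%N then (if (c < bdim k)%N then ent (nth [::] A k) r c else Z0)
    else if (c < bdim k)%N then Z0 else bdiag A L' (r - bdim k)%N (c - bdim k)%N
  else Z0.
Definition lact k (c : bool) : zlist :=
  lmk (dm k) (dm k) (bdiag (if c then basic_b else basic_a) (parts k)).

(** Beyond the table the dimension is 0, which makes the family of modules total in its index. *)
Lemma lact_rels k : lrels (dm k) (lact k false) (lact k true).
Proof.
have [|k18] := ltnP k 18; first by move: k; apply/allnP; vm_compute.
have d0 : dm k = 0%N by rewrite /dm /parts nth_default.
by rewrite /lrels d0.
Qed.

Definition off k l := sumn (map bdim (take l (parts k))).
Definition part k l := nth 5 (parts k) l.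
Definition linc k l : zlist :=
  lmk (dm (part k l)) (dm k) (fun r c => if c == (off k l + r)%N then 1%stdZ else Z0).
Definition lprj k l : zlist :=
  lmk (dm k) (dm (part k l)) (fun r c => if r == (off k l + c)%N then 1%stdZ else Z0).

Definition hom_test k l A : bool :=
  all (fun c => leqm (dm k) (dm l) (lmul (dm k) (dm k) (dm l) (lact k c) A)
                     (lmul (dm k) (dm l) (dm l) A (lact l c))) [:: false; true].

Definition parts_test k : bool :=
  alln (size (parts k)) (fun l =>
    [&& hom_test (part k l) k (linc k l), hom_test k (part k l) (lprj k l) &
     alln (size (parts k)) (fun l' =>
       leqm (dm (part k l)) (dm (part k l')) (lmul (dm (part k l)) (dm k) (dm (part k l')) (linc k l) (lprj k l'))
            (if l == l' then lid (dm (part k l)) 1 else [::]))]) &&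
  leqm (dm k) (dm k) (lbig (dm k) (dm k) (size (parts k))
    (fun l => lmul (dm k) (dm (part k l)) (dm k) (lprj k l) (linc k l))) (lid (dm k) 1).

Lemma parts_ok : alln 18 parts_test.
Proof. by vm_compute. Qed.

Definition lword k w : zlist :=
  match w with
  | 0 => lid (dm k) 1 | 1 => lact k false | 2 => lact k true
  | 3 => lmul (dm k) (dm k) (dm k) (lact k false) (lact k true)
  | 4 => lmul (dm k) (dm k) (dm k) (lact k true) (lact k false)
  | _ => lmul (dm k) (dm k) (dm k) (lmul (dm k) (dm k) (dm k) (lact k false) (lact k true)) (lact k false)
  end.

Definition gen_test : bool :=
  alln 6 (fun w =>
    [&& leqm 1 6 (lmul 1 6 6 [:: [:: 1%stdZ]] (lword 4 w)) (lmk 1 6 (fun _ j => if j == w then 1%stdZ else Z0)),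
        leqm 6 1 (lmul 6 6 1 (lword 0 w) [:: [:: 1%stdZ]]) (lmk 6 1 (fun i _ => if i == w then 1%stdZ else Z0)) &
     all (fun c => leqm 6 6 (lact 4 c) (rmat c) && leqm 6 6 (lact 0 c) (lmk 6 6 (fun i j => ent (lmat c) j i)))
       [:: false; true]]).
Lemma gen_ok : gen_test. Proof. by vm_compute. Qed.

(* The map [x |-> x * b], for [b] the element of the free module with coordinates [c]
   restricted to the [l]-th summand. *)
Definition elt (c : seq Z) l j : zlist :=
  lbig (dm j) (dm j) 6 (fun w => lscal (dm j) (dm j) (nth Z0 c (6 * l + w)) (lword j w)).
Definition lblk (d e : nat) (U : zlist) r c : zlist :=
  lmk d e (fun x y => ent U (r * d + x) (c * e + y)).
(** Each free summand has six basis vectors, the first being its generator, so this is the image of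
    the generator of summand [l]. *)
Definition grow (A : zlist) l : seq Z := nth [::] A (6 * l).
Definition item (A : seq zlist) i := nth [::] A i.

Definition seq_test i : bool :=
  let s := item src i in let t := item mid i in let p := item epi i in
  let: (c1, (U1, V1)) := nth (Z0, ([::], [::])) cert_mid i in
  let: (c2, (U2, V2)) := nth (Z0, ([::], [::])) cert_epi i in
  let: (c3, V3) := nth (Z0, [::]) cert_epi_full i in
  let C := dm (src_ix i) in let D := dm (mid_ix i) in let W := dm (epi_ix i) in
  [&& all (Z.ltb Z0) [:: c1; c2; c3], hom_test i (src_ix i) s, hom_test (src_ix i) (mid_ix i) t,
      hom_test (mid_ix i) (epi_ix i) p,
      leqm (dm i) D (lmul (dm i) C D s t) [::], leqm C W (lmul C D W t p) [::],
      leqm C C (ladd C C (lmul C D C t U1) (lmul C (dm i) C V1 s)) (lid C c1),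
      leqm D D (ladd D D (lmul D W D p U2) (lmul D C D V2 t)) (lid D c2) &
      leqm W W (lmul W D W V3 p) (lid W c3)].
Lemma seq_ok : alln 5 seq_test. Proof. by vm_compute. Qed.

Definition weight i x := nth 0 (nth [::] wts i) x.
Definition lowers_test m n (w w' : nat -> nat) (A : zlist) :=
  alln m (fun x => alln n (fun y => Z.eqb (ent A x y) Z0 || (w' y < w x)%N)).
Definition arrow i l := lmul (dm i) (dm (src_ix i)) (dm (part (src_ix i) l)) (item src i) (lprj (src_ix i) l).
Definition arrow_test i : bool :=
  alln (size (parts (src_ix i))) (fun l => (part (src_ix i) l < 5)%N &&
    lowers_test (dm i) (dm (part (src_ix i) l)) (weight i) (weight (part (src_ix i) l)) (arrow i l)).
Lemma arrow_ok : alln 5 arrow_test. Proof. by vm_compute. Qed.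

Fixpoint target i (p : seq nat) : nat :=
  if p is l :: p' then target (part (src_ix i) l) p' else i.
Fixpoint valid i (p : seq nat) : bool :=
  if p is l :: p' then (l < size (parts (src_ix i)))%N && valid (part (src_ix i) l) p' else (i < 5)%N.
Fixpoint path_mx i (p : seq nat) : zlist :=
  if p is l :: p' then
    lmul (dm i) (dm (part (src_ix i) l)) (dm (target (part (src_ix i) l) p'))
      (arrow i l) (path_mx (part (src_ix i) l) p')
  else lid (dm i) 1.
Definition path_list i j := nth [::] (nth [::] paths i) j.

(** The weight condition concerns the nonempty paths from N_i to itself: their combinations must be
    nilpotent for an endomorphism with nonzero identity part to be invertible. *)
Definition hom_cert_test i j : bool :=
  let: (c, (U, V)) := nth (Z0, ([::], [::])) (nth [::] cert_hom i) j in
  let ps := path_list i j in let d := dm j in let q := size ps in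
  [&& Z.ltb Z0 c, all (fun p => valid i p && (target i p == j)) ps,
      all (fun p => (p == [::]) || (i != j) || lowers_test (dm i) (dm j) (weight i) (weight j) (path_mx i p)) ps &
   alln (rk0 i) (fun l => alln (rk0 i) (fun l' =>
     leqm d d
       (ladd d d
         (lbig d d (rk1 i) (fun r => lmul d d d (elt (grow (item pres1 i) r) l j) (lblk d d U r l')))
         (lmul d q d (lblk d q V l 0)
            [seq nth [::] (lmul 1 (dm i) d [:: grow (item projcov0 i) l'] (path_mx i p)) 0 | p <- ps]))
       (if l == l' then lid d c else [::])))].
Lemma hom_cert_ok : alln 5 (fun i => alln 5 (hom_cert_test i)).
Proof. by vm_compute. Qed.

Definition ext_cert_test i j : bool :=
  let: (c, (U, V)) := nth (Z0, ([::], [::])) (nth [::] cert_ext i) j in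
  let d := dm j in
  Z.ltb Z0 c && alln (rk1 i) (fun l => alln (rk1 i) (fun l' =>
    leqm d d
       (ladd d d
         (lbig d d (rk2 i) (fun r => lmul d d d (elt (grow (item pres2 i) r) l j) (lblk d d U r l')))
         (lbig d d (rk0 i) (fun k => lmul d d d (lblk d d V l k) (elt (grow (item pres1 i) l') k j))))
       (if l == l' then lid d c else [::]))).
Lemma ext_cert_ok : alln 4 (fun i => alln 5 (ext_cert_test i)).
Proof. by vm_compute. Qed.

Definition res_test i : bool :=
  let F0 := dm (free_ix (rk0 i)) in let F1 := dm (free_ix (rk1 i)) in
  let: (c1, (U1, V1)) := nth (Z0, ([::], [::])) cert_cover0 i in
  let: (c2, V2) := nth (Z0, [::]) cert_cover0_full i in
  [&& all (Z.ltb Z0) [:: c1; c2], hom_test (free_ix (rk0 i)) i (item projcov0 i),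
      hom_test (free_ix (rk1 i)) (free_ix (rk0 i)) (item pres1 i),
      leqm F1 (dm i) (lmul F1 F0 (dm i) (item pres1 i) (item projcov0 i)) [::],
      leqm F0 F0 (ladd F0 F0 (lmul F0 (dm i) F0 (item projcov0 i) U1) (lmul F0 F1 F0 V1 (item pres1 i))) (lid F0 c1) &
      leqm (dm i) (dm i) (lmul (dm i) F0 (dm i) V2 (item projcov0 i)) (lid (dm i) c2)].
Lemma res_ok : alln 5 res_test. Proof. by vm_compute. Qed.

(** The argument [n] is a dimension, six times the rank, hence the division. *)
Definition rad_test m n (d : zlist) (UV : zlist * zlist) :=
  leqm m n (ladd m n (lmul m n n UV.1 (lact (free_ix (n %/ 6)) false))
                     (lmul m n n UV.2 (lact (free_ix (n %/ 6)) true))) d.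

(** Row [k] is the product of the words [w] and [k], so this is left multiplication by the word [w]
    on A. Following the projections onto the summands, these maps form a basis of Hom(A^m, A). *)
Definition lelt w := lmk 6 6 (fun k j => ent (lword 4 k) w j).
Definition dual_basis m x : zlist :=
  lmul (dm (free_ix m)) 6 6 (lprj (free_ix m) (x %/ 6)) (lelt (x %% 6)).

Definition tau_test i : bool :=
  let F0 := dm (free_ix (rk0 i)) in let F1 := dm (free_ix (rk1 i)) in
  let F2 := dm (free_ix (rk2 i)) in let O := dm (omega_ix i) in
  let D1 := dm (dual_ix (rk1 i)) in let D2 := dm (dual_ix (rk2 i)) in
  let: (c1, (U1, V1)) := nth (Z0, ([::], [::])) cert_cover1 i in
  let: (c2, V2) := nth (Z0, [::]) cert_cover1_full i in
  let: (c3, U3) := nth (Z0, [::]) cert_incl i in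
  let: (c4, (U4, V4)) := nth (Z0, ([::], [::])) cert_tau i in
  let: (c5, U5) := nth (Z0, [::]) cert_tau_free i in
  let: (c6, (U6, (V6, W6))) := nth (Z0, ([::], ([::], [::]))) cert_rad3 i in
  [&& [&& all (Z.ltb Z0) [:: c1; c2; c3; c4; c5; c6], hom_test (free_ix (rk2 i)) (free_ix (rk1 i)) (item pres2 i),
      hom_test (free_ix (rk1 i)) (omega_ix i) (item projcov1 i),
      hom_test (omega_ix i) (free_ix (rk0 i)) (item incl i),
      leqm F1 F0 (lmul F1 O F0 (item projcov1 i) (item incl i)) (item pres1 i),
      leqm O (dm i) (lmul O F0 (dm i) (item incl i) (item projcov0 i)) [::] &
      leqm F2 O (lmul F2 F1 O (item pres2 i) (item projcov1 i)) [::]],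
      [&& leqm F1 F1 (ladd F1 F1 (lmul F1 O F1 (item projcov1 i) U1) (lmul F1 F2 F1 V1 (item pres2 i))) (lid F1 c1),
      leqm O O (lmul O F1 O V2 (item projcov1 i)) (lid O c2),
      leqm O O (lmul O F0 O (item incl i) U3) (lid O c3),
      rad_test F1 F0 (item pres1 i) (nth ([::], [::]) cert_rad1 i),
      rad_test F2 F1 (item pres2 i) (nth ([::], [::]) cert_rad2 i) &
      leqm F2 F2 (ladd F2 F2 (lmul F2 F1 F2 (item pres2 i) U6)
        (ladd F2 F2 (lmul F2 F2 F2 V6 (lact (free_ix (rk2 i)) false))
                    (lmul F2 F2 F2 W6 (lact (free_ix (rk2 i)) true)))) (lid F2 c6)] &
      [&& hom_test i.+1 (dual_ix (rk2 i)) (item taumap i),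
      leqm (dm i.+1) D1 (lmul (dm i.+1) D2 D1 (item taumap i) (item dualpres i)) [::],
      leqm D2 D2 (ladd D2 D2 (lmul D2 D1 D2 (item dualpres i) U4) (lmul D2 (dm i.+1) D2 V4 (item taumap i))) (lid D2 c4),
      leqm (dm i.+1) (dm i.+1) (lmul (dm i.+1) D2 (dm i.+1) (item taumap i) U5) (lid (dm i.+1) c5) &
      alln D1 (fun j => leqm F2 6 (lmul F2 F1 6 (item pres2 i) (dual_basis (rk1 i) j))
         (lbig F2 6 D2 (fun k => lscal F2 6 (ent (item dualpres i) k j) (dual_basis (rk2 i) k))))]].
Lemma tau_ok : alln 4 tau_test. Proof. by vm_compute. Qed.

Definition coords_test m : bool :=
  alln (6 * m) (fun j => [&& hom_test (free_ix m) 4 (dual_basis m j),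
    all (fun c => leqm (dm (free_ix m)) 6 (lmul (dm (free_ix m)) 6 6 (dual_basis m j) (lmat c))
       (lbig (dm (free_ix m)) 6 (6 * m)
          (fun k => lscal (dm (free_ix m)) 6 (ent (lact (dual_ix m) c) k j) (dual_basis m k))))
      [:: false; true] &
    alln (6 * m) (fun k => Z.eqb (ent (dual_basis m k) (6 * (j %/ 6)) (j %% 6)) (if j == k then 1%stdZ else Z0))]).
Lemma coords_ok : alln 3 coords_test. Proof. by vm_compute. Qed.

Definition left_test c : bool := hom_test 4 4 (lmat c) &&
  leqm 1 6 (lmul 1 6 6 [:: [:: 1%stdZ]] (lmat c)) (lmul 1 6 6 [:: [:: 1%stdZ]] (lact 4 c)).
Lemma left_ok : left_test false && left_test true. Proof. by vm_compute. Qed.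

Definition free_test m : bool :=
  [&& dm (free_ix m) == (6 * m)%N, dm (dual_ix m) == (6 * m)%N,
    (free_ix m < 18)%N, size (parts (free_ix m)) == m &
    alln m (fun l => [&& part (free_ix m) l == 4, off (free_ix m) l == (6 * l)%N &
      leqm 1 (dm (free_ix m)) (lmul 1 6 (dm (free_ix m)) [:: [:: 1%stdZ]] (linc (free_ix m) l))
        (lmk 1 (dm (free_ix m)) (fun _ j => if j == (6 * l)%N then 1%stdZ else Z0))])].
Lemma free_ok : alln 3 free_test. Proof. by vm_compute. Qed.

(** * Modules and maps over K defined by the integer tables *)

Section Semantics.
Variable K : fieldType.

Definition model k : rep K := Rep (dm k) _ _ (zrels (lact_rels k)).

Lemma modelE k c : act (model k) c = zmx (dm k) (dm k) (lact k c).
Proof. by case: c. Qed.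

Lemma word_model k w : word (model k) w = zmx (dm k) (dm k) (lword k w).
Proof. by move: w => [|[|[|[|[|w]]]]]; rewrite /= ?zmx_id ?zr1 // -?zmxM. Qed.

Lemma hom_testP k l A : hom_test k l A -> rhom (model k) (model l) (zmx (dm k) (dm l) A).
Proof.
move=> /allP h; apply/rhomP => c; rewrite !modelE !zmxM; apply: zmx_eq; apply: h.
by case: c; rewrite !inE.
Qed.

Lemma zr_lmk m n f (i : 'I_m) (j : 'I_n) : zmx (K := K) m n (lmk m n f) i j = zr (f i j).
Proof. by rewrite mxE ent_lmk. Qed.

Definition inc k l : 'M[K]_(rdim (model (part k l)), rdim (model k)) := zmx (dm (part k l)) (dm k) (linc k l).
Definition prj k l : 'M[K]_(rdim (model k), rdim (model (part k l))) := zmx (dm k) (dm (part k l)) (lprj k l).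

Lemma partsP k : (k < 18)%N ->
  (forall l, (l < size (parts k))%N -> rhom (model (part k l)) (model k) (inc k l) /\
     rhom (model k) (model (part k l)) (prj k l)) /\
  \sum_(l < size (parts k)) prj k l *m inc k l = 1%:M.
Proof.
move=> /(allnP _ _ parts_ok)/andP[/allnP h1 /(@zmx_eq K) h2]; split.
  by move=> l /h1/and3P[hi hp _]; split; apply: hom_testP.
rewrite zmx_id zr1 in h2; rewrite -[RHS]h2 -zmx_big; apply: eq_bigr => l _.
by rewrite /prj /inc zmxM.
Qed.

Definition e0 : 'rV[K]_(rdim (model 4)) := zmx 1 6 [:: [:: 1%stdZ]].
(** The basis of A consists of the words, so the homomorphism sending 1 to [w] must have the vectors
    [w] times word [k] as its rows. *)
Definition gen_map W (w : 'rV[K]_(rdim W)) : 'M[K]_(rdim (model 4), rdim W) :=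
  \matrix_(k, y) (w *m word W k) 0 y.

Lemma row_gen_map W (w : 'rV[K]_(rdim W)) k : row k (gen_map w) = w *m word W k.
Proof. by apply/rowP => y; rewrite !mxE. Qed.

Lemma mul_gen_map W (w : 'rV[K]_(rdim W)) (u : 'rV[K]_6) :
  (u : 'rV_(rdim (model 4))) *m gen_map w = w *m \sum_(k < 6) u 0 k *: word W k.
Proof.
rewrite mulmx_sum_row mulmx_sumr; apply: eq_bigr => k _.
by rewrite row_gen_map scalemxAr.
Qed.

Lemma gen_map_hom W (w : 'rV[K]_(rdim W)) : rhom (model 4) W (gen_map w).
Proof.
apply/rhomP => c; apply/row_matrixP => k; rewrite !row_mul row_gen_map -mulmxA.
rewrite mul_gen_map; congr (_ *m _); rewrite word_r //; apply: eq_bigr => l _; congr (_ *: _).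
have /and3P[_ _ /allP/(_ c)] := allnP _ _ gen_ok 0 isT.
by case: c => /(_ isT)/andP[/(@zmx_eq K) h _]; rewrite modelE h !mxE.
Qed.

Lemma e0_word (k : 'I_6) : e0 *m word (model 4) k = delta_mx 0 k.
Proof.
have /and3P[/(@zmx_eq K) h _ _] := allnP _ _ gen_ok k (ltn_ord k).
rewrite /e0 word_model zmxM h; apply/matrixP => x y.
by rewrite zr_lmk mxE ord1 eqxx -val_eqE /=; case: eqP.
Qed.

Lemma e0_gen_map W (w : 'rV[K]_(rdim W)) : e0 *m gen_map w = w.
Proof.
have := e0_word 0; rewrite mulmx1 => ->; rewrite -rowE row_gen_map mulmx1 //.
Qed.

Lemma rgen_e0 : rgen (model 4) e0.
Proof.
move=> W w; exists (gen_map w); split; first by rewrite gen_map_hom e0_gen_map.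
move=> f [hf ef]; apply/row_matrixP => k.
by rewrite row_gen_map rowE -e0_word -mulmxA (word_hom k hf) mulmxA ef.
Qed.

Lemma col_eq m n (A B : 'M[K]_(m, n)) : (forall k, col k A = col k B) -> A = B.
Proof. by move=> h; apply/trmx_inj/row_matrixP => k; rewrite -!tr_col h. Qed.

Definition l0 : 'cV[K]_(rdim (model 0)) := zmx 6 1 [:: [:: 1%stdZ]].

Lemma l0_word (k : 'I_6) : word (model 0) k *m l0 = delta_mx k 0.
Proof.
have /and3P[_ /(@zmx_eq K) h _] := allnP _ _ gen_ok k (ltn_ord k).
rewrite /l0 word_model zmxM h; apply/matrixP => x y.
by rewrite zr_lmk mxE ord1 eqxx andbT -val_eqE /=; case: eqP.
Qed.

Lemma lgen_l0 : lgen (model 0) l0.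
Proof.
move=> W w; pose f : 'M[K]_(rdim W, rdim (model 0)) := \matrix_(x, k) (word W k *m w) x 0.
have cf k : col k f = word W k *m w by apply/colP => x; rewrite !mxE.
have act0 c k : col k (f *m act (model 0) c) = col k (act W c *m f).
  have /and3P[_ _ /allP/(_ c)] := allnP _ _ gen_ok 0 isT.
  have -> : c \in [:: false; true] by case: c.
  move=> /(_ isT)/andP[_ /(@zmx_eq K) h].
  rewrite !colE -mulmxA -[RHS]mulmxA -!colE cf mulmxA word_l // modelE h mulmx_suml.
  apply/colP => x; rewrite !mxE summxE; apply: eq_bigr => l _.
  by rewrite -scalemxAl [col _ _ _ _]mxE zr_lmk [f x l]mxE [RHS]mxE mulrC.
have actE c : f *m act (model 0) c = act W c *m f.
  by apply: col_eq => k; rewrite act0.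
have fl : f *m l0 = w.
  by have := l0_word 0; rewrite mul1mx => ->; rewrite -colE cf mul1mx.
exists f; split; first by split=> //; apply/andP; split; apply/eqP; [exact: actE false | exact: actE true].
move=> g [/andP[/eqP ga /eqP gb] gl].
have hg c : g *m act (model 0) c = act W c *m g by case: c.
have gw k : g *m word (model 0) k = word W k *m g.
  by apply/esym; apply: word_hom; apply/rhomP => c; rewrite hg.
apply: col_eq => k; rewrite cf colE -l0_word mulmxA gw -mulmxA gl //.
Qed.

Section Free.
Variable m : nat.
Hypothesis m3 : (m < 3)%N.
Let F := model (free_ix m).

Lemma dim_free : dm (free_ix m) = (6 * m)%N.
Proof. by have /and5P[/eqP] := allnP _ _ free_ok m m3. Qed.

Definition finc l : 'M[K]_(rdim (model 4), rdim F) := zmx 6 (dm (free_ix m)) (linc (free_ix m) l).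
Definition fprj l : 'M[K]_(rdim F, rdim (model 4)) := zmx (dm (free_ix m)) 6 (lprj (free_ix m) l).
Definition gen l : 'rV[K]_(rdim F) := e0 *m finc l.

Let freeP : (free_ix m < 18)%N /\ size (parts (free_ix m)) = m.
Proof. by have /and5P[_ _ h /eqP] := allnP _ _ free_ok m m3. Qed.

Lemma part_free l : (l < m)%N -> part (free_ix m) l = 4%N /\ off (free_ix m) l = (6 * l)%N.
Proof.
by have /and5P[_ _ _ _ /allnP h] := allnP _ _ free_ok m m3; move=> /h/and3P[/eqP ? /eqP ?].
Qed.

Lemma finc_hom l : (l < m)%N -> rhom (model 4) F (finc l).
Proof.
move=> lm; have [k18 sz] := freeP; have [] := partsP k18; rewrite sz => /(_ l lm)[+ _] _.
by rewrite /inc; have [-> _] := part_free lm.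
Qed.

Lemma fprj_hom l : (l < m)%N -> rhom F (model 4) (fprj l).
Proof.
move=> lm; have [k18 sz] := freeP; have [] := partsP k18; rewrite sz => /(_ l lm)[_ +] _.
by rewrite /prj; have [-> _] := part_free lm.
Qed.

Lemma fprj_finc : \sum_(l < m) fprj l *m finc l = 1%:M.
Proof.
have [k18 sz] := freeP; have [_ <-] := partsP k18; rewrite sz; apply: eq_bigr => l _.
by rewrite /prj /inc /fprj /finc; have [-> _] := part_free (ltn_ord l).
Qed.

Lemma finc_fprj l l' : (l < m)%N -> (l' < m)%N ->
  finc l *m fprj l' = if l == l' then 1%:M else 0.
Proof.
move=> lm l'm; have [k18 sz] := freeP.
have /andP[/allnP h _] := allnP _ _ parts_ok _ k18.
have := h l; rewrite sz => /(_ lm)/and3P[_ _ /allnP/(_ l' l'm)/(@zmx_eq K)].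
have [-> _] := part_free lm; have [-> _] := part_free l'm.
rewrite -zmxM => h'; rewrite /finc /fprj [LHS]h'.
by case: eqP => _; rewrite ?zmx_id ?zmx0.
Qed.

Lemma fprjE l (x : 'I_(dm (free_ix m))) (w : 'I_6) : (l < m)%N ->
  fprj l x w = zr (if x == (6 * l + w)%N :> nat then 1%stdZ else Z0).
Proof. by move=> lm; rewrite mxE /lprj; have [-> ->] := part_free lm; rewrite ent_lmk. Qed.

Definition free_map W (v : nat -> 'rV[K]_(rdim W)) : 'M[K]_(rdim F, rdim W) :=
  \sum_(l < m) fprj l *m gen_map (v l).

Lemma free_map_hom W v : rhom F W (@free_map W v).
Proof. by apply: rhom_sum => l _; apply: rhomM (gen_map_hom _); apply: fprj_hom. Qed.

Lemma gen_free_map W (v : nat -> 'rV[K]_(rdim W)) l : (l < m)%N -> gen l *m free_map v = v l.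
Proof.
move=> lm; rewrite /gen -mulmxA mulmx_sumr (bigD1 (Ordinal lm)) //= big1 ?addr0.
  by rewrite (mulmxA (finc l)) finc_fprj // eqxx mul1mx e0_gen_map.
move=> l' ll'; rewrite (mulmxA (finc l)) finc_fprj // eq_sym.
by rewrite -val_eqE /= in ll'; rewrite (negPf ll') mul0mx.
Qed.

Lemma free_inj W (y y' : 'M[K]_(rdim F, rdim W)) : rhom F W y -> rhom F W y' ->
  (forall l, (l < m)%N -> gen l *m y = gen l *m y') -> y = y'.
Proof.
move=> hy hy' h; rewrite -[y]mul1mx -[y']mul1mx -fprj_finc !mulmx_suml.
apply: eq_bigr => l _; rewrite -!mulmxA; congr (_ *m _); apply: (rgen_inj rgen_e0).
- by apply: rhomM hy; apply: finc_hom.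
- by apply: rhomM hy'; apply: finc_hom.
by rewrite !mulmxA; apply: h.
Qed.

Lemma free_proj : rproj F.
Proof.
move=> W W' g h hg fg hh; have [g' gg] := row_fullP fg.
exists (free_map (fun l => gen l *m h *m g')); split; first exact: free_map_hom.
apply: free_inj => //; first by apply: rhomM hg; apply: free_map_hom.
by move=> l lm; rewrite mulmxA gen_free_map // -mulmxA gg mulmx1.
Qed.

Lemma gen_row l n A : (l < m)%N -> gen l *m zmx (dm (free_ix m)) n A = zmx 1 n [:: grow A l].
Proof.
move=> lm; have l6 : (6 * l < dm (free_ix m))%N by rewrite dim_free ltn_mul2l.
have /and5P[_ _ _ _ /allnP h] := allnP _ _ free_ok m m3.
have /and3P[_ _ /(@zmx_eq K) hl] := h l lm.
have -> : gen l = delta_mx 0 (Ordinal l6) :> 'rV[K]_(dm (free_ix m)).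
  rewrite /gen /e0 /finc zmxM hl; apply/matrixP => x y.
  by rewrite zr_lmk mxE ord1 eqxx -val_eqE /=; case: eqP.
by rewrite -rowE zrow.
Qed.

(** A homomorphism on a free module sends an element to the combination of the images of the
    generators with the same coefficients. Applied to rows of a presentation matrix, this turns
    relations into linear equations for those images. *)
Lemma row_gen c j (y : 'M[K]_(rdim F, rdim (model j))) : rhom F (model j) y ->
  zmx 1 (dm (free_ix m)) [:: c] *m y =
  \sum_(l < m) (gen l *m y) *m zmx (dm j) (dm j) (elt c l j).
Proof.
move=> hy; have -> : y = free_map (fun l => gen l *m y).
  by apply: free_inj => //; [exact: free_map_hom | move=> l lm; rewrite gen_free_map].
rewrite mulmx_sumr; apply: eq_bigr => l _; rewrite mulmxA gen_free_map // mul_gen_map.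
congr (_ *m _); rewrite -zmx_big; apply: eq_bigr => w _; rewrite -zmxZ word_model; congr (_ *: _).
have lw : (6 * l + w < dm (free_ix m))%N.
  by rewrite dim_free (leq_trans (n := 6 * l.+1)) ?leq_mul2l ?ltn_ord // mulnS addnC ltn_add2r.
rewrite mxE (bigD1 (Ordinal lw)) //= big1 ?addr0.
  by rewrite fprjE // mxE eqxx mulr1.
move=> x xw; rewrite -val_eqE /= in xw.
by rewrite fprjE // (negPf xw) mulr0.
Qed.

End Free.
End Semantics.

Definition rank_test i := [&& rk0 i < 3, rk1 i < 3 & rk2 i < 3]%N.
Lemma rank_ok : alln 5 rank_test. Proof. by vm_compute. Qed.

(** * Meaning of the certificates *)

Section Char0.
Variables (K : fieldType) (charK0 : [pchar K]%R =i pred0).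
Local Notation model := (model K).

(** The characteristic enters here: the positive integer scalars of the certificates remain
    invertible in K. *)
Lemma zr_neq0 z : Z.ltb Z0 z -> zr (K := K) z != 0.
Proof.
case: z => // p _; rewrite /zr -[int_of_Z _]/(Posz (Pos.to_nat p)) -pmulrn (proj1 (pcharf0P K) charK0).
by case: (Pos2Nat.is_succ p) => n ->.
Qed.

Lemma lowers_testP m n w w' A : lowers_test m n w w' A -> lowers w w' (zmx (K := K) m n A).
Proof.
move=> /allnP h x y; rewrite mxE => xy.
have /allnP/(_ y (ltn_ord y)) := h x (ltn_ord x).
by case: Z.eqb_spec => // e; rewrite e zr0 eqxx in xy.
Qed.

Lemma rank3 i : (i < 5)%N -> [/\ (rk0 i < 3)%N, (rk1 i < 3)%N & (rk2 i < 3)%N].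
Proof. by move=> /(allnP _ _ rank_ok)/and3P. Qed.

(** Multiplying the certificate by the unknown vectors [v] kills the part containing the equations
    [E] and leaves [v] itself, up to the factor [c], in terms of [G]. *)
Lemma solve_cert m s d (v : nat -> 'rV[K]_d) n (E : nat -> nat -> 'M[K]_(d, n))
    (U : nat -> nat -> 'M[K]_(n, d)) (G : nat -> nat -> 'M[K]_d) c :
  (forall l l', (l < m)%N -> (l' < m)%N ->
     \sum_(r < s) E l r *m U r l' + G l l' = if l == l' then c%:M else 0) ->
  (forall r, (r < s)%N -> \sum_(l < m) v l *m E l r = 0) ->
  forall l', (l' < m)%N -> c *: v l' = \sum_(l < m) v l *m G l l'.
Proof.
move=> h0 hv l' lm'.
have : \sum_(l < m) v l *m (\sum_(r < s) E l r *m U r l' + G l l') = c *: v l'.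
  rewrite (bigD1 (Ordinal lm')) //= h0 // eqxx mul_mx_scalar big1 ?addr0 // => l ll'.
  by rewrite h0 //; rewrite -val_eqE /= in ll'; rewrite (negPf ll') mulmx0.
move=> <-; under eq_bigr do rewrite mulmxDr mulmx_sumr.
rewrite big_split /= exchange_big big1 ?add0r // => r _.
by under eq_bigr do rewrite mulmxA; rewrite -mulmx_suml hv // mul0mx.
Qed.

Section Sequence.
Variable i : nat.
Hypothesis i5 : (i < 5)%N.

Definition smx : 'M[K]_(rdim (model i), rdim (model (src_ix i))) := zmx (dm i) (dm (src_ix i)) (item src i).
Definition tmx : 'M[K]_(rdim (model (src_ix i)), rdim (model (mid_ix i))) :=
  zmx (dm (src_ix i)) (dm (mid_ix i)) (item mid i).

Lemma seqP : [/\ rhom (model i) (model (src_ix i)) smx, rhom (model (src_ix i)) (model (mid_ix i)) tmx,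
  smx *m tmx = 0 & exists p, [/\ rhom (model (mid_ix i)) (model (epi_ix i)) p, row_full p,
    (kermx tmx <= smx)%MS, tmx *m p = 0 & (kermx p <= tmx)%MS]].
Proof.
have := allnP _ _ seq_ok i i5; rewrite /seq_test.
case: (nth _ cert_mid i) => c1 [U1 V1]; case: (nth _ cert_epi i) => c2 [U2 V2].
case: (nth _ cert_epi_full i) => c3 V3.
case/and5P => /= /and4P[c1p c2p c3p _] h1 h2 h3 /and5P[h4 h5 h6 h7 h8].
split; [exact: hom_testP | exact: hom_testP | exact: zmul0|].
exists (zmx (dm (mid_ix i)) (dm (epi_ix i)) (item epi i)); split.
- exact: hom_testP.
- exact: (zfull (zr_neq0 c3p) h8).
- exact: (zker (zr_neq0 c1p) h6).
- exact: zmul0.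
- exact: (zker (zr_neq0 c2p) h7).
Qed.

Lemma arrowE l : zmx (dm i) (dm (part (src_ix i) l)) (arrow i l) = smx *m prj K (src_ix i) l.
Proof. by rewrite /arrow -zmxM. Qed.

Lemma arrowP l : (l < size (parts (src_ix i)))%N ->
  [/\ (part (src_ix i) l < 5)%N, rhom (model (src_ix i)) (model (part (src_ix i) l)) (prj K (src_ix i) l),
   rhom (model (part (src_ix i) l)) (model (src_ix i)) (inc K (src_ix i) l) &
   lowers (weight i) (weight (part (src_ix i) l)) (smx *m prj K (src_ix i) l)].
Proof.
move=> ls; have /allnP/(_ l ls)/andP[p5 /lowers_testP] := allnP _ _ arrow_ok i i5.
rewrite arrowE => low.
have k18 : (src_ix i < 18)%N by exact: (allnP 5 (fun x => src_ix x < 18)%N isT i i5).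
by have [/(_ l ls)[]] := partsP K k18.
Qed.

End Sequence.

Lemma path_hom i p : (i < 5)%N -> valid i p ->
  rhom (model i) (model (target i p)) (zmx (dm i) (dm (target i p)) (path_mx i p)).
Proof.
elim: p i => [|l p IH] i i5; first by rewrite /= zmx_id zr1; move=> _; apply: rhom1.
case/andP => ls vp; have [p5 hp _ _] := arrowP i5 ls; have [hs _ _ _] := seqP i5.
rewrite [path_mx _ _]/= [target _ _]/= -zmxM arrowE.
exact: rhomM (rhomM hs hp) (IH _ p5 vp).
Qed.

Lemma ker_cert m n (f : 'M[K]_(m, n)) U A B (V W : 'M[K]_m) c : c != 0 ->
  f *m U + (V *m A + W *m B) = c%:M -> (kermx f <= A + B)%MS.
Proof.
move=> c0 /(congr1 (mulmx (kermx f))); rewrite mulmxDr mulmxA mulmx_ker mul0mx add0r.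
rewrite mul_mx_scalar => e; rewrite -[kermx f]scale1r -(mulVf c0) -scalerA -e.
by rewrite scalemx_sub // mulmxDr !mulmxA addmx_sub_adds ?submxMl.
Qed.

Section Resolution.
Variable i : nat.
Hypothesis i5 : (i < 5)%N.
Let F0 := free_ix (rk0 i).
Let F1 := free_ix (rk1 i).

Definition p0 : 'M[K]_(rdim (model F0), rdim (model i)) := zmx (dm F0) (dm i) (item projcov0 i).
Definition d1 : 'M[K]_(rdim (model F1), rdim (model F0)) := zmx (dm F1) (dm F0) (item pres1 i).

Lemma resP : [/\ rhom (model F0) (model i) p0, rhom (model F1) (model F0) d1, d1 *m p0 = 0,
  (kermx p0 <= d1)%MS & row_full p0].
Proof.
have := allnP _ _ res_ok i i5; rewrite /res_test.
case: (nth _ cert_cover0 i) => c1 [U1 V1]; case: (nth _ cert_cover0_full i) => c2 V2.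
case/and5P => /= /and3P[c1p c2p _] h1 h2 h3 /andP[h4 h5]; split.
- exact: hom_testP.
- exact: hom_testP.
- exact: zmul0.
- exact: (zker (zr_neq0 c1p) h4).
- exact: (zfull (zr_neq0 c2p) h5).
Qed.

Lemma gen_p0 l : (l < rk0 i)%N -> gen K (rk0 i) l *m p0 = zmx 1 (dm i) [:: grow (item projcov0 i) l].
Proof. by have [r0 _ _] := rank3 i5; move=> lm; rewrite /p0 gen_row. Qed.

Lemma gen_d1 l : (l < rk1 i)%N -> gen K (rk1 i) l *m d1 = zmx 1 (dm F0) [:: grow (item pres1 i) l].
Proof. by have [_ r1 _] := rank3 i5; move=> lm; rewrite /d1 gen_row. Qed.

(** A homomorphism is determined by the images [v] of the generators of P_0, which satisfy the
    equations given by P_1. The certificate solves these equations and its [V] part produces the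
    coefficients of the paths. *)
Lemma hom_span_paths j (f : 'M[K]_(rdim (model i), rdim (model j))) : (j < 5)%N ->
  rhom (model i) (model j) f -> exists2 c, c != 0 & exists x : 'rV[K]_(size (path_list i j)),
    c *: f = \sum_b x 0 b *: zmx (dm i) (dm j) (path_mx i (nth [::] (path_list i j) b)).
Proof.
move=> j5 hf; have [r0 r1 _] := rank3 i5; have [hp hd dp _ fp] := resP.
have := allnP _ _ (allnP _ _ hom_cert_ok i i5) j j5; rewrite /hom_cert_test.
case: (nth _ (nth _ cert_hom i) j) => c [U V] /and4P[cp /allP vp _ /allnP cert].
set ps := path_list i j in cert vp *; set q := size ps in cert *.
exists (zr c); first exact: zr_neq0.
pose v l := gen K (rk0 i) l *m (p0 *m f).
pose B l' := zmx (K := K) q (dm j)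
  [seq nth [::] (lmul 1 (dm i) (dm j) [:: grow (item projcov0 i) l'] (path_mx i p)) 0 | p <- ps].
pose VV l := zmx (K := K) (dm j) q (lblk (dm j) q V l 0).
have sol := @solve_cert (rk0 i) (rk1 i) (dm j) v (dm j)
  (fun l r => zmx (dm j) (dm j) (elt (grow (item pres1 i) r) l j))
  (fun r l' => zmx (dm j) (dm j) (lblk (dm j) (dm j) U r l')) (fun l l' => VV l *m B l') (zr c).
pose x : 'rV[K]_q := \sum_(l < rk0 i) v l *m VV l.
exists x; set g := \sum_b _.
have hg : rhom (model i) (model j) g.
  apply: rhom_sum => b _; apply: rhomZ.
  have /vp/andP[vb /eqP <-] : nth [::] ps b \in ps by apply: mem_nth.
  exact: path_hom.
(* P_0 covers N_i and is free, so both maps need only be compared at its generators. *)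
apply: (row_full_inj fp); apply: (free_inj r0).
- by apply: rhomM hp _; apply: rhomZ.
- exact: rhomM hp hg.
move=> l' l'm; rewrite -scalemxAr -scalemxAr -/(v l') sol //.
- under eq_bigr do rewrite mulmxA; rewrite -mulmx_suml -/x mulmx_sum_row /g !mulmx_sumr.
  apply: eq_bigr => b _; rewrite -!scalemxAr mulmxA gen_p0 // zmxM; congr (_ *: _).
  by rewrite /B zrow (nth_map [::]) //; apply/rowP => y; rewrite !mxE.
- move=> l k lm km; have /allnP/(_ k km)/(@zmx_eq K) := cert l lm.
  rewrite -zmxD -zmx_big -zmxM => e; rewrite (_ : \sum_(r < rk1 i) _ =
     \sum_(r < rk1 i) zmx (dm j) (dm j) (lmul (dm j) (dm j) (dm j) (elt (grow (item pres1 i) r) l j) (lblk (dm j) (dm j) U r k))).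
    by rewrite e; case: eqP => _; rewrite ?zmx_id ?zmx0.
  by apply: eq_bigr => r _; rewrite zmxM.
move=> r rm; rewrite -(row_gen r0); last exact: rhomM hp hf.
by rewrite -gen_d1 // -mulmxA (mulmxA d1) dp mul0mx mulmx0.
Qed.

End Resolution.

(** If v (c + n) = 0, then v is proportional to v n, whose support has smaller weights than that of
    v; descending, v = 0. *)
Lemma lowers_unit d (w : nat -> nat) (n : 'M[K]_d) c : c != 0 -> lowers w w n ->
  c%:M + n \in unitmx.
Proof.
move=> c0 ln; suff ker0 v : v *m (c%:M + n) = 0 :> 'rV_d -> v = 0.
  rewrite -row_free_unit -kermx_eq0; apply/eqP/row_matrixP => k; rewrite row0.
  by apply: ker0; rewrite -row_mul mulmx_ker row0.
rewrite mulmxDr mul_mx_scalar => /eqP; rewrite addr_eq0 => /eqP vE.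
have low m : (forall x, v 0 x != 0 -> (w x < m)%N) -> v = 0.
  elim: m => [|m IH] h; first by apply/rowP => x; rewrite mxE; apply/eqP/negPn/negP => /h.
  apply: IH => y vy; have : (c *: v) 0 y != 0 by rewrite mxE mulf_neq0.
  rewrite vE 2!mxE oppr_eq0 => vn; have [x] : exists x, v 0 x * n x y != 0.
    apply/existsP; apply: contraR vn => /existsPn /= vn.
    by rewrite big1 // => x _; apply/eqP/negPn/vn.
  by rewrite mulf_eq0 negb_or => /andP[/h vx /ln xy]; apply: leq_trans xy vx.
apply: (low (\max_(y < d) w y).+1) => y _.
by rewrite ltnS; apply: (@leq_bigmax _ (fun y : 'I_d => w y)).
Qed.

(** In terms of paths, every nonempty path factors through [smx i] by its first arrow, so only the
    identity path can obstruct a factorization; when its coefficient is nonzero, [f] is up to a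
    scalar the sum of a nonzero scalar and a weight-lowering map. *)
Lemma hom_radical i j (f : 'M[K]_(rdim (model i), rdim (model j))) : (i < 5)%N -> (j < 5)%N ->
  rhom (model i) (model j) f ->
  (exists2 g, rhom (model (src_ix i)) (model j) g & f = smx i *m g) \/
  (exists2 g, rhom (model j) (model i) g & g *m f = 1%:M).
Proof.
move=> i5 j5 hf; have [c c0 [x xE]] := hom_span_paths i5 j5 hf.
have := allnP _ _ (allnP _ _ hom_cert_ok i i5) j j5; rewrite /hom_cert_test.
case: (nth _ (nth _ cert_hom i) j) => _ [_ _] /and4P[_ /allP vp /allP lowp _].
set ps := path_list i j in x xE vp lowp.
pose p (b : 'I_(size ps)) := nth [::] ps b.
have pps b : p b \in ps by apply: mem_nth.
have ex b : exists g : 'M[K]_(rdim (model (src_ix i)), rdim (model j)), rhom (model (src_ix i)) (model j) g /\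
    (p b != [::] -> zmx (dm i) (dm j) (path_mx i (p b)) = smx i *m g).
  (* The value 0 is a placeholder for the empty path, which the condition excludes. *)
  have := vp _ (pps b); case: (p b) => [|l q] /=; first by exists 0; split=> //; apply: rhom0.
  case/andP => /andP[ls vq] /eqP <-; have [p5 hp _ _] := arrowP i5 ls.
  exists (prj K (src_ix i) l *m zmx (dm (part (src_ix i) l)) _ (path_mx (part (src_ix i) l) q)).
  split; first exact: rhomM hp (path_hom p5 vq).
  by move=> _; rewrite mulmxA -arrowE zmxM.
have [g hg] := fin_all_exists ex.
pose h := \sum_(b | p b != [::]) x 0 b *: g b.
have hh : rhom (model (src_ix i)) (model j) h.
  by apply: rhom_sum => b _; apply: rhomZ; apply: (hg b).1.
have nE : smx i *m h = \sum_(b | p b != [::]) x 0 b *: zmx (dm i) (dm j) (path_mx i (p b)).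
  by rewrite mulmx_sumr; apply: eq_bigr => b pb; rewrite (hg b).2 // scalemxAr.
have left : c *: f = smx i *m h -> exists2 g, rhom (model (src_ix i)) (model j) g & f = smx i *m g.
  move=> e; exists (c^-1 *: h); first exact: rhomZ.
  by rewrite -scalemxAr -e scalerA mulVf // scale1r.
(* For distinct indices the empty path is not listed, since its target would be N_i. *)
case: (altP (i =P j)) => [ij|ij]; last first.
  left; apply: left; rewrite nE xE; apply: eq_bigl => b; apply/esym.
  by have := vp _ (pps b); case: (p b) => //= /andP[_]; rewrite (negPf ij).
subst j; pose c' := \sum_(b | p b == [::]) x 0 b.
have fE : c *: f = c'%:M + smx i *m h.
  rewrite nE xE (bigID (fun b => p b == [::])) /=; congr (_ + _).
  rewrite /c' raddf_sum; apply: eq_bigr => b /eqP pb.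
  by rewrite -/(p b) pb /= zmx_id zr1 scalemx1.
have [c0'|c0'] := eqVneq c' 0.
  by left; apply: left; rewrite fE c0' raddf0 add0r.
right; have u : f \in unitmx.
  rewrite -(unitmxZ f (a := c)) ?unitfE // fE; apply: (lowers_unit (w := weight i)) => //.
  move=> y z; rewrite nE summxE => sz.
  have [b] : exists b, (p b != [::]) && ((x 0 b *: zmx (dm i) (dm i) (path_mx i (p b))) y z != 0).
    apply/existsP; apply: contraR sz => /existsPn /= sz.
    by rewrite big1 // => b pb; apply/eqP; have := sz b; rewrite pb /= negbK.
  case/andP => pb; rewrite [X in X != _]mxE mulf_eq0 negb_or => /andP[_].
  have := lowp _ (pps b); rewrite (negPf pb) eqxx /=.
  by move=> /lowers_testP/(_ y z).
exists (invmx f); last exact: mulVmx.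
by apply: rhom_inv hf _ _; rewrite ?mulmxV ?mulVmx.
Qed.

Lemma superfluous V k (f : 'M[K]_(rdim V, k)) Q (h : 'M[K]_(rdim Q, rdim V)) :
  (kermx f <= ra V + rb V)%MS -> rhom Q V h -> (f <= h *m f)%MS -> row_full h.
Proof.
move=> kf /rhomP hh /submxP[d fd]; apply: nakayama => [c|].
  by rewrite -hh submxMl.
rewrite -[1%:M](subrK (d *m h)) addrC addmx_sub_adds ?submxMl //.
by apply: submx_trans kf; rewrite sub_kermx mulmxBl mul1mx -mulmxA -fd subrr.
Qed.

Lemma rad_testP m n (d : zlist) UV l (k : 'M[K]_(rdim (model (free_ix n)), l)) : (n < 3)%N -> rad_test m (dm (free_ix n)) d UV ->
  (kermx k <= zmx (K := K) m (dm (free_ix n)) d)%MS -> 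
  (kermx k <= ra (model (free_ix n)) + rb (model (free_ix n)))%MS.
Proof.
move=> n3; have e6 : (dm (free_ix n) %/ 6)%N = n by rewrite dim_free // mulKn.
rewrite /rad_test e6 => /(@zmx_eq K) e kd; apply: submx_trans kd _.
by rewrite -e -zmxD -!zmxM addmx_sub_adds ?submxMl.
Qed.

Section Tau.
Variable i : nat.
Hypothesis i4 : (i < 4)%N.
Let F0 := free_ix (rk0 i).
Let F1 := free_ix (rk1 i).
Let F2 := free_ix (rk2 i).
Let O := omega_ix i.
Let i5 : (i < 5)%N := ltnW i4.

Definition d2 : 'M[K]_(rdim (model F2), rdim (model F1)) := zmx (dm F2) (dm F1) (item pres2 i).
Definition q1 : 'M[K]_(rdim (model F1), rdim (model O)) := zmx (dm F1) (dm O) (item projcov1 i).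
Definition io : 'M[K]_(rdim (model O), rdim (model F0)) := zmx (dm O) (dm F0) (item incl i).

(** The resolution of N_i is used with a shift: P_2 -> P_1 is the minimal presentation of the
    syzygy, so its dualization is the one whose kernel is N_{i+1}. *)
Lemma coverP : [/\ rhom (model F2) (model F1) d2, rhom (model F1) (model O) q1, rhom (model O) (model F0) io,
   q1 *m io = d1 i & d2 *m q1 = 0] /\
  [/\ io *m p0 i = 0, row_full q1, row_free io & (kermx q1 <= d2)%MS] /\
  [/\ (kermx (p0 i) <= ra (model F0) + rb (model F0))%MS, (kermx q1 <= ra (model F1) + rb (model F1))%MS,
   (kermx d2 <= ra (model F2) + rb (model F2))%MS &
   forall j, (j < dm (dual_ix (rk1 i)))%N -> d2 *m zmx (dm F1) 6 (dual_basis (rk1 i) j) =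
     \sum_(k < dm (dual_ix (rk2 i))) zr (ent (item dualpres i) k j) *: zmx (dm F2) 6 (dual_basis (rk2 i) k)] /\
  exists t : 'M[K]_(rdim (model i.+1), rdim (model (dual_ix (rk2 i)))),
  [/\ rhom (model i.+1) (model (dual_ix (rk2 i))) t, row_free t &
     (t == kermx (zmx (dm (dual_ix (rk2 i))) (dm (dual_ix (rk1 i))) (item dualpres i)))%MS].
Proof.
have [r0 r1 r2] := rank3 i5; have [_ _ _ kp _] := resP i5.
have := allnP _ _ tau_ok i i4; rewrite /tau_test.
case: (nth _ cert_cover1 i) => c1 [U1 V1]; case: (nth _ cert_cover1_full i) => c2 V2.
case: (nth _ cert_incl i) => c3 U3; case: (nth _ cert_tau i) => c4 [U4 V4].
case: (nth _ cert_tau_free i) => c5 U5; case: (nth _ cert_rad3 i) => c6 [U6 [V6 W6]].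
case/and3P => /and5P[/= /and5P[c1p c2p c3p c4p /and3P[c5p c6p _]] h1 h2 h3 /and3P[h4 h5 h6]].
move=> /and5P[h7 h8 h9 h10 /andP[h11 h17]] /and5P[h12 h13 h14 h15 /allnP h16].
have kq : (kermx q1 <= d2)%MS := zker (zr_neq0 c1p) h7.
split; first split; [exact: hom_testP|exact: hom_testP|exact: hom_testP|exact: zmulE|exact: zmul0|].
split; first split; [exact: zmul0|exact: (zfull (zr_neq0 c2p) h8)|exact: (zfree (zr_neq0 c3p) h9)|exact: kq|].
split; first split.
- exact: rad_testP r0 h10 kp.
- exact: rad_testP r1 h11 kq.
- move/(@zmx_eq K): h17; rewrite zmx_id -!zmxD -!zmxM => e.
  exact: (ker_cert (zr_neq0 c6p) e).
- move=> j /h16 e; apply: (etrans (zmulE e)); rewrite -zmx_big; apply: eq_bigr => k _.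
  by rewrite zmxZ.
exists (zmx (dm i.+1) (dm (dual_ix (rk2 i))) (item taumap i)); split.
- exact: hom_testP.
- exact: (zfree (zr_neq0 c5p) h15).
by apply/andP; split; [rewrite sub_kermx zmul0 | exact: (zker (zr_neq0 c4p) h14)].
Qed.

Lemma cover0P : proj_cover (model F0) (model i) (p0 i).
Proof.
have [r0 _ _] := rank3 i5; have [hp _ _ _ fp] := resP i5.
have [_ [_ [[kp _ _] _]]] := coverP; split=> //; first exact: free_proj.
by move=> Q h hh full; apply: superfluous kp hh _; apply: submx_full.
Qed.

Lemma syzygy_model : syzygy (model i) (model O).
Proof.
have [[_ _ hio qio _] [[iop _ fio _] _]] := coverP.
exists (model F0), (p0 i), io; split=> //; first exact: cover0P.
apply/andP; split; first by rewrite sub_kermx iop.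
by have [_ _ _ kp _] := resP i5; apply: submx_trans kp _; rewrite -qio submxMl.
Qed.

Lemma min_pres_model : min_pres (model O) (model F2) (model F1) d2 q1.
Proof.
have [_ r1 r2] := rank3 i5.
have [[hd hq _ _ dq] [[_ fq _ kq] [[_ kq1 kd _] _]]] := coverP; split=> //.
- split=> //; first exact: free_proj.
  by move=> Q h hh full; apply: superfluous kq1 hh _; apply: submx_full.
- exact: free_proj.
- by apply/andP; split=> //; rewrite sub_kermx dq.
by move=> Q h hh /andP[_ hd']; apply: superfluous kd hh hd'.
Qed.

End Tau.

Section Coords.
Variable m : nat.
Hypothesis m3 : (m < 3)%N.
Let F := model (free_ix m).
Let H := model (dual_ix m).

Definition dbasis (x : nat) : 'M[K]_(rdim F, rdim (model 4)) := zmx (dm (free_ix m)) 6 (dual_basis m x).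
Definition lmx c : 'M[K]_(rdim (model 4)) := zmx 6 6 (lmat c).

Lemma dim_dual : dm (dual_ix m) = (6 * m)%N.
Proof. by have /and5P[_ /eqP] := allnP _ _ free_ok m m3. Qed.

Lemma dbasis_test (j : 'I_(rdim H)) : [/\ rhom F (model 4) (dbasis j),
  forall c, dbasis j *m lmx c = \sum_i act H c i j *: dbasis i &
  forall k : 'I_(rdim H), (gen K m (k %/ 6) *m dbasis j) 0 (inord (k %% 6) : 'I_6) = (j == k)%:R].
Proof.
have jm : (j < 6 * m)%N by rewrite -dim_dual; apply: ltn_ord.
have test k : (k < 6 * m)%N -> (k %/ 6 < m)%N by rewrite ltn_divLR // mulnC.
have /and3P[hj /allP ha _] := allnP _ _ (allnP _ _ coords_ok m m3) j jm.
split; first exact: hom_testP.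
  move=> c; have /(@zmx_eq K) : leqm (dm (free_ix m)) 6 (lmul (dm (free_ix m)) 6 6 (dual_basis m j) (lmat c))
     (lbig (dm (free_ix m)) 6 (6 * m)
          (fun k => lscal (dm (free_ix m)) 6 (ent (lact (dual_ix m) c) k j) (dual_basis m k))).
    by apply: ha; case: c; rewrite !inE.
  rewrite -zmxM -dim_dual => e; apply: (etrans e); rewrite -zmx_big; apply: eq_bigr => k _.
  by rewrite -zmxZ modelE mxE.
move=> k; have km : (k < 6 * m)%N by rewrite -dim_dual; apply: ltn_ord.
rewrite /dbasis gen_row ?test // mxE inordK ?ltn_mod //.
have /and3P[_ _ /allnP/(_ j jm)/Z.eqb_eq e] := allnP _ _ (allnP _ _ coords_ok m m3) k km.
rewrite [ent _ _ _]e eq_sym -val_eqE /=; by case: eqP.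
Qed.

Lemma coords_model : hom_coords F (model 4) (lmx false) (lmx true) H (fun x => dbasis x).
Proof.
(* The dual coordinates: [phi h k] reads the coefficient of word k mod 6 in the image of generator k
   div 6. They give the Kronecker delta on [dbasis], whence independence, and they determine [h],
   whence spanning. *)
pose phi (h : 'M[K]_(rdim F, rdim (model 4))) (k : 'I_(rdim H)) : K :=
  (gen K m (k %/ 6) *m h) 0 (inord (k %% 6) : 'I_6).
have phi_sum (x : 'rV[K]_(rdim H)) k : phi (\sum_i x 0 i *: dbasis i) k = x 0 k.
  rewrite /phi mulmx_sumr summxE (bigD1 k) //= big1 ?addr0.
    by have [_ _ h] := dbasis_test k; rewrite -scalemxAr mxE h eqxx mulr1.
  move=> j jk; have [_ _ h] := dbasis_test j.
  by rewrite -scalemxAr mxE h (negPf jk) mulr0.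
split.
- by move=> j; have [] := dbasis_test j.
- rewrite -kermx_eq0; apply/eqP/row_matrixP => k; rewrite row0.
  set v := row k _; have vM : v *m \matrix_(j < rdim H) mxvec (dbasis j) = 0.
    by rewrite /v -row_mul mulmx_ker row0.
  have v0 : \sum_i v 0 i *: dbasis i = 0.
    apply: (can_inj mxvecK); rewrite linear0 -[RHS]vM mulmx_sum_row linear_sum.
    by apply: eq_bigr => j _; rewrite rowK linearZ.
  by apply/rowP => j; rewrite -phi_sum v0 /phi mulmx0 !mxE.
- move=> h hh; pose x : 'rV[K]_(rdim H) := \row_k phi h k.
  have -> : h = \sum_i x 0 i *: dbasis i.
    apply: (free_inj m3) => //.
      by apply: rhom_sum => j _; apply: rhomZ; have [] := dbasis_test j.
    move=> l lm; apply/rowP => w.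
    have w6 : (w < 6)%N := ltn_ord w.
    have kl : (6 * l + w < rdim H)%N.
      by rewrite [rdim H]dim_dual (leq_trans (n := 6 * l.+1)) ?leq_mul2l // mulnS addnC ltn_add2r.
    have e1 : ((6 * l + w) %/ 6 = l)%N by rewrite mulnC divnMDl // divn_small // addn0.
    have e2 : ((6 * l + w) %% 6 = w)%N by rewrite mulnC modnMDl modn_small.
    have := phi_sum x (Ordinal kl); rewrite [x 0 _]mxE /phi /= e1 e2.
    have -> : inord w = w :> 'I_6 by apply: val_inj; rewrite /= inordK.
    by move=> ->.
  apply/submxP; exists x; rewrite mulmx_sum_row linear_sum.
  by apply: eq_bigr => j _; rewrite rowK linearZ.
- by move=> j; have [_ /(_ false) h _] := dbasis_test j.
- by move=> j; have [_ /(_ true) h _] := dbasis_test j.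
Qed.

End Coords.

Lemma tau_model i : (i < 4)%N -> is_tau (model (omega_ix i)) (model i.+1).
Proof.
move=> i4; have [_ r1 r2] := rank3 (ltnW i4).
have [_ [_ [[_ _ _ hF] [t [ht ft et]]]]] := coverP i4.
have /andP[/andP[hl0 /(@zmx_eq K) el0] /andP[hl1 /(@zmx_eq K) el1]] := left_ok.
exists (model 4), (e0 K), (lmx false), (lmx true), (model (free_ix (rk2 i))), (model (free_ix (rk1 i))).
exists (d2 i), (q1 i), (model (dual_ix (rk2 i))), (fun x => dbasis (rk2 i) x).
exists (model (dual_ix (rk1 i))), (fun x => dbasis (rk1 i) x).
exists (zmx (dm (dual_ix (rk2 i))) (dm (dual_ix (rk1 i))) (item dualpres i)), t; split.
- exact: rgen_e0.
- split; [exact: hom_testP| |exact: hom_testP|].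
    by rewrite /e0 /lmx [LHS]zmxM el0 -zmxM.
  by rewrite /e0 /lmx [LHS]zmxM el1 -zmxM.
- exact: min_pres_model.
- split; [exact: coords_model | exact: coords_model|].
  move=> j; rewrite hF //; apply: eq_bigr => k _; by rewrite [X in _ = X *: _]mxE.
- by split.
Qed.

Lemma tau2_model i : (i < 4)%N -> tau2 (model i) (model i.+1).
Proof. by move=> i4; exists (model (omega_ix i)); split; [apply: syzygy_model | apply: tau_model]. Qed.

Lemma ext1_model i j : (i < 5)%N -> (j < 5)%N -> ext1_zero (model i) (model j).
Proof.
move=> i5 j5; have [i4|] := ltnP i 4; last first.
  move=> i4; have -> : i = 4%N by apply/eqP; rewrite eqn_leq i4 -ltnS i5.
  (* N_4 = A is projective, so every extension of it splits by lifting the identity. *)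
  have pr : rproj (model 4) := @free_proj K 1 isT.
  move=> E u p hu hp fu fp _.
  by have [h [hh hE]] := pr E (model 4) p _ hp fp (rhom1 _); exists h.
have [r0 r1 r2] := rank3 i5; have [hp hd dp kp fp] := resP i5.
have [[hd2 hq _ qio dq] _] := coverP i4.
have dd : d2 i *m d1 i = 0 by rewrite -qio mulmxA dq mul0mx.
apply: (ext1_of_resolution (@free_proj K _ r0) hd hp fp kp dp dd) => y hy dy.
have := allnP _ _ (allnP _ _ ext_cert_ok i i4) j j5; rewrite /ext_cert_test.
case: (nth _ (nth _ cert_ext i) j) => c [U V] /andP[cp /allnP cert].
pose v l := gen K (rk1 i) l *m y.
pose E1 k l' := zmx (K := K) (dm j) (dm j) (elt (grow (item pres1 i) l') k j).
pose VV l k := zmx (K := K) (dm j) (dm j) (lblk (dm j) (dm j) V l k).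
have sol := @solve_cert (rk1 i) (rk2 i) (dm j) v (dm j)
  (fun l r => zmx (dm j) (dm j) (elt (grow (item pres2 i) r) l j))
  (fun r l' => zmx (dm j) (dm j) (lblk (dm j) (dm j) U r l'))
  (fun l l' => \sum_(k < rk0 i) VV l k *m E1 k l') (zr c).
(* The map on P_0 prescribed at the generators by the [V] part of the certificate, divided by
   [c]. *)
pose z : 'M[K]_(rdim (model (free_ix (rk0 i))), rdim (model j)) :=
  @free_map K (rk0 i) (model j) (fun k => (zr c)^-1 *: \sum_(l < rk1 i) v l *m VV l k).
have hz : rhom (model (free_ix (rk0 i))) (model j) z by apply: free_map_hom.
exists z => //; apply: (free_inj r1) => //; first exact: rhomM hd hz.
move=> l' l'm; have c0 := zr_neq0 cp.
rewrite mulmxA gen_d1 // (row_gen r0) //; apply: (scalerI c0); rewrite -/(v l') sol //.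
- rewrite scaler_sumr; under eq_bigr do rewrite mulmx_sumr; rewrite exchange_big.
  apply: eq_bigr => k _; rewrite gen_free_map // scalemxAl scalerA mulfV // scale1r mulmx_suml.
  by apply: eq_bigr => l _; rewrite mulmxA.
- move=> l k lm km; have /allnP/(_ k km)/(@zmx_eq K) := cert l lm.
  rewrite -zmxD -!zmx_big => e.
  transitivity (zmx (K := K) (dm j) (dm j) (if l == k then lid (dm j) c else [::])).
    by rewrite -e; congr (_ + _); apply: eq_bigr => r _; rewrite -zmxM.
  by case: eqP => _; rewrite ?zmx_id ?zmx0.
move=> r rm; rewrite -(row_gen r1) //.
have e : gen K (rk2 i) r *m d2 i = zmx 1 (dm (free_ix (rk1 i))) [:: grow (item pres2 i) r].
  by rewrite /d2 gen_row.
by rewrite -e -mulmxA dy mulmx0.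
Qed.

(** * From the explicit modules to the theorem *)

Lemma iso_model (M : nat -> rep K) : is_DA (M 0%N) -> (forall i, (i < 4)%N -> tau2 (M i) (M i.+1)) ->
  forall i, (i < 5)%N -> iso (M i) (model i).
Proof.
move=> [e ge] tM; elim=> [|i IH] i5; first exact: lgen_iso ge (@lgen_l0 K).
apply: tau2_iso (IH (ltnW i5)) (tM i i5) (tau2_model i5).
Qed.

Lemma add_model X : (forall j, (j < 5)%N -> ext1_zero (model j) X) -> fadd 5 model X.
Proof.
move=> ext.
apply: (@add_of_no_ext K 5 model (fun i => model (src_ix i)) (fun i => model (mid_ix i))
  smx tmx weight 4 (e0 K) X) => //.
- exact: rgen_e0.
- by move=> i i5; have [_ h _ _] := seqP i5.
- by move=> i i5; have [_ _ h _] := seqP i5.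
- move=> i i5; have k18 : (src_ix i < 18)%N by exact: (allnP 5 (fun x => src_ix x < 18)%N isT i i5).
  exists (size (parts (src_ix i))), (fun l => part (src_ix i) l).
  exists (fun l => prj K (src_ix i) l), (fun l => inc K (src_ix i) l); split.
    by move=> l; have [] := arrowP i5 (ltn_ord l).
  by have [_] := partsP K k18.
- move=> i i5; have k18 : (mid_ix i < 18)%N by exact: (allnP 5 (fun x => mid_ix x < 18)%N isT i i5).
  have p5 : alln (size (parts (mid_ix i))) (fun l => part (mid_ix i) l < 5)%N.
    by exact: (allnP 5 (fun i => alln (size (parts (mid_ix i))) (fun l => part (mid_ix i) l < 5)%N) isT i i5).
  have [hpi pi1] := partsP K k18.
  exists (size (parts (mid_ix i))), (fun l => part (mid_ix i) l).
  exists (fun l => prj K (mid_ix i) l), (fun l => inc K (mid_ix i) l); split=> // l.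
  by have [hi hp] := hpi l (ltn_ord l); split=> //; apply: (allnP _ _ p5).
- by move=> i j f i5 j5 hf; apply: hom_radical.
move=> i f i5 hf sf; have [hs ht _ [p [hp fp ks tp kp]]] := seqP i5.
have extW : ext1_zero (model (epi_ix i)) X.
  (* For i = 0 the sequence ends in N_{-1} = 0, whose cocycles are matrices without rows. *)
  have [i0|i0] := posnP i.
    rewrite i0; apply: ext1_zeroP => e _; exists 0 => c.
    by apply/matrixP => -[].
  apply: ext; move: i5 i0; clear; case: i => [|[|[|[|[|i]]]]] //.
exact: ext1_extend extW ht hp fp ks tp kp hf sf.
Qed.

End Char0.

Theorem theorem2 (K : fieldType) (charK0 : [pchar K]%R =i pred0)
  (M0 M1 M2 M3 M4 : rep K) :
  is_DA M0 -> tau2 M0 M1 -> tau2 M1 M2 -> tau2 M2 M3 -> tau2 M3 M4 ->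
  cluster_tilting2 (dsum M0 (dsum M1 (dsum M2 (dsum M3 M4)))).
Proof.
move=> h0 h1 h2 h3 h4; set M := dsum _ _.
pose Ms i := nth M0 [:: M0; M1; M2; M3; M4] i.
have isoM i : (i < 5)%N -> iso (Ms i) (model K i).
  by apply: iso_model => //; case=> [|[|[|[|j]]]].
have Madd i : (i < 5)%N -> in_add M (model K i).
  move=> i5; apply: in_add_trans (in_add_iso (isoM i i5)).
  have c1 := in_add_trans (in_add_dsumr M0 _) (in_add_dsumr M1 (dsum M2 (dsum M3 M4))).
  have c2 := in_add_trans c1 (in_add_dsumr M2 (dsum M3 M4)).
  case: i i5 => [|[|[|[|[|i]]]]] // _.
  - exact: in_add_dsuml.
  - exact: in_add_trans (in_add_dsumr _ _) (in_add_dsuml _ _).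
  - exact: in_add_trans c1 (in_add_dsuml _ _).
  - exact: in_add_trans c2 (in_add_dsuml _ _).
  - exact: in_add_trans c2 (in_add_dsumr _ _).
have extM i j : (i < 5)%N -> (j < 5)%N -> ext1_zero (Ms i) (Ms j).
  move=> i5 j5; apply: in_add_ext1_l (in_add_iso (iso_sym (isoM i i5))) _.
  exact: in_add_ext1_r (in_add_iso (iso_sym (isoM j j5))) (ext1_model charK0 i5 j5).
have extMl j : (j < 5)%N -> ext1_zero M (Ms j).
  move=> j5; do 4?[apply: ext1_dsuml];
  [exact: (extM 0%N)|exact: (extM 1%N)|exact: (extM 2)|exact: (extM 3)|exact: (extM 4)].
apply: cluster_tilting2_half.
(* A is a summand of [M] and is generated by [e0], so each vector of [X] is the image of [e0] under
   a map that factors through copies of [M]. *)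
- move=> X v; have [f hf <-] := rgen_hom v (@rgen_e0 K).
  have [k [i [q [hiq iq]]]] := Madd 4 isT.
  exists k, (fun j => e0 K *m i j), (fun j => q j *m f); split.
    by move=> j; apply: rhomM hf; have [] := hiq j.
  rewrite -[f in LHS]mul1mx -iq mulmx_suml mulmx_sumr; apply: eq_bigr => j _.
  by rewrite !mulmxA.
- do 4?[apply: ext1_dsumr];
  [exact: (extMl 0%N)|exact: (extMl 1%N)|exact: (extMl 2)|exact: (extMl 3)|exact: (extMl 4)].
move=> X hX; apply: (in_add_fadd Madd); apply: add_model => // j j5.
exact: in_add_ext1_l (Madd j j5) hX.
Qed.
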